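(* Let $\mathbf{k}$ be an algebraically closed field of characteristic zero, and let $\Delta$ and $\Delta'$ be (arbitrary) simplicial complexes on $[n]$ and $[n']$. If $$\operatorname{Aut}\bigl(X_\Delta\times\mathbb A^1\bigr)\cong\operatorname{Aut}\bigl(X_{\Delta'}\times\mathbb A^1\bigr)$$ as ind-groups, then $\Delta\cong\Delta'$ as abstract simplicial complexes and $X_\Delta\cong X_{\Delta'}$ as algebraic varieties.
   Context: $\mathbf{k}$ is an algebraically closed field of characteristic zero. For $n\ge 1$, $[n]=\{1,\dots,n\}$. A simplicial complex $\Delta$ on $[n]$ is a collection of subsets of $[n]$ (faces) closed under taking subsets; it is always assumed that $\{i\}\in\Delta$ for every $i\in[n]$. Stanley-Reisner variety: $\mathbf k[\Delta]=\mathbf k[x_1,\dots,x_n]/I_\Delta$ with $I_\Delta=(\prod_{i\in\sigma}x_i:\sigma\subseteq[n],\sigma\notin\Delta)$ and $X_\Delta=\operatorname{Spec}\mathbf k[\Delta]$. Ind-varieties and ind-groups: an ind-variety is a set $\mathcal V$ with an ascending filtration $\mathcal V_0\subseteq\mathcal V_1\subseteq\cdots$ with union $\mathcal V$, each $\mathcal V_k$ an algebraic variety (not necessarily irreducible) and each inclusion a closed immersion. A morphism $\varphi:\mathcal V\to\mathcal W$ is a map such that for each $k$ there is $\ell$ with $\varphi(\mathcal V_k)\subseteq\mathcal W_\ell$ and $\varphi|_{\mathcal V_k}:\mathcal V_k\to\mathcal W_\ell$ a morphism of varieties. An ind-group is a group with an ind-variety structure for which multiplication and inversion are morphisms. An isomorphism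 of ind-groups is a group isomorphism that is also an isomorphism of ind-varieties. Ind-group structure on automorphism groups: $X_\Delta\times\mathbb A^1$ is the affine variety with coordinate ring $A=\mathbf k[\Delta][x_v]$ ($x_v$ a new variable), graded by total degree and generated by $\overline{x}_1,\dots,\overline{x}_n,x_v$ (it is the Stanley-Reisner ring of the cone over $\Delta$). With $A_{\le d}$ the finite-dimensional subspace of elements of degree $\le d$, an endomorphism of $A$ is identified with the tuple of images of the generators, and endomorphisms with images of degree $\le d$ form a closed subvariety of $(A_{\le d})^{n+1}$. $\operatorname{Aut}(X_\Delta\times\mathbb A^1)=\operatorname{Aut}_{\mathbf k}(A)$ is identified with the set of pairs $(\varphi,\varphi^{-1})$, and the $d$-th filtration piece consists of pairs for which $\varphi$ and $\varphi^{-1}$ both send every generator to an element of degree at most $d$. *)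

(* Defs.v *)
From HB Require Import structures.
From mathcomp Require Import all_boot all_order all_algebra.
From mathcomp Require Import boolp.
From mathcomp Require classical_sets.
From mathcomp Require Import mpoly.

Set Implicit Arguments.
Unset Strict Implicit.
Unset Printing Implicit Defensive.

Import GRing.Theory.
Local Open Scope ring_scope.
Local Open Scope quotient_scope.

(* The vertex set [n] is 'I_n. For n >= 1 the field [faces0] follows from the
   other two; for n = 0 it only rules out the void complex. *)
Record simplicial_complex (n : nat) := SimplicialComplex {
  faces :> {set {set 'I_n}};
  faces_sub : forall s t : {set 'I_n}, s \in faces -> t \subset s -> t \in faces;
  faces1 : forall i : 'I_n, [set i] \in faces;
  faces0 : set0 \in faces }.

Definition complex_isomorphic n n'
    (D : simplicial_complex n) (D' : simplicial_complex n') :=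
  exists f : 'I_n -> 'I_n', bijective f /\
    forall s : {set 'I_n}, (s \in D) = (f @: s \in D').

Section StanleyReisner.
Variables (k : fieldType) (n : nat) (D : simplicial_complex n).

Definition sr_ideal (p : {mpoly k[n]}) : bool :=
  `[< exists q : {set 'I_n} -> {mpoly k[n]},
        p = \sum_(s : {set 'I_n} | s \notin D) q s * \prod_(i in s) 'X_i >].

Lemma sr_ideal_closed : idealr_closed sr_ideal.
Proof.
split=> [||a u v /asboolP[q qE] /asboolP[r rE]].
- apply/asboolP; exists (fun=> 0); rewrite big1 // => s _; exact: mul0r.
- apply/asboolP => -[q /(congr1 (meval (fun=> 0 : k)))].
  rewrite meval1 raddf_sum big1 => [/eqP|s sD]; first by rewrite oner_eq0.
  have [i si] : exists i, i \in s.
    by apply/set0Pn; apply: contraNneq sD => ->; exact: faces0.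
  by rewrite /= mevalM rmorph_prod (bigD1 i) //= mevalXU mul0r mulr0.
- apply/asboolP; exists (fun s => a * q s + r s).
  rewrite qE rE mulr_sumr -big_split /=.
  by apply: eq_bigr => s _; rewrite mulrDl mulrA.
Qed.

HB.instance Definition _ := isIdealr.Build {mpoly k[n]} sr_ideal sr_ideal_closed.

Definition sr_ring := {ideal_quot (sr_ideal : idealr {mpoly k[n]})}.
HB.instance Definition _ := GRing.ComNzRing.on sr_ring.

Definition sr_pi (p : {mpoly k[n]}) : sr_ring := \pi p.

Fact sr_pi_nmod : nmod_morphism sr_pi.
Proof. by split=> [|x y]; rewrite /sr_pi !piE. Qed.
Fact sr_pi_monoid : monoid_morphism sr_pi.
Proof. by split=> [|x y]; rewrite /sr_pi !piE. Qed.
HB.instance Definition _ :=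
  GRing.isNmodMorphism.Build {mpoly k[n]} sr_ring sr_pi sr_pi_nmod.
HB.instance Definition _ :=
  GRing.isMonoidMorphism.Build {mpoly k[n]} sr_ring sr_pi sr_pi_monoid.

Definition sr_scale (c : k) (x : sr_ring) := sr_pi c%:MP * x.

Fact sr_scaleA a b x : sr_scale a (sr_scale b x) = sr_scale (a * b) x.
Proof. by rewrite /sr_scale mulrA -rmorphM -mpolyCM. Qed.
Fact sr_scale1 : left_id 1 sr_scale.
Proof. by move=> x; rewrite /sr_scale mpolyC1 rmorph1 mul1r. Qed.
Fact sr_scaleDr : right_distributive sr_scale +%R.
Proof. by move=> c x y; rewrite /sr_scale mulrDr. Qed.
Fact sr_scaleDl x : {morph sr_scale^~ x : a b / a + b}.
Proof. by move=> a b; rewrite /sr_scale mpolyCD rmorphD mulrDl. Qed.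
HB.instance Definition _ := GRing.Zmodule_isLmodule.Build k sr_ring
  sr_scaleA sr_scale1 sr_scaleDr sr_scaleDl.
Fact sr_scaleAl (c : k) (x y : sr_ring) : c *: (x * y) = (c *: x) * y.
Proof. exact: mulrA. Qed.
HB.instance Definition _ := GRing.Lmodule_isLalgebra.Build k sr_ring sr_scaleAl.
HB.instance Definition _ := GRing.Lalgebra_isComAlgebra.Build k sr_ring.

Definition sr_gen (i : 'I_n) : sr_ring := sr_pi 'X_i.

Lemma sr_pi_alg (c : k) : c%:A = sr_pi c%:MP :> sr_ring.
Proof. exact: mulr1. Qed.

End StanleyReisner.

Section PolyAlgebra.
Variables (k : fieldType) (B : comAlgType k).

(* [{poly B}] itself carries the scalars B, hence the alias. *)
Definition poly_ext := {poly B}.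
HB.instance Definition _ := GRing.ComNzRing.on poly_ext.

Definition poly_ext_scale (c : k) (p : poly_ext) : poly_ext := c%:A%:P * p.

Fact poly_ext_scaleA a b p :
  poly_ext_scale a (poly_ext_scale b p) = poly_ext_scale (a * b) p.
Proof. by rewrite /poly_ext_scale mulrA -polyCM -scalerAl mul1r scalerA. Qed.
Fact poly_ext_scale1 : left_id 1 poly_ext_scale.
Proof. by move=> p; rewrite /poly_ext_scale scale1r mul1r. Qed.
Fact poly_ext_scaleDr : right_distributive poly_ext_scale +%R.
Proof. by move=> c p q; rewrite /poly_ext_scale mulrDr. Qed.
Fact poly_ext_scaleDl p : {morph poly_ext_scale^~ p : a b / a + b}.
Proof. by move=> a b; rewrite /poly_ext_scale scalerDl polyCD mulrDl. Qed.
HB.instance Definition _ := GRing.Zmodule_isLmodule.Build k poly_ext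
  poly_ext_scaleA poly_ext_scale1 poly_ext_scaleDr poly_ext_scaleDl.
Fact poly_ext_scaleAl (c : k) (p q : poly_ext) : c *: (p * q) = (c *: p) * q.
Proof. exact: mulrA. Qed.
HB.instance Definition _ :=
  GRing.Lmodule_isLalgebra.Build k poly_ext poly_ext_scaleAl.
HB.instance Definition _ := GRing.Lalgebra_isComAlgebra.Build k poly_ext.

Lemma poly_ext_alg (c : k) : c%:A = (c%:A : B)%:P :> poly_ext.
Proof. exact: mulr1. Qed.

End PolyAlgebra.

Section FgAlg.
Variable k : fieldType.

Record fg_algebra := FgAlgebra {
  fg_alg :> comAlgType k;
  fg_num : nat;
  fg_gen : 'I_fg_num -> fg_alg;
  fg_genP : forall a, exists p, a = mmap (in_alg fg_alg) fg_gen p }.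

Lemma sr_alg_genP n (D : simplicial_complex n) (a : sr_ring k D) :
  exists p, a = mmap (in_alg (sr_ring k D)) (@sr_gen k n D) p.
Proof.
exists (repr a); rewrite -[LHS]reprK; rewrite -/(sr_pi D (repr a)).
elim/mpolyind: (repr a) => [|c m p _ _ IHp]; first by rewrite raddf0 mmap0.
rewrite raddfD /= mmapD IHp; congr (_ + _).
rewrite mmapZ mmapX -mul_mpolyC rmorphM /= -sr_pi_alg; congr (_ * _).
rewrite mpolyXE_id rmorph_prod; apply: eq_bigr => i _; exact: rmorphXn.
Qed.

Definition sr_alg n (D : simplicial_complex n) : fg_algebra :=
  FgAlgebra (@sr_alg_genP n D).

Section PolyAlg.
Variable B : fg_algebra.

Definition poly_gen (i : 'I_(fg_num B).+1) : poly_ext B :=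
  if unlift ord_max i is Some j then (fg_gen j)%:P else 'X.

Lemma poly_alg_genP (a : poly_ext B) :
  exists p, a = mmap (in_alg (poly_ext B)) poly_gen p.
Proof.
elim/poly_ind: a => [|a b [p ->]]; first by exists 0; rewrite mmap0.
have [q ->] := fg_genP b.
exists (p * 'X_ord_max + mmap (@mpolyC _ k) (fun j => 'X_(lift ord_max j)) q).
rewrite mmapD rmorphM /= mmapX mmap1U {3}/poly_gen unlift_none; congr (_ + _).
elim/mpolyind: q => [|c m q _ _ IHq]; first by rewrite !mmap0.
rewrite !mmapD polyCD IHq; congr (_ + _).
rewrite !mmapZ !mmapX polyCM rmorphM /= mmapC /= -poly_ext_alg; congr (_ * _).
rewrite !rmorph_prod; apply: eq_bigr => i _.
by rewrite !rmorphXn /= mmapX mmap1U /poly_gen liftK.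
Qed.

Definition poly_alg : fg_algebra := FgAlgebra poly_alg_genP.

End PolyAlg.
End FgAlg.

Section AffineVarieties.
Variable k : closedFieldType.

(* The k-algebra of functions generated by S. *)
Inductive alg_gen V (S : (V -> k) -> Prop) : (V -> k) -> Prop :=
| AlgGen f of S f : alg_gen S f
| AlgGenC c : alg_gen S (fun=> c)
| AlgGenD f g of alg_gen S f & alg_gen S g : alg_gen S (fun v => f v + g v)
| AlgGenM f g of alg_gen S f & alg_gen S g : alg_gen S (fun v => f v * g v).

(* An affine variety with point set V, given by its algebra of regular functions:
   some coordinates c identify V with the Zariski closed subset of k^N defined by
   the polynomials in S, and the regular functions with the polynomial ones. *)
Record affine_variety (V : Type) := AffineVariety {
  regular : (V -> k) -> Prop;
  regularP : exists (N : nat) (c : V -> 'I_N -> k) (S : {mpoly k[N]} -> Prop),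
    [/\ injective c,
        forall x, (exists v, c v = x) <-> (forall p, S p -> p.@[x] = 0)
      & forall f, regular f <-> exists p : {mpoly k[N]}, f = fun v => p.@[c v]] }.

Definition var_morphism V W (X : affine_variety V) (Y : affine_variety W)
    (f : V -> W) :=
  forall h, regular Y h -> regular X (h \o f).

Definition var_isomorphic V W (X : affine_variety V) (Y : affine_variety W) :=
  exists (f : V -> W) (g : W -> V),
    [/\ cancel f g, cancel g f, var_morphism X Y f & var_morphism Y X g].

Definition zariski_closed V (X : affine_variety V) (Z : V -> Prop) :=
  exists2 S : (V -> k) -> Prop, (forall h, S h -> regular X h)
    & forall v, Z v <-> (forall h, S h -> h v = 0).

(* An isomorphism onto a closed subvariety, the regular functions of the latter
   being the restrictions of those of Y. *)
Definition closed_immersion V W (X : affine_variety V) (Y : affine_variety W)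
    (i : V -> W) :=
  [/\ injective i, zariski_closed Y (fun w => exists v, i v = w)
    & forall h, regular X h <-> exists2 h', regular Y h' & h = h' \o i].

Lemma alg_gen_sub V (S S' : (V -> k) -> Prop) f :
  (forall g, S g -> alg_gen S' g) -> alg_gen S f -> alg_gen S' f.
Proof.
move=> SS'; elim=> [g /SS'//|c|g h _ ? _ ?|g h _ ? _ ?].
- exact: AlgGenC.
- exact: AlgGenD.
- exact: AlgGenM.
Qed.

Lemma alg_gen_comp V W (S : (V -> k) -> Prop) (S' : (W -> k) -> Prop)
    (i : W -> V) f :
  (forall g, S g -> alg_gen S' (g \o i)) -> alg_gen S f -> alg_gen S' (f \o i).
Proof.
move=> SS'; elim=> [g /SS'//|c|g h _ ? _ ?|g h _ ? _ ?].
- exact: AlgGenC.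
- exact: (AlgGenD (f := g \o i)).
- exact: (AlgGenM (f := g \o i)).
Qed.

Lemma alg_gen_sum V (S : (V -> k) -> Prop) I (r : seq I) (F : I -> V -> k) :
  (forall i, alg_gen S (F i)) -> alg_gen S (fun v => \sum_(i <- r) F i v).
Proof.
move=> SF; elim: r => [|i r IHr].
  by under eq_fun do rewrite big_nil; exact: AlgGenC.
by under eq_fun do rewrite big_cons; exact: AlgGenD.
Qed.

Lemma alg_gen_prod V (S : (V -> k) -> Prop) I (r : seq I) (F : I -> V -> k) :
  (forall i, alg_gen S (F i)) -> alg_gen S (fun v => \prod_(i <- r) F i v).
Proof.
move=> SF; elim: r => [|i r IHr].
  by under eq_fun do rewrite big_nil; exact: AlgGenC.
by under eq_fun do rewrite big_cons; exact: AlgGenM.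
Qed.

Lemma alg_gen_exp V (S : (V -> k) -> Prop) f n :
  alg_gen S f -> alg_gen S (fun v => f v ^+ n).
Proof.
move=> Sf; elim: n => [|n IHn].
  by under eq_fun do rewrite expr0; exact: AlgGenC.
by under eq_fun do rewrite exprS; exact: AlgGenM.
Qed.

Lemma alg_gen_mpoly V (S : (V -> k) -> Prop) N (c : V -> 'I_N -> k)
    (p : {mpoly k[N]}) :
  (forall i, alg_gen S (c^~ i)) -> alg_gen S (fun v => p.@[c v]).
Proof.
move=> Sc; under eq_fun do rewrite mevalE.
apply: alg_gen_sum => m; apply: AlgGenM; first exact: AlgGenC.
by apply: alg_gen_prod => i; exact: alg_gen_exp.
Qed.

Lemma alg_gen_finP V N (c : V -> 'I_N -> k) (f : V -> k) :
  alg_gen (fun g => exists i, g = c^~ i) f <->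
  exists p : {mpoly k[N]}, f = fun v => p.@[c v].
Proof.
split=> [|[p ->]]; last by apply: alg_gen_mpoly => i; apply: AlgGen; exists i.
elim=> {f}[_ [i ->]|a|_ _ _ [p ->] _ [q ->]|_ _ _ [p ->] _ [q ->]].
- by exists 'X_i; apply: funext => v; rewrite mevalXU.
- by exists a%:MP; apply: funext => v; rewrite mevalC.
- by exists (p + q); apply: funext => v; rewrite mevalD.
- by exists (p * q); apply: funext => v; rewrite mevalM.
Qed.

Lemma affine_by_coordinates V (I : finType) (c : V -> I -> k)
    (S : ((I -> k) -> k) -> Prop) (reg : (V -> k) -> Prop) :
  injective c ->
  (forall h, S h -> alg_gen (fun g => exists i, g = fun x => x i) h) ->
  (forall x, (exists v, c v = x) <-> (forall h, S h -> h x = 0)) ->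
  (forall f, reg f <-> alg_gen (fun g => exists i, g = c^~ i) f) ->
  exists (N : nat) (c : V -> 'I_N -> k) (S : {mpoly k[N]} -> Prop),
    [/\ injective c,
        forall x, (exists v, c v = x) <-> (forall p, S p -> p.@[x] = 0)
      & forall f, reg f <-> exists p : {mpoly k[N]}, f = fun v => p.@[c v]].
Proof.
move=> c_inj Salg Sc regE.
pose dec (x : 'I_#|I| -> k) (i : I) := x (enum_rank i).
pose enc (x : I -> k) (j : 'I_#|I|) := x (enum_val j).
have decK : cancel enc dec by move=> x; apply: funext => i; rewrite /dec /enc enum_rankK.
have encK : cancel dec enc by move=> x; apply: funext => i; rewrite /dec /enc enum_valK.
exists #|I|, (enc \o c), (fun p => S (fun x => p.@[enc x])); split.
- by move=> u v /(can_inj decK) /c_inj.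
- move=> x; split=> [[v <-] p /= Sp|Sx].
    by apply: (Sc (c v)).1 Sp; exists v.
  have /Sc[v cv] : forall h, S h -> h (dec x) = 0.
    move=> h Sh; have hE : h \o dec = fun x => h (dec x) by [].
    have [p pE] : exists p : {mpoly k[#|I|]}, h \o dec = fun x => p.@[x].
      apply/(alg_gen_finP (fun x => x)); move/Salg: (Sh); apply: alg_gen_comp.
      by move=> _ [i ->]; apply: AlgGen; exists (enum_rank i).
    move: (congr1 (fun f => f x) pE) => /= ->; apply: Sx.
    suff <- : h = fun x => p.@[enc x] by [].
    by apply: funext => y; rewrite -[p.@[_]](congr1 (fun f => f (enc y)) pE) /= decK.
  by exists v; rewrite /= cv encK.
- move=> f; split=> [/regE fS|fS].
    apply/alg_gen_finP; apply: alg_gen_sub fS => _ [i ->]; apply: AlgGen.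
    by exists (enum_rank i); apply: funext => v; rewrite /= /enc enum_rankK.
  apply/regE; apply: alg_gen_sub ((alg_gen_finP _ _).2 fS) => _ [i ->].
  by apply: AlgGen; exists (enum_val i).
Qed.

Lemma regular_alg_gen V (X : affine_variety V) f :
  alg_gen (regular X) f -> regular X f.
Proof.
have [N [c [S [_ _ regX]]]] := regularP X => fX; apply/regX/alg_gen_finP.
by apply: alg_gen_sub fX => g /regX/alg_gen_finP.
Qed.

Lemma closed_immersion_regular V W (X : affine_variety V) (Y : affine_variety W)
    (i : V -> W) :
  (forall h, regular X h <-> exists2 h', regular Y h' & h = h' \o i) ->
  closed_immersion X Y i.
Proof.
move=> regi; have [N [c [S [c_inj cS regX]]]] := regularP X.
have [M [e [T [e_inj _ regY]]]] := regularP Y.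
have /choice[C /all_and2[CY Ci]] : forall j, exists h, regular Y h /\ c^~ j = h \o i.
  move=> j; have /regi[h hY hE] : regular X (c^~ j).
    by apply/regX; exists 'X_j; apply: funext => v; rewrite mevalXU.
  by exists h.
have CE v : (fun j => C j (i v)) = c v.
  by apply: funext => j; exact: (esym (congr1 (fun f => f v) (Ci j))).
have Cp p : regular Y (fun w => p.@[fun j => C j w]).
  by apply/regular_alg_gen/alg_gen_mpoly => j; exact: AlgGen.
pose Z h := (exists2 p, S p & h = fun w => p.@[fun j => C j w]) \/
  (exists (g : W -> k) (p : {mpoly k[N]}), [/\ regular Y g,
     (forall v, g (i v) = p.@[c v]) & h = fun w => g w + -1 * p.@[fun j => C j w]]).
split=> //; first by move=> u v uv; apply: c_inj; rewrite -!CE uv.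
exists Z => [h [[p _ ->]//|[g [p [gY _ ->]]]]|w].
  apply: regular_alg_gen; apply: AlgGenD; first exact: AlgGen.
  by apply: AlgGenM; [exact: AlgGenC | exact: AlgGen].
split=> [[v <-] h [[p Sp ->]|[g [p [_ gp ->]]]]|Zw].
- by rewrite CE; apply: (cS (c v)).1 Sp; exists v.
- by rewrite CE gp mulN1r subrr.
have /cS[v vE] : forall p, S p -> p.@[fun j => C j w] = 0.
  by move=> p Sp; apply: (Zw (fun w => p.@[fun j => C j w])); left; exists p.
exists v; apply: e_inj; apply: funext => j.
have ejY : regular Y (e^~ j).
  by apply/regY; exists 'X_j; apply: funext => u; rewrite mevalXU.
have /regX[p pE] : regular X (e^~ j \o i) by apply/regi; exists (e^~ j).
have gp u : e (i u) j = p.@[c u] by move/(congr1 (fun f => f u)): pE.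
have := Zw (fun w => e w j + -1 * p.@[fun j => C j w]).
rewrite -vE -gp mulN1r => /(_ _)/eqP; rewrite subr_eq0 => H.
by apply/esym/eqP/H; right; exists (e^~ j), p.
Qed.

Section Product.
Variables (V W : Type) (X : affine_variety V) (Y : affine_variety W).

Definition prod_regular : (V * W -> k) -> Prop :=
  alg_gen (fun f => (exists2 g, regular X g & f = g \o fst) \/
                    (exists2 h, regular Y h & f = h \o snd)).

Lemma prod_regularP :
  exists (N : nat) (c : V * W -> 'I_N -> k) (S : {mpoly k[N]} -> Prop),
    [/\ injective c,
        forall x, (exists v, c v = x) <-> (forall p, S p -> p.@[x] = 0)
      & forall f, prod_regular f <-> exists p : {mpoly k[N]}, f = fun v => p.@[c v]].
Proof.
have [N [c [S [c_inj cS regX]]]] := regularP X.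
have [M [d [T [d_inj dT regY]]]] := regularP Y.
pose C (u : V * W) (i : 'I_N + 'I_M) :=
  match i with inl i => c u.1 i | inr j => d u.2 j end.
pose Z (h : ('I_N + 'I_M -> k) -> k) :=
  (exists2 p, S p & h = fun x => p.@[x \o inl]) \/
  (exists2 p, T p & h = fun x => p.@[x \o inr]).
apply: (@affine_by_coordinates _ _ C Z).
- move=> [v w] [v' w'] eqC; congr (_, _).
    by apply: c_inj; apply: funext => i; move/(congr1 (fun f => f (inl i))): eqC.
  by apply: d_inj; apply: funext => i; move/(congr1 (fun f => f (inr i))): eqC.
- move=> _ [[p _ ->]|[p _ ->]]; apply: (alg_gen_mpoly (c := fun x => x \o _)) => i.
    by apply: AlgGen; exists (inl i).
  by apply: AlgGen; exists (inr i).
- move=> x; split=> [[[v w] <-] _ [[p Sp ->]|[p Tp ->]]|Zx].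
  + by apply: (cS _).1 Sp; exists v.
  + by apply: (dT _).1 Tp; exists w.
  + have /cS[v vE] : forall p, S p -> p.@[x \o inl] = 0.
      by move=> p Sp; apply: (Zx (fun x => p.@[x \o inl])); left; exists p.
    have /dT[w wE] : forall p, T p -> p.@[x \o inr] = 0.
      by move=> p Sp; apply: (Zx (fun x => p.@[x \o inr])); right; exists p.
    by exists (v, w); apply: funext => -[i|j]; rewrite /= ?vE ?wE.
- move=> f; split; apply: alg_gen_sub => g.
    case=> [[h /regX[p ->] ->]|[h /regY[p ->] ->]]; apply: alg_gen_mpoly => i.
      by apply: AlgGen; exists (inl i).
    by apply: AlgGen; exists (inr i).
  case=> -[i|i] ->; apply: AlgGen; [left; exists (c^~ i)|right; exists (d^~ i)] => //.
    by apply/regX; exists 'X_i; apply: funext => v; rewrite mevalXU.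
  by apply/regY; exists 'X_i; apply: funext => v; rewrite mevalXU.
Qed.

Definition prod_variety : affine_variety (V * W) := AffineVariety prod_regularP.

End Product.

(* All filtration pieces are affine, as they are for automorphism groups of
   affine varieties. *)
Record ind_variety (T : Type) := IndVariety {
  piece : nat -> T -> Prop;
  piece_var : forall d, affine_variety {x | piece d x};
  piece_sub : forall d x, piece d x -> piece d.+1 x;
  piece_cover : forall x, exists d, piece d x;
  piece_closed : forall d, closed_immersion (piece_var d) (piece_var d.+1)
    (fun x => exist _ (sval x) (piece_sub (svalP x))) }.

Definition ind_morphism T U (V : ind_variety T) (W : ind_variety U) (f : T -> U) :=
  forall d, exists e, exists fE : forall x, piece V d x -> piece W e (f x),
    var_morphism (piece_var V d) (piece_var W e)
      (fun x => exist _ (f (sval x)) (fE _ (svalP x))).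

(* In [ind_mul] the source is filtered by the products V_d x V_d. *)
Record ind_group := IndGroup {
  ind_grp :> groupType;
  ind_var :> ind_variety ind_grp;
  ind_mul : forall d, exists e,
    exists mE : forall x y, piece ind_var d x -> piece ind_var d y ->
                            piece ind_var e (x * y)%g,
    var_morphism (prod_variety (piece_var ind_var d) (piece_var ind_var d))
      (piece_var ind_var e)
      (fun u => exist _ (sval u.1 * sval u.2)%g (mE _ _ (svalP u.1) (svalP u.2)));
  ind_inv : ind_morphism ind_var ind_var (fun x => x^-1%g) }.

Definition ind_group_isomorphic (G H : ind_group) :=
  exists (f : G -> H) (g : H -> G),
    [/\ cancel f g, cancel g f, {morph f : x y / (x * y)%g},
        ind_morphism G H f & ind_morphism H G g].

End AffineVarieties.

Section Morphisms.
Variable k : fieldType.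

Lemma lrmorphism_of_fun (A B : comAlgType k) (F : A -> B) :
  linear F -> monoid_morphism F -> exists f : {lrmorphism A -> B}, f =1 F.
Proof.
move=> Flin Fmon.
pose lin := GRing.isLinear.Build k A B *:%R F Flin.
pose mon := GRing.isMonoidMorphism.Build A B F Fmon.
pose f : {lrmorphism A -> B} := HB.pack F lin mon.
by exists f.
Qed.

Lemma lrmorphism_ext (A B : comAlgType k) (f g : {lrmorphism A -> B}) :
  f =1 g -> f = g.
Proof.
case: f => f cf; case: g => g cg /= fg.
have {fg} fg : f = g by apply: funext.
case: g / fg in cg *; congr GRing.LRMorphism.Pack.
case: cf => -[a] [b] [c]; case: cg => -[a'] [b'] [c'].
by rewrite (Prop_irrelevance a a') (Prop_irrelevance b b') (Prop_irrelevance c c').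
Qed.

Lemma lrmorphism_mmap (A B : comAlgType k) (f : {lrmorphism A -> B}) m
    (a : 'I_m -> A) (p : {mpoly k[m]}) :
  f (mmap (in_alg A) a p) = mmap (in_alg B) (f \o a) p.
Proof.
elim/mpolyind: p => [|c i p _ _ IHp]; first by rewrite !mmap0 raddf0.
rewrite !mmapD raddfD /= IHp; congr (_ + _).
rewrite !mmapZ !mmapX rmorphM /= linearZ /= rmorph1; congr (_ * _).
by rewrite rmorph_prod; apply: eq_bigr => j _; rewrite rmorphXn.
Qed.

Variable A : fg_algebra k.

Lemma fg_ext (B : comAlgType k) (f g : {lrmorphism A -> B}) :
  (forall i, f (fg_gen i) = g (fg_gen i)) -> f =1 g.
Proof.
move=> fg a; have [p ->] := fg_genP a; rewrite !lrmorphism_mmap.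
by congr mmap; apply: funext => i; exact: fg.
Qed.

Lemma fg_morphism (B : comAlgType k) (b : 'I_(fg_num A) -> B) :
  (forall p, mmap (in_alg A) (@fg_gen k A) p = 0 -> mmap (in_alg B) b p = 0) ->
  exists f : {lrmorphism A -> B}, forall i, f (fg_gen i) = b i.
Proof.
move=> rel; have /choice[q qE] := @fg_genP k A.
pose F a := mmap (in_alg B) b (q a).
have FE a p : a = mmap (in_alg A) (@fg_gen k A) p -> F a = mmap (in_alg B) b p.
  move=> aE; apply/eqP; rewrite -subr_eq0 /F -mmapB; apply/eqP/rel.
  by rewrite mmapB -qE -aE subrr.
have Flin : linear F.
  move=> c x y; rewrite (FE _ (c *: q x + q y)).
    by rewrite mmapD mmapZ mulr_algl.
  by rewrite mmapD mmapZ -!qE /= mulr_algl.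
have Fmon : monoid_morphism F.
  split=> [|x y].
    by rewrite (FE _ 1) ?rmorph1.
  by rewrite (FE _ (q x * q y)) ?rmorphM //= -!qE.
have [f fE] := lrmorphism_of_fun Flin Fmon.
exists f => i; rewrite fE (FE _ 'X_i) mmapX mmap1U //.
Qed.

Lemma functional_sep (a : A) : a != 0 -> exists l : {scalar A}, l a = 1.
Proof.
move=> a0.
pose P (U : classical_sets.set A) :=
  (forall c x y, U x -> U y -> U (c *: x + y)) /\ ~ U a.
have [F FP totF|U [[Ulin Ua] Umax]] := @classical_sets.Zorn_bigcup A P.
  split=> [c x y [X FX Xx] [Y FY Yy]|[X FX Xa]]; last exact: (FP _ FX).2 Xa.
  have [XY|YX] := totF _ _ FX FY; [exists Y|exists X] => //.
    by apply: (FP _ FY).1 => //; exact: XY.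
  by apply: (FP _ FX).1 => //; exact: YX.
have U0 : U 0.
  apply: contrapT => nU0.
  have [x Ux] : exists x, U x.
    apply: contrapT => nU.
    have : ~ P (fun y => y = 0).
      apply: Umax; split; last by move=> /(_ 0 erefl) ?; apply: nU; exists 0.
      by move=> y Uy; case: nU; exists y.
    apply; split=> [c x y -> ->|/eqP]; first by rewrite scaler0 addr0.
    by rewrite (negbTE a0).
  by apply: nU0; rewrite -(addNr x) -scaleN1r; exact: Ulin.
have UZ c x : U x -> U (c *: x) by move=> Ux; rewrite -[_ *: _]addr0; exact: Ulin.
have UD x y : U x -> U y -> U (x + y).
  by move=> Ux Uy; rewrite -[x]scale1r; exact: Ulin.
have dec x : exists c, U (x - c *: a).
  apply: contrapT => nx.
  have nUx : ~ U x by move=> Ux; apply: nx; exists 0; rewrite scale0r subr0.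
  pose U' : classical_sets.set A := fun y => exists c, U (y - c *: x).
  have : ~ P U'.
    apply: Umax; split=> [y Uy|UU]; first by exists 0; rewrite scale0r subr0.
    by apply: nUx; apply: UU; exists 1; rewrite scale1r subrr.
  apply; split=> [c y z [d Ud] [e Ue]|[c Uc]].
    exists (c * d + e); have := Ulin c _ _ Ud Ue.
    by rewrite scalerBr scalerA scalerDl opprD addrACA.
  have c0 : c != 0.
    by apply: contra_notN Ua => /eqP c0; rewrite c0 scale0r subr0 in Uc.
  apply: nx; exists c^-1; have := UZ (- c^-1) _ Uc.
  by rewrite scalerBr scalerA mulNr mulVf // scaleN1r opprK scaleNr addrC.
have /choice[l lU] := dec.
have lE x c : U (x - c *: a) -> l x = c.
  move=> Uc; apply/eqP; rewrite -subr_eq0; apply: contra_notT Ua => lc0.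
  have := Ulin (-1) _ _ (lU x) Uc.
  rewrite scaleN1r opprB addrA subrK -scalerBl => /(UZ (l x - c)^-1).
  by rewrite scalerA mulVf // scale1r.
have l_lin : scalar l.
  move=> c x y; apply: lE; have := Ulin c _ _ (lU x) (lU y).
  by rewrite scalerBr scalerA addrACA -opprD -scalerDl.
pose lin := GRing.isLinear.Build k A k *%R l l_lin.
pose L : {scalar A} := HB.pack l lin.
exists L; rewrite /L /=; apply: lE; by rewrite scale1r subrr.
Qed.

End Morphisms.

Section Spec.
Variables (k : closedFieldType) (A : fg_algebra k).

(* The closed points of Spec A. Nilpotents of A are not seen by these functions;
   Stanley-Reisner rings are reduced. *)
Definition spec_point := {lrmorphism A -> k^o}.

Definition spec_regular (f : spec_point -> k) := exists a : A, f = fun x => x a.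

Lemma spec_regularP :
  exists (N : nat) (c : spec_point -> 'I_N -> k) (S : {mpoly k[N]} -> Prop),
    [/\ injective c,
        forall x, (exists v, c v = x) <-> (forall p, S p -> p.@[x] = 0)
      & forall f, spec_regular f <-> exists p : {mpoly k[N]}, f = fun v => p.@[c v]].
Proof.
have mmapk N (x : 'I_N -> k) (p : {mpoly k[N]}) : mmap (in_alg k^o) x p = p.@[x].
  by rewrite /meval; congr mmap; apply: funext => c; exact: mulr1.
exists (fg_num A), (fun x i => x (fg_gen i)),
  (fun p => mmap (in_alg A) (@fg_gen k A) p = 0); split.
- move=> x y xy; apply: lrmorphism_ext; apply: fg_ext => i.
  by move/(congr1 (fun f => f i)): xy.
- move=> x; split=> [[v <-] p p0|Sx].
    by rewrite -mmapk -[LHS](lrmorphism_mmap v (@fg_gen k A)) p0 raddf0.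
  have [|v vx] := @fg_morphism k A k^o x; first by move=> p /Sx; rewrite mmapk.
  by exists v; apply: funext.
- move=> f; split=> [[a ->]|[p ->]].
    have [p ->] := fg_genP a; exists p; apply: funext => v.
    by rewrite lrmorphism_mmap mmapk.
  exists (mmap (in_alg A) (@fg_gen k A) p); apply: funext => v.
  by rewrite lrmorphism_mmap mmapk.
Qed.

Definition Spec : affine_variety k spec_point := AffineVariety spec_regularP.

End Spec.

Section DualFrame.
Variables (k : fieldType) (A : fg_algebra k).

Lemma dual_frame (Q : A -> Prop) (s : seq A) :
    (forall c x y, Q x -> Q y -> Q (c *: x + y)) -> Q 0 ->
    (forall x, x \in s -> Q x) ->
  exists r (l : 'I_r -> {scalar A}) (e : 'I_r -> A), (forall j, Q (e j)) /\
    (forall x, x \in s -> x = \sum_j l j x *: e j).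
Proof.
move=> Qlin Q0; elim: s => [|x s IHs] Qs.
  by exists 0%N, (fun=> GRing.Linear.clone _ _ _ _ \0 _), (fun=> 0); split.
have [y ys|r [l [e [Qe ls]]]] := IHs; first by apply: Qs; rewrite in_cons ys orbT.
pose P y := \sum_j l j y *: e j.
have Plin : linear P.
  move=> c y z; rewrite /P scaler_sumr -big_split /=; apply: eq_bigr => u _.
  by rewrite linearP scalerDl scalerA.
have QP y : Q (P y).
  rewrite /P; apply: big_ind => [//|u v Qu Qv|j _].
    by rewrite -[u]scale1r; exact: Qlin.
  by rewrite -[_ *: _]addr0; exact: Qlin.
pose z := x - P x.
have [z0|z0] := eqVneq z 0.
  exists r, l, e; split=> // y; rewrite in_cons => /predU1P[->|]; last exact: ls.
  by apply/eqP; rewrite -subr_eq0; apply/eqP.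
have [g gz] := functional_sep z0.
pose L y := g (y - P y).
have Llin : scalar L.
  by move=> c y w; rewrite /L Plin opprD addrACA -scalerN -scalerDr linearP.
pose lin := GRing.isLinear.Build k A k *%R L Llin.
pose Lf : {scalar A} := HB.pack L lin.
exists r.+1, (fun i => if unlift ord0 i is Some j then l j else Lf),
  (fun i => if unlift ord0 i is Some j then e j else z); split=> [i|y].
  case: unlift => [j|]; first exact: Qe.
  rewrite /z addrC -scaleN1r; apply: Qlin => //.
  by apply: Qs; exact: mem_head.
rewrite big_ord_recl unlift_none; under eq_bigr do rewrite liftK.
rewrite -/(P y) {1}/Lf /= /L in_cons => /predU1P[->|ys].
  by rewrite -/z gz scale1r subrK.
have -> : P y = y by rewrite [RHS]ls.
by rewrite subrr raddf0 scale0r add0r.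
Qed.

(* If A is graded by giving its generators degree 1, this is the sum of the
   components of degree at most d. *)
Definition deg_le (d : nat) (a : A) : Prop :=
  exists2 p : {mpoly k[fg_num A]}, (msize p <= d.+1)%N
    & a = mmap (in_alg A) (@fg_gen k A) p.

Lemma deg_leW d e a : (d <= e)%N -> deg_le d a -> deg_le e a.
Proof. by move=> de [p pd ->]; exists p => //; exact: leq_trans pd _. Qed.

Lemma deg_le_ex a : exists d, deg_le d a.
Proof. by have [p ->] := fg_genP a; exists (msize p), p. Qed.

Lemma deg_le_lin d c x y : deg_le d x -> deg_le d y -> deg_le d (c *: x + y).
Proof.
move=> [p pd ->] [q qd ->]; exists (c *: p + q).
  rewrite (leq_trans (msizeD_le _ _)) // geq_max qd andbT.
  exact: leq_trans (msizeZ_le _ _) pd.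
by rewrite mmapD mmapZ mulr_algl.
Qed.

Lemma deg_leC d c : deg_le d c%:A.
Proof. by exists c%:MP; rewrite ?mmapC //; rewrite msizeC; case: eqP. Qed.

Lemma deg_le0 d : deg_le d 0.
Proof. by rewrite -(scale0r 1); exact: deg_leC. Qed.

Lemma deg_leM d e x y : deg_le d x -> deg_le e y -> deg_le (d + e) (x * y).
Proof.
move=> [p pd ->] [q qe ->]; exists (p * q); last by rewrite rmorphM.
have [->|p0] := eqVneq p 0; first by rewrite mul0r msize0.
have [->|q0] := eqVneq q 0; first by rewrite mulr0 msize0.
by rewrite msizeM // -subn1 leq_subLR add1n -addSn -addnS leq_add.
Qed.

Lemma deg_le_mmap d e (a : 'I_(fg_num A) -> A) p :
  (forall i, deg_le e (a i)) -> (msize p <= d.+1)%N ->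
  deg_le (d * e) (mmap (in_alg A) a p).
Proof.
move=> ae pd; rewrite /mmap big_seq; apply: big_ind => [|x y xd yd|m mp].
- exact: deg_le0.
- by rewrite -[x]scale1r; exact: deg_le_lin.
rewrite /= mulr_algl -[_ *: _]addr0; apply: deg_le_lin; last exact: deg_le0.
apply: (@deg_leW (\sum_i m i * e)%N).
  rewrite -big_distrl /= -mdegE leq_mul2r; apply/orP; right.
  by rewrite -ltnS (leq_trans _ pd) // msize_mdeg_lt.
rewrite /mmap1; elim: (index_enum _) => [|i s IHs].
  by rewrite !big_nil -(scale1r 1); exact: deg_leC.
rewrite !big_cons; apply: deg_leM => //.
elim: (m i) => [|n IHn]; first by rewrite expr0 -(scale1r 1); exact: deg_leC.
by rewrite exprS mulSn; exact: deg_leM.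
Qed.

Lemma deg_le_frame d :
  exists r (l : 'I_r -> {scalar A}) (e : 'I_r -> A), (forall j, deg_le d (e j)) /\
    (forall x, deg_le d x -> x = \sum_j l j x *: e j).
Proof.
pose s := [seq mmap1 (@fg_gen k A) (bmnm m) | m <- index_enum (bmultinom (fg_num A) d.+1)].
have [|||r [l [e [ed ls]]]] := @dual_frame (deg_le d) s.
- exact: deg_le_lin.
- exact: deg_le0.
- move=> _ /mapP[m _ ->]; exists 'X_[m]; last by rewrite mmapX.
  by rewrite msizeX bmdeg.
exists r, l, e; split=> // _ [p pd ->]; rewrite (mmapE _ pd).
transitivity (\sum_(m : bmultinom (fg_num A) d.+1)
    \sum_j (p@_m * l j (mmap1 (@fg_gen k A) m)) *: e j).
  apply: eq_bigr => m _; rewrite [mmap1 _ _]ls; last first.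
    by apply/mapP; exists m; rewrite ?mem_index_enum.
  rewrite /= mulr_algl scaler_sumr; apply: eq_bigr => j _.
  by rewrite scalerA -ls //; apply/mapP; exists m; rewrite ?mem_index_enum.
rewrite exchange_big; apply: eq_bigr => j _ /=.
rewrite raddf_sum scaler_suml; apply: eq_bigr => m _.
by rewrite /= mulr_algl linearZ.
Qed.
End DualFrame.

Section Aut.
Variables (k : closedFieldType) (A : fg_algebra k).

(* Automorphisms are kept as pairs of mutually inverse endomorphisms of A. *)
Record aut := Aut {
  aut_fun :> {lrmorphism A -> A};
  aut_inv : {lrmorphism A -> A};
  aut_funK : cancel aut_fun aut_inv;
  aut_invK : cancel aut_inv aut_fun }.

Lemma aut_ext (f g : aut) : (forall i, f (fg_gen i) = g (fg_gen i)) -> f = g.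
Proof.
case: f => f f' fK f'K; case: g => g g' gK g'K /= /fg_ext fg.
have {}fg : f = g by exact: lrmorphism_ext.
case: g / fg in gK g'K *.
have fg' : f' = g' by apply: lrmorphism_ext => x; rewrite -{1}[x]g'K fK.
by case: g' / fg' in gK g'K *; congr Aut.
Qed.

Definition aut_one : aut := @Aut idfun idfun (fun=> erefl) (fun=> erefl).
Definition aut_mul (f g : aut) : aut :=
  @Aut (aut_fun f \o aut_fun g) (aut_inv g \o aut_inv f)
    (can_comp (aut_funK f) (aut_funK g)) (can_comp (aut_invK g) (aut_invK f)).
Definition aut_opp (f : aut) : aut := Aut (aut_invK f) (aut_funK f).

Fact aut_mulA : associative aut_mul.
Proof. by move=> f g h; apply: aut_ext. Qed.
Fact aut_mul1 : left_id aut_one aut_mul.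
Proof. by move=> f; apply: aut_ext. Qed.
Fact aut_1mul : right_id aut_one aut_mul.
Proof. by move=> f; apply: aut_ext. Qed.
Fact aut_mulV : left_inverse aut_one aut_opp aut_mul.
Proof. by move=> f; apply: aut_ext => i /=; rewrite aut_funK. Qed.
Fact aut_Vmul : right_inverse aut_one aut_opp aut_mul.
Proof. by move=> f; apply: aut_ext => i /=; rewrite aut_invK. Qed.

HB.instance Definition _ := gen_eqMixin aut.
HB.instance Definition _ := gen_choiceMixin aut.
HB.instance Definition _ :=
  isGroup.Build aut aut_mulA aut_mul1 aut_1mul aut_mulV aut_Vmul.

Definition aut_piece (d : nat) (f : aut) : Prop :=
  forall i, deg_le d (f (fg_gen i)) /\ deg_le d (aut_inv f (fg_gen i)).

(* The pieces are subvarieties of powers of the finite-dimensional vector spaces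
   [deg_le d], whose algebra of polynomial functions is generated by the linear
   functionals, that is, by the restrictions of the linear functionals on A. *)
Definition aut_coord (d : nat) (u : {f | aut_piece d f} -> k) : Prop :=
  exists (l : {scalar A}) i,
    u = (fun f => l (sval f (fg_gen i))) \/
    u = (fun f => l (aut_inv (sval f) (fg_gen i))).

Definition aut_regular (d : nat) := alg_gen (@aut_coord d).

Section PolynomialMaps.
Variables (V : Type) (S : (V -> k) -> Prop).

Definition poly_map (F : V -> A) :=
  (exists d, forall v, deg_le d (F v)) /\
  forall l : {scalar A}, alg_gen S (fun v => l (F v)).

Lemma poly_mapC a : poly_map (fun=> a).
Proof.
split=> [|l]; last exact: AlgGenC.
by have [d ad] := deg_le_ex a; exists d.
Qed.

Lemma poly_mapD F G : poly_map F -> poly_map G -> poly_map (fun v => F v + G v).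
Proof.
move=> [[d Fd] Fl] [[e Ge] Gl]; split=> [|l].
  exists (maxn d e) => v; rewrite -[F v]scale1r; apply: deg_le_lin.
    exact: deg_leW (leq_maxl _ _) (Fd v).
  exact: deg_leW (leq_maxr _ _) (Ge v).
by under eq_fun do rewrite raddfD; exact: (AlgGenD (Fl l) (Gl l)).
Qed.

Lemma poly_mapM F G : poly_map F -> poly_map G -> poly_map (fun v => F v * G v).
Proof.
move=> [[d Fd] Fl] [[e Ge] Gl]; split=> [|l].
  by exists (d + e)%N => v; exact: deg_leM.
have [r [x [b [_ bx]]]] := deg_le_frame A d.
under eq_fun => v.
  rewrite (bx _ (Fd v)) mulr_suml raddf_sum /=.
  under eq_bigr do rewrite -scalerAl linearZ /=.
  over.
apply: alg_gen_sum => j; apply: AlgGenM => //.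
have lin : scalar (fun y => l (b j * y)).
  by move=> c y z; rewrite mulrDr -scalerAr linearP.
pose m := GRing.isLinear.Build k A k *%R _ lin.
pose L : {scalar A} := HB.pack (fun y => l (b j * y)) m.
exact: (Gl L).
Qed.

Lemma poly_mapZ (u : V -> k) F :
  alg_gen S u -> poly_map F -> poly_map (fun v => u v *: F v).
Proof.
move=> Su [[d Fd] Fl]; split=> [|l].
  by exists d => v; rewrite -[_ *: _]addr0; apply: deg_le_lin => //; exact: deg_le0.
by under eq_fun do rewrite linearZ; exact: (AlgGenM Su (Fl l)).
Qed.

Lemma poly_map_sum I (r : seq I) (F : I -> V -> A) :
  (forall i, poly_map (F i)) -> poly_map (fun v => \sum_(i <- r) F i v).
Proof.
move=> PF; elim: r => [|i r IHr].
  by under eq_fun do rewrite big_nil; exact: poly_mapC.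
by under eq_fun do rewrite big_cons; exact: poly_mapD.
Qed.

Lemma poly_map_mmap (a : V -> 'I_(fg_num A) -> A) (p : {mpoly k[fg_num A]}) :
  (forall i, poly_map (a^~ i)) -> poly_map (fun v => mmap (in_alg A) (a v) p).
Proof.
move=> Pa; apply: poly_map_sum => m; apply: poly_mapM; first exact: poly_mapC.
rewrite /mmap1; elim: (index_enum _) => [|i r IHr].
  by under eq_fun do rewrite big_nil; exact: poly_mapC.
under eq_fun do rewrite big_cons; apply: poly_mapM => //.
elim: (m i) => [|n IHn]; first by under eq_fun do rewrite expr0; exact: poly_mapC.
by under eq_fun do rewrite exprS; exact: poly_mapM.
Qed.

Lemma poly_map_comp (F G : V -> {lrmorphism A -> A}) d :
  (forall v i, deg_le d (G v (fg_gen i))) ->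
  (forall i, poly_map (fun v => F v (fg_gen i))) ->
  (forall i, poly_map (fun v => G v (fg_gen i))) ->
  forall i, poly_map (fun v => F v (G v (fg_gen i))).
Proof.
move=> Gd PF PG i.
have [r [x [b [_ bx]]]] := deg_le_frame A d.
under eq_fun => v.
  rewrite (bx _ (Gd v i)) raddf_sum /=.
  under eq_bigr do rewrite linearZ /=.
  over.
apply: poly_map_sum => j; apply: poly_mapZ; first exact: (PG i).2.
have [p ->] := fg_genP (b j).
by under eq_fun do rewrite lrmorphism_mmap; exact: poly_map_mmap.
Qed.

End PolynomialMaps.

Lemma functional0 (a : A) : (forall l : {scalar A}, l a = 0) -> a = 0.
Proof.
move=> la; have [//|/functional_sep[l l1]] := eqVneq a 0.
by have := la l; rewrite l1 => /eqP; rewrite oner_eq0.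
Qed.

Lemma aut_of_pair (a : bool -> 'I_(fg_num A) -> A) :
  (forall b p, mmap (in_alg A) (@fg_gen k A) p = 0 -> mmap (in_alg A) (a b) p = 0) ->
  (forall b i p, a b i = mmap (in_alg A) (@fg_gen k A) p ->
                 mmap (in_alg A) (a (~~ b)) p = fg_gen i) ->
  exists f : aut, forall i, f (fg_gen i) = a true i /\ aut_inv f (fg_gen i) = a false i.
Proof.
move=> rel inv.
have [f fE] := fg_morphism (rel true); have [g gE] := fg_morphism (rel false).
have fK : cancel f g.
  apply: (@fg_ext k A A (g \o f) idfun) => i /=.
  rewrite fE; have [p pE] := fg_genP (a true i).
  rewrite pE lrmorphism_mmap -(inv _ _ _ pE); congr mmap; exact: funext.
have gK : cancel g f.
  apply: (@fg_ext k A A (f \o g) idfun) => i /=.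
  rewrite gE; have [p pE] := fg_genP (a false i).
  rewrite pE lrmorphism_mmap -(inv _ _ _ pE); congr mmap; exact: funext.
by exists (Aut fK gK).
Qed.

Lemma aut_regularP d :
  exists (N : nat) (c : {f | aut_piece d f} -> 'I_N -> k) (S : {mpoly k[N]} -> Prop),
    [/\ injective c,
        forall x, (exists v, c v = x) <-> (forall p, S p -> p.@[x] = 0)
      & forall f, @aut_regular d f <-> exists p : {mpoly k[N]}, f = fun v => p.@[c v]].
Proof.
have [r [l [e [ed el]]]] := deg_le_frame A d.
have /choice[E eE] : forall j, exists p, e j = mmap (in_alg A) (@fg_gen k A) p.
  by move=> j; exact: fg_genP.
pose I : finType := (bool * 'I_(fg_num A) * 'I_r)%type.
pose img (f : aut) b i := (if b then aut_fun f else aut_inv f) (fg_gen i).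
pose c (f : {f | aut_piece d f}) (u : I) := l u.2 (img (sval f) u.1.1 u.1.2).
pose a (x : I -> k) b i := \sum_j x (b, i, j) *: e j.
have imgd (f : {f | aut_piece d f}) b i : deg_le d (img (sval f) b i).
  by case: b (svalP f i) => -[].
have acE f : a (c f) = img (sval f).
  by apply: funext => b; apply: funext => i; rewrite /a /c /= -el.
pose proj (g : (I -> k) -> k) := exists u, g = fun x => x u.
have Pa b i : poly_map proj (fun x => a x b i).
  apply: poly_map_sum => j; apply: poly_mapZ; last exact: poly_mapC.
  by apply: AlgGen; exists (b, i, j).
pose inv x b i := \sum_j x (b, i, j) *: mmap (in_alg A) (a x (~~ b)) (E j).
have Pinv b i : poly_map proj (fun x => inv x b i - fg_gen i).
  apply: poly_mapD; last exact: poly_mapC.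
  apply: poly_map_sum => j; apply: poly_mapZ; last exact: poly_map_mmap.
  by apply: AlgGen; exists (b, i, j).
have invE x b i p : a x b i = mmap (in_alg A) (@fg_gen k A) p ->
    (forall p, mmap (in_alg A) (@fg_gen k A) p = 0 ->
               mmap (in_alg A) (a x (~~ b)) p = 0) ->
    mmap (in_alg A) (a x (~~ b)) p = inv x b i.
  move=> ap rel; have [f fE] := fg_morphism rel.
  have fg : f \o @fg_gen k A = a x (~~ b) by exact: funext.
  rewrite -fg -lrmorphism_mmap -ap /a /inv raddf_sum; apply: eq_bigr => j _.
  by rewrite /= linearZ /= eE lrmorphism_mmap fg.
pose S (h : (I -> k) -> k) :=
  [\/ exists b i j, h = fun x => l j (a x b i) - x (b, i, j),
      exists b p (L : {scalar A}), mmap (in_alg A) (@fg_gen k A) p = 0 /\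
        h = fun x => L (mmap (in_alg A) (a x b) p)
    | exists b i (L : {scalar A}), h = fun x => L (inv x b i - fg_gen i)].
apply: (@affine_by_coordinates k _ I c S).
- move=> [f fd] [g gd] fg; apply: eq_exist; apply: aut_ext => i.
  by have := congr1 (fun x => a x true i) fg; rewrite !acE.
- move=> _ [[b [i [j ->]]]|[b [p [L [_ ->]]]]|[b [i [L ->]]]].
  + have -> : (fun x => l j (a x b i) - x (b, i, j)) =
        fun x => l j (a x b i) + -1 * x (b, i, j).
      by apply: funext => x; rewrite mulN1r.
    apply: AlgGenD; first exact: (Pa b i).2.
    apply: AlgGenM; first exact: AlgGenC.
    by apply: AlgGen; exists (b, i, j).
  + by apply: (poly_map_mmap p _).2 => i; exact: Pa.
  + exact: (Pinv b i).2.
- move=> x; split=> [[f <-] _ [[b [i [j ->]]]|[b [p [L [p0 ->]]]]|[b [i [L ->]]]]|Sx].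
  + by rewrite acE /c subrr.
  + rewrite acE -(_ : (if b then aut_fun (sval f) else aut_inv (sval f)) \o
        @fg_gen k A = img (sval f) b) //.
    by rewrite -lrmorphism_mmap p0 !raddf0.
  + have [p pE] := fg_genP (a (c f) b i).
    rewrite -(invE _ _ _ p) //; last first.
      move=> q q0; rewrite acE.
      rewrite -(_ : (if ~~ b then aut_fun (sval f) else aut_inv (sval f)) \o
        @fg_gen k A = img (sval f) (~~ b)) //.
      by rewrite -lrmorphism_mmap q0 raddf0.
    rewrite acE -(_ : (if ~~ b then aut_fun (sval f) else aut_inv (sval f)) \o
        @fg_gen k A = img (sval f) (~~ b)) //.
    rewrite -lrmorphism_mmap -pE acE /img.
    by case: (b) => /=; rewrite ?aut_funK ?aut_invK subrr raddf0.
  + have rel b p : mmap (in_alg A) (@fg_gen k A) p = 0 -> mmap (in_alg A) (a x b) p = 0.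
      move=> p0; apply: functional0 => L.
      by apply: (Sx (fun x => L (mmap (in_alg A) (a x b) p))); constructor 2; exists b, p, L.
    have [|f fE] := @aut_of_pair (a x) rel.
      move=> b i p ap; rewrite (invE x b i p ap (rel _)); apply/eqP; rewrite -subr_eq0; apply/eqP.
      apply: functional0 => L.
      by apply: (Sx (fun x => L (inv x b i - fg_gen i))); constructor 3; exists b, i, L.
    have ad b i : deg_le d (a x b i).
      rewrite /a; apply: big_ind => [|y z yd zd|j _]; first exact: deg_le0.
        by rewrite -[y]scale1r; exact: deg_le_lin.
      by rewrite -[_ *: _]addr0; apply: deg_le_lin => //; exact: deg_le0.
    have fd : aut_piece d f by move=> i; rewrite (fE i).1 (fE i).2.
    exists (exist _ f fd); apply: funext => -[[b i] j]; rewrite /c /img /=.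
    have -> : (if b then aut_fun f else aut_inv f) (fg_gen i) = a x b i.
      by case: b; [exact: (fE i).1 | exact: (fE i).2].
    apply/eqP; rewrite -subr_eq0; apply/eqP.
    by apply: (Sx (fun x => l j (a x b i) - x (b, i, j))); constructor 1; exists b, i, j.
- move=> f; split; apply: alg_gen_sub => g.
  + have lin b i (L : {scalar A}) : alg_gen (fun g => exists u, g = c^~ u)
        (fun f => L (img (sval f) b i)).
      have -> : (fun f => L (img (sval f) b i)) =
          fun f => \sum_j L (e j) * c f (b, i, j).
        apply: funext => h; rewrite [in LHS](el _ (imgd h b i)) raddf_sum.
        by apply: eq_bigr => j _; rewrite /= linearZ mulrC.
      apply: alg_gen_sum => j; apply: AlgGenM; first exact: AlgGenC.
      by apply: AlgGen; exists (b, i, j).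
    by case=> L [i [->|->]]; [exact: (lin true) | exact: (lin false)].
  + case=> -[[b i] j] ->; apply: AlgGen; exists (l j), i.
    by case: b; [left|right].
Qed.

Definition aut_piece_var d : affine_variety k {f | aut_piece d f} :=
  AffineVariety (aut_regularP d).

Lemma aut_piece_sub d f : aut_piece d f -> aut_piece d.+1 f.
Proof. by move=> fd i; case: (fd i) => ? ?; split; exact: (deg_leW (leqnSn d)). Qed.

Lemma aut_piece_cover f : exists d, aut_piece d f.
Proof.
have /choice[D DP] : forall i, exists d,
    deg_le d (f (fg_gen i)) /\ deg_le d (aut_inv f (fg_gen i)).
  move=> i; have [d fd] := deg_le_ex (f (fg_gen i)).
  have [e fe] := deg_le_ex (aut_inv f (fg_gen i)).
  by exists (maxn d e); split; [apply: deg_leW fd; exact: leq_maxl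
                              | apply: deg_leW fe; exact: leq_maxr].
exists (\max_i D i) => i; have [fd gd] := DP i.
by split; [apply: deg_leW fd | apply: deg_leW gd]; exact: leq_bigmax.
Qed.

Lemma aut_piece_closed d : closed_immersion (aut_piece_var d) (aut_piece_var d.+1)
  (fun x => exist _ (sval x) (aut_piece_sub (svalP x))).
Proof.
apply: closed_immersion_regular => h; split=> [hX|[h' h'Y ->]].
  elim: hX => {h}[_ [l [i [->|->]]]|a|f g _ [f' fY ->] _ [g' gY ->]
                                  |f g _ [f' fY ->] _ [g' gY ->]].
  - exists (fun f : {f | aut_piece _ f} => l (sval f (fg_gen i))) => //.
    by apply: AlgGen; exists l, i; left.
  - exists (fun f : {f | aut_piece _ f} => l (aut_inv (sval f) (fg_gen i))) => //.
    by apply: AlgGen; exists l, i; right.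
  - by exists (fun=> a) => //; exact: AlgGenC.
  - by exists (fun v => f' v + g' v) => //; exact: AlgGenD.
  - by exists (fun v => f' v * g' v) => //; exact: AlgGenM.
apply: alg_gen_comp h'Y => _ [l [i [->|->]]]; apply: AlgGen; exists l, i.
  by left.
by right.
Qed.

Definition aut_ind_variety : ind_variety k aut :=
  IndVariety aut_piece_cover aut_piece_closed.

Lemma aut_piece_mul d f g :
  aut_piece d f -> aut_piece d g -> aut_piece (d * d) (f * g)%g.
Proof.
move=> fd gd i; split.
  have [p pd pE] := (gd i).1; rewrite /= pE lrmorphism_mmap.
  by apply: deg_le_mmap => // j; exact: (fd j).1.
have [p pd pE] := (fd i).2; rewrite /= pE lrmorphism_mmap.
by apply: deg_le_mmap => // j; exact: (gd j).2.
Qed.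

Lemma aut_mul_morphism d : exists e,
  exists mE : forall x y, piece aut_ind_variety d x -> piece aut_ind_variety d y ->
                          piece aut_ind_variety e (x * y)%g,
  var_morphism
    (prod_variety (piece_var aut_ind_variety d) (piece_var aut_ind_variety d))
    (piece_var aut_ind_variety e)
    (fun u => exist _ (sval u.1 * sval u.2)%g (mE _ _ (svalP u.1) (svalP u.2))).
Proof.
exists (d * d)%N, (@aut_piece_mul d) => h.
pose T := ({f | aut_piece d f} * {f | aut_piece d f})%type.
pose S (f : T -> k) := (exists2 g, aut_regular g & f = g \o fst) \/
                       (exists2 h, aut_regular h & f = h \o snd).
have P1 i : poly_map S (fun u : T => sval u.1 (fg_gen i)).
  split=> [|l]; first by exists d => v; exact: (svalP v.1 i).1.
  apply: AlgGen; left; exists (fun f : {f | aut_piece _ f} => l (sval f (fg_gen i))) => //.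
  by apply: AlgGen; exists l, i; left.
have P2 i : poly_map S (fun u : T => sval u.2 (fg_gen i)).
  split=> [|l]; first by exists d => v; exact: (svalP v.2 i).1.
  apply: AlgGen; right; exists (fun f : {f | aut_piece _ f} => l (sval f (fg_gen i))) => //.
  by apply: AlgGen; exists l, i; left.
have Q1 i : poly_map S (fun u : T => aut_inv (sval u.1) (fg_gen i)).
  split=> [|l]; first by exists d => v; exact: (svalP v.1 i).2.
  apply: AlgGen; left; exists (fun f : {f | aut_piece _ f} => l (aut_inv (sval f) (fg_gen i))) => //.
  by apply: AlgGen; exists l, i; right.
have Q2 i : poly_map S (fun u : T => aut_inv (sval u.2) (fg_gen i)).
  split=> [|l]; first by exists d => v; exact: (svalP v.2 i).2.
  apply: AlgGen; right; exists (fun f : {f | aut_piece _ f} => l (aut_inv (sval f) (fg_gen i))) => //.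
  by apply: AlgGen; exists l, i; right.
apply: alg_gen_comp => _ [l [i [->|->]]].
  by apply: (poly_map_comp (d := d) _ P1 P2 i).2 => v j; exact: (svalP v.2 j).1.
by apply: (poly_map_comp (d := d) _ Q2 Q1 i).2 => v j; exact: (svalP v.1 j).2.
Qed.

Lemma aut_inv_morphism :
  ind_morphism aut_ind_variety aut_ind_variety (fun f => f^-1%g).
Proof.
move=> d; exists d; have pE f : aut_piece d f -> aut_piece d f^-1%g.
  by move=> fd i; case: (fd i).
exists pE => h; apply: alg_gen_comp => _ [l [i [->|->]]]; apply: AlgGen; exists l, i.
  by right.
by left.
Qed.

Definition aut_ind_group : ind_group k :=
  IndGroup aut_mul_morphism aut_inv_morphism.

End Aut.

Section Statement.
Variables (k : closedFieldType) (n : nat) (D : simplicial_complex n).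

Definition sr_variety : affine_variety k (spec_point (sr_alg k D)) :=
  Spec (sr_alg k D).

(* Aut (X_D x A^1) = Aut_k (k[D][x_v]), the generators being the classes of the n
   variables and x_v. *)
Definition aut_cylinder : ind_group k := aut_ind_group (poly_alg (sr_alg k D)).

End Statement.

(* Main.v *)
From HB Require Import structures.
From mathcomp Require Import all_boot all_order all_algebra all_fingroup.
From mathcomp Require Import boolp mpoly zify.
Require Import Defs.

Set Implicit Arguments.
Unset Strict Implicit.
Unset Printing Implicit Defensive.

Import Order.TTheory GRing.Theory Num.Theory.
Local Open Scope ring_scope.
Local Open Scope quotient_scope.

Local Notation pev x p := (mmap (in_alg _) x p).

(** An isomorphism of ind-groups from Aut (X_D x A^1) to Aut (X_D' x A^1) remembers D
    through the diagonal torus and the root subgroups that move the variable of the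
    line.

    Let C and C' be the cones over D and D', with apex v; the coordinate rings of the
    cylinders are the Stanley-Reisner rings k[C] and k[C'] (cylinder_coordinates). The
    diagonal torus of Aut k[C] normalizes the one-parameter subgroups that send x_v to
    x_v + z x^d, for d a monomial supported on a face of D, and acts on them by the
    weight d - e_v. An isomorphism of ind-groups is polynomial on families of bounded
    degree, so it yields an action of a torus of rank n + 1 on k[C'] and, in
    characteristic 0, locally nilpotent derivations of k[C'] of the weights d - e_v
    (transported_torus).

    A faithful action on k[C'] of a torus whose rank is at least the number of vertices
    of C' is the standard action in suitable coordinates (toric_coordinates). The torus
    preserves the components of the variety. A subtorus acting trivially on a component
    fixes the origin and acts faithfully on the cotangent space there; this bounds its
    rank, so the action on each component has full rank (facet_weights). Hence the
    invariants on a component are constants (invariant_const), and the elements of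
    nonzero weight form the ideal of a fixed point, which lies on all the components and
    may be moved to the origin (fixed_coordinates). There the weights of the cotangent
    space are independent, weight vectors y lifting a basis of it generate the ring,
    and the components are coordinate subspaces for y just as they are for the original
    coordinates, up to a permutation (facet_permutation). In particular the rank is
    the number of vertices, and n = n' by symmetry.

    In these coordinates, a homogeneous locally nilpotent derivation is a multiple of
    some y^b d/dy_j such that j can be added to any face containing the support of b
    (derivation_root). Reading the weights d - e_v in the basis of the weights of y
    yields a permutation s, with s v = j, and a set B, the support of b for d = 0, such
    that the faces of D go to faces of C' without j that can be joined to B
    (roots_permutation). The faces of C' that can be joined to B can be joined to j, so
    the number of faces of C is at most that of C' (card_star_le). With the inverse
    isomorphism these numbers are equal; then s is an isomorphism from C to C' and j is
    an apex of C' (star_isomorphism). Finally the apexes j and v of C' can be exchanged,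
    so D and D' are isomorphic (cone_cancel), and then so are their rings and
    varieties.

    Points of the torus are taken in the dense subgroup of the 2^c with c an integer
    vector. *)

(** * Coordinates of a Stanley-Reisner ring *)

Section Coordinates.
Variable k : fieldType.

Definition mnm_supp m (u : 'X_{1..m}) : {set 'I_m} := [set i | u i != 0%N].

Definition face_var m (s : {set 'I_m}) (i : 'I_m) : {mpoly k[m]} :=
  if i \in s then 'X_i else 0.

Lemma rmorph_mmap1 (R S : comNzRingType) (f : {rmorphism R -> S}) m
    (x : 'I_m -> R) u : f (mmap1 x u) = mmap1 (f \o x) u.
Proof. by rewrite rmorph_prod; apply: eq_bigr => i _; rewrite rmorphXn. Qed.

Lemma mmap1_eq0 (R : idomainType) m (x : 'I_m -> R) u :
  (mmap1 x u == 0) = [exists i, (u i != 0%N) && (x i == 0)].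
Proof.
rewrite prodf_seq_eq0; apply/hasP/existsP => [[i _]|[i ui]].
  by rewrite /= expf_eq0 lt0n => ?; exists i.
by exists i; rewrite ?mem_index_enum //= expf_eq0 lt0n.
Qed.

Lemma mmap1D (R : comNzRingType) m (x : 'I_m -> R) u v :
  mmap1 x (u + v)%MM = mmap1 x u * mmap1 x v.
Proof.
by rewrite /mmap1 -big_split; apply: eq_bigr => i _; rewrite mnmDE exprD.
Qed.

Lemma mmap1_face_var m (s : {set 'I_m}) u :
  mmap1 (face_var s) u = if mnm_supp u \subset s then 'X_[u] else 0.
Proof.
case: ifPn => [us|/subsetPn[i]].
  rewrite mpolyXE_id; apply: eq_bigr => i _; rewrite /face_var.
  have [->|ui] := eqVneq (u i) 0%N; first by rewrite !expr0.
  by rewrite (subsetP us) ?inE.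
rewrite inE => ui si; apply/eqP; rewrite mmap1_eq0; apply/existsP; exists i.
by rewrite ui /face_var (negbTE si) eqxx.
Qed.

Lemma mcoeff_face m (s : {set 'I_m}) (p : {mpoly k[m]}) u :
  (pev (face_var s) p)@_u = if mnm_supp u \subset s then p@_u else 0.
Proof.
elim/mpolyind: p => [|c v p _ _ IHp]; first by rewrite mmap0 !mcoeff0 if_same.
rewrite mmapD mmapZ mmapX !mcoeffD mulr_algl !mcoeffZ IHp mcoeffX mmap1_face_var.
have [<-|vu] := eqVneq v u.
  by case: ifP => _; rewrite ?mcoeffX ?eqxx // mcoeff0 mulr0 addr0.
rewrite mulr0 add0r; case: ifP => _; rewrite ?mcoeff0 ?mulr0 ?add0r //.
by rewrite mcoeffX (negbTE vu) mulr0 add0r.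
Qed.

(** The variety of C is the union of the coordinate subspaces of the faces, and
    pi s is the restriction of functions to the subspace of s, written in all the
    variables. Presenting k[C] by restrictions rather than by relations lets the
    same statement describe several systems of coordinates on one algebra. *)
Record sr_coordinates (A : comAlgType k) m (C : simplicial_complex m)
    (x : 'I_m -> A) (pi : {set 'I_m} -> {lrmorphism A -> {mpoly k[m]}}) : Prop :=
  SrCoordinates {
  src_gen : forall a, exists p, a = pev x p;
  src_face : forall s i, s \in C -> pi s (x i) = face_var s i;
  src_inj : forall a, (forall s, s \in C -> pi s a = 0) -> a = 0 }.

Section Theory.
Variables (A : comAlgType k) (m : nat) (C : simplicial_complex m).
Variables (x : 'I_m -> A) (pi : {set 'I_m} -> {lrmorphism A -> {mpoly k[m]}}).
Hypothesis xP : sr_coordinates C x pi.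

Lemma src_pev s p : s \in C -> pi s (pev x p) = pev (face_var s) p.
Proof.
move=> sC; rewrite lrmorphism_mmap; congr mmap; apply: funext => i.
exact: (src_face xP).
Qed.

Lemma src_coeff s p u :
  s \in C -> (pi s (pev x p))@_u = if mnm_supp u \subset s then p@_u else 0.
Proof. by move=> sC; rewrite src_pev // mcoeff_face. Qed.

Lemma src_coeff_sub s t a u : s \in C -> t \in C ->
  mnm_supp u \subset s -> mnm_supp u \subset t -> (pi s a)@_u = (pi t a)@_u.
Proof.
by have [p ->] := src_gen xP a => sC tC us ut; rewrite !src_coeff // us ut.
Qed.

Lemma src_coeff0 s a u : s \in C -> ~~ (mnm_supp u \subset s) -> (pi s a)@_u = 0.
Proof.
by have [p ->] := src_gen xP a => sC us; rewrite !src_coeff // (negbTE us).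
Qed.

Lemma src_pev_eq0 p :
  (forall u, mnm_supp u \in C -> p@_u = 0) -> pev x p = 0.
Proof.
move=> p0; apply: (src_inj xP) => s sC; apply/mpolyP => u.
by rewrite src_coeff // mcoeff0; case: ifP => // /(faces_sub sC)/p0.
Qed.

Lemma src_nonface u : mnm_supp u \notin C -> mmap1 x u = 0.
Proof.
move=> uC; rewrite -(mmapX x (in_alg A)) src_pev_eq0 // => v vC.
by rewrite mcoeffX; case: eqP vC uC => // -> ->.
Qed.

(** The universal property of k[C]: a relation between the x i involves only
    monomials whose support is not a face. *)
Lemma src_morphism (B : comAlgType k) (b : 'I_m -> B) :
  (forall u, mnm_supp u \notin C -> mmap1 b u = 0) ->
  exists f : {lrmorphism A -> B}, forall i, f (x i) = b i.
Proof.
move=> b0; have [|f fx] := @fg_morphism k (FgAlgebra (src_gen xP)) B b.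
  move=> p /= xp0; rewrite /mmap big_seq big1 // => u pu.
  have [uC|/b0->] := boolP (mnm_supp u \in C); last by rewrite mulr0.
  have := congr1 (fun a => (pi (mnm_supp u) a)@_u) xp0.
  rewrite /= src_coeff // subxx raddf0 mcoeff0 => ->.
  by rewrite /= scale0r mul0r.
by exists f.
Qed.

Lemma src_ext (B : comAlgType k) (f g : {lrmorphism A -> B}) :
  (forall i, f (x i) = g (x i)) -> f =1 g.
Proof. exact: (@fg_ext k (FgAlgebra (src_gen xP)) B f g). Qed.

(** The j-th power of the maximal ideal of the origin, tested on every coordinate
    subspace. *)
Definition ord_ge (j : nat) (a : A) :=
  forall s u, s \in C -> (mdeg u < j)%N -> (pi s a)@_u = 0.

Lemma ord_ge_lin j c a b : ord_ge j a -> ord_ge j b -> ord_ge j (c *: a + b).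
Proof.
move=> ja jb s u sC uj; rewrite linearP mcoeffD mcoeffZ.
by rewrite (ja s u) // (jb s u) // mulr0 addr0.
Qed.

Lemma ord_ge0 j : ord_ge j 0.
Proof. by move=> s u _ _; rewrite raddf0 mcoeff0. Qed.

Lemma ord_geD j a b : ord_ge j a -> ord_ge j b -> ord_ge j (a + b).
Proof. by move=> ja jb; rewrite -[a]scale1r; exact: ord_ge_lin. Qed.

Lemma ord_geZ j c a : ord_ge j a -> ord_ge j (c *: a).
Proof. by move=> ja; rewrite -[_ *: _]addr0; apply: ord_ge_lin => //; exact: ord_ge0. Qed.

Lemma ord_geN j a : ord_ge j a -> ord_ge j (- a).
Proof. by rewrite -scaleN1r; exact: ord_geZ. Qed.

Lemma ord_geB j a b : ord_ge j a -> ord_ge j b -> ord_ge j (a - b).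
Proof. by move=> ja jb; apply: ord_geD => //; exact: ord_geN. Qed.

Lemma ord_ge_sum j I (r : seq I) (P : pred I) (F : I -> A) :
  (forall i, P i -> ord_ge j (F i)) -> ord_ge j (\sum_(i <- r | P i) F i).
Proof.
move=> jF; apply: big_ind => //; first exact: ord_ge0.
by move=> a b; exact: ord_geD.
Qed.

Lemma ord_geW i j a : (i <= j)%N -> ord_ge j a -> ord_ge i a.
Proof. by move=> ij ja s u sC ui; apply: ja => //; exact: leq_trans ij. Qed.

Lemma ord_ge_triv a : ord_ge 0 a.
Proof. by []. Qed.

Lemma ord_geM i j a b : ord_ge i a -> ord_ge j b -> ord_ge (i + j) (a * b).
Proof.
move=> ia jb s u sC uij; rewrite rmorphM mcoeffM big1 // => -[v w] /= /eqP uE.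
have vw : (mdeg v + mdeg w < i + j)%N by rewrite -mdegD -uE.
have [vi|iv] := ltnP (mdeg v) i; first by rewrite ia ?mul0r.
rewrite (jb s w) ?mulr0 // -(ltn_add2l i).
by apply: leq_ltn_trans vw; rewrite leq_add2r.
Qed.

Lemma ord_ge_mmap1 (z : 'I_m -> A) u :
  (forall i, ord_ge 1 (z i)) -> ord_ge (mdeg u) (mmap1 z u).
Proof.
move=> z1; rewrite mdegE /mmap1.
elim: (index_enum _) => [|i r IHr]; first by rewrite !big_nil; exact: ord_ge_triv.
rewrite !big_cons; apply: ord_geM => //.
elim: (u i) => [|l IHl]; first exact: ord_ge_triv.
by rewrite exprS -add1n; exact: ord_geM.
Qed.

Lemma ord_ge_inf a : (forall j, ord_ge j a) -> a = 0.
Proof.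
move=> ja; apply: (src_inj xP) => s sC; apply/mpolyP => u; rewrite mcoeff0.
exact: (ja (mdeg u).+1).
Qed.

Lemma ord_ge_var i : ord_ge 1 (x i).
Proof.
move=> s u sC; rewrite ltnS leqn0 mdeg_eq0 => /eqP->.
rewrite (src_face xP) // /face_var; case: ifP => _; rewrite ?mcoeff0 //.
by rewrite mcoeffX -mdeg_eq0 mdeg1.
Qed.

(** The monomials of low degree of any representative have a support outside C,
    so that they can be dropped. *)
Lemma ord_ge_rep j a : ord_ge j a ->
  exists2 p, (forall u, u \in msupp p -> (j <= mdeg u)%N) & a = pev x p.
Proof.
have [p ->] := src_gen xP a => ja.
pose q := \sum_(u <- msupp p | (j <= mdeg u)%N) p@_u *: 'X_[u].
have qE u : q@_u = if (j <= mdeg u)%N then p@_u else 0.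
  rewrite /q raddf_sum /= big_mkcond /=.
  have [up|] := boolP (u \in msupp p).
    rewrite (bigD1_seq u) ?msupp_uniq //= big1 => [|v vu]; last first.
      by case: ifP => // _; rewrite mcoeffZ mcoeffX (negbTE vu) mulr0.
    by rewrite addr0; case: ifP => // _; rewrite mcoeffZ mcoeffX eqxx mulr1.
  rewrite -mcoeff_eq0 => /eqP pu; rewrite pu if_same big1_seq // => v /= vp.
  case: ifP => // _; rewrite mcoeffZ mcoeffX; case: eqP => [vu|_]; rewrite ?mulr0 //.
  by rewrite vu pu mul0r.
exists q => [u|]; first by rewrite mcoeff_msupp qE; case: ifP => //; rewrite eqxx.
apply/eqP; rewrite -subr_eq0 -mmapB; apply/eqP/src_pev_eq0 => u uC.
rewrite mcoeffB qE; case: leqP => [_|uj]; first by rewrite subrr.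
by have := ja _ u uC uj; rewrite src_coeff // subxx subr0.
Qed.

Lemma ord_ge_pev j (z : 'I_m -> A) p : (forall i, ord_ge 1 (z i)) ->
  (forall u, u \in msupp p -> (j <= mdeg u)%N) -> ord_ge j (pev z p).
Proof.
move=> z1 pj; rewrite /mmap big_seq; apply: ord_ge_sum => u up.
rewrite /= mulr_algl; apply: ord_geZ.
by apply: ord_geW (pj _ up) _; exact: ord_ge_mmap1.
Qed.

(** Telescoping: replacing one factor z i by z' i costs an element of order 2
    where there was one of order 1. *)
Lemma ord_ge_perturb1 (z z' : 'I_m -> A) u :
  (forall i, ord_ge 1 (z i)) -> (forall i, ord_ge 1 (z' i)) ->
  (forall i, ord_ge 2 (z i - z' i)) ->
  ord_ge (mdeg u).+1 (mmap1 z u - mmap1 z' u).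
Proof.
move=> z1 z'1 zz'.
have step i j a b c d : ord_ge i a -> ord_ge j d -> ord_ge i.+1 (a - c) ->
    ord_ge j.+1 (b - d) -> ord_ge j b -> ord_ge (i + j).+1 (a * b - c * d).
  move=> ia jd ac bd jb.
  have -> : a * b - c * d = a * (b - d) + (a - c) * d.
    by rewrite mulrBr mulrBl addrA subrK.
  by apply: ord_geD; [rewrite -addnS|rewrite -addSn]; exact: ord_geM.
suff [_ [_ //]] : ord_ge (mdeg u) (mmap1 z u) /\ ord_ge (mdeg u) (mmap1 z' u) /\
    ord_ge (mdeg u).+1 (mmap1 z u - mmap1 z' u).
rewrite mdegE /mmap1; elim: (index_enum _) => [|i r [IH1 [IH2 IH3]]].
  by rewrite !big_nil subrr; do ![split|exact: ord_ge_triv|exact: ord_ge0].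
rewrite !big_cons.
have [H1 [H2 H3]] : ord_ge (u i) (z i ^+ u i) /\ ord_ge (u i) (z' i ^+ u i) /\
    ord_ge (u i).+1 (z i ^+ u i - z' i ^+ u i).
  elim: (u i) => [|l [J1 [J2 J3]]].
    by rewrite !expr0 subrr; do ![split|exact: ord_ge_triv|exact: ord_ge0].
  rewrite !exprS -add1n; split; first exact: ord_geM.
  by split; [exact: ord_geM|apply: step].
by split; [exact: ord_geM|split; [exact: ord_geM|apply: step]].
Qed.

Lemma ord_ge_perturb j (z z' : 'I_m -> A) p :
  (forall i, ord_ge 1 (z i)) -> (forall i, ord_ge 1 (z' i)) ->
  (forall i, ord_ge 2 (z i - z' i)) ->
  (forall u, u \in msupp p -> (j <= mdeg u)%N) ->
  ord_ge j.+1 (pev z p - pev z' p).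
Proof.
move=> z1 z'1 zz' pj; rewrite /mmap -sumrB big_seq; apply: ord_ge_sum => u up.
rewrite /= !mulr_algl -scalerBr; apply: ord_geZ.
apply: (@ord_geW _ (mdeg u).+1); first by rewrite ltnS pj.
exact: ord_ge_perturb1.
Qed.

(** The class of a function in the cotangent space at the origin. *)
Definition lin (a : A) : 'rV[k]_m := \row_i (pi [set i] a)@_U_(i).

Lemma mnm_supp1 i : mnm_supp U_(i)%MM = [set i] :> {set 'I_m}.
Proof. by apply/setP => j; rewrite !inE mnm1E eqb0 negbK eq_sym. Qed.

Lemma lin_linear : linear lin.
Proof. by move=> c a b; apply/rowP => i; rewrite !mxE linearP mcoeffD mcoeffZ. Qed.
HB.instance Definition _ := GRing.isLinear.Build k A 'rV[k]_m _ lin lin_linear.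

Lemma lin_var i : lin (x i) = delta_mx 0 i.
Proof.
apply/rowP => j; rewrite !mxE (src_face xP _ (faces1 C j)) /face_var in_set1 eqxx /=.
rewrite eq_sym; have [->|ij] := eqVneq j i; first by rewrite mcoeffX eqxx.
by rewrite mcoeff0.
Qed.

Lemma ord_ge2P a : ord_ge 1 a -> lin a = 0 -> ord_ge 2 a.
Proof.
move=> a1 la s u sC; rewrite ltnS leq_eqVlt ltnS leqn0 => /orP[/mdeg1P[i /eqP->]|u0].
  have [iS|iS] := boolP (i \in s); last by rewrite src_coeff0 // mnm_supp1 sub1set.
  rewrite (@src_coeff_sub _ [set i] _ _ sC (faces1 C i)) ?mnm_supp1 ?sub1set ?inE //.
  by have := congr1 (fun v : 'rV_m => v 0 i) la; rewrite !mxE.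
by apply: a1 => //; rewrite (eqP u0).
Qed.

Lemma ord_ge2_lin a : ord_ge 2 a -> lin a = 0.
Proof. by move=> a2; apply/rowP => i; rewrite !mxE; apply: a2; rewrite ?mdeg1 ?faces1. Qed.

Lemma ord_ge1_gen a : exists c, ord_ge 1 (a - c%:A).
Proof.
exists (pi set0 a)@_0 => s u sC; rewrite ltnS leqn0 mdeg_eq0 => /eqP->.
have sup0 : mnm_supp 0%MM = set0 :> {set 'I_m}.
  by apply/setP => i; rewrite !inE mnm0E eqxx.
rewrite linearB /= mcoeffB (@src_coeff_sub s set0 a _ sC (faces0 C)) ?sup0 ?sub0set //.
by rewrite linearZ /= rmorph1 mcoeffZ mcoeff1 eqxx mulr1 subrr.
Qed.

Section Endomorphism.
Variable f : {lrmorphism A -> A}.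

Lemma ord_ge_endo j a :
  (forall i, ord_ge 1 (f (x i))) -> ord_ge j a -> ord_ge j (f a).
Proof.
move=> f1 /ord_ge_rep[p pj ->]; rewrite lrmorphism_mmap.
exact: ord_ge_pev.
Qed.

(** Such an f acts trivially on the successive quotients of the filtration by
    order, so that 1 is its only eigenvalue. *)
Lemma unipotent_eigen q a :
  (forall i, ord_ge 2 (f (x i) - x i)) -> q != 1 -> f a = q *: a -> a = 0.
Proof.
move=> f2 q1 fa.
have f1 i : ord_ge 1 (f (x i)).
  rewrite -[f _](subrK (x i)); apply: ord_geD (ord_ge_var i).
  exact: ord_geW (f2 i).
suff ja j : ord_ge j a by exact: ord_ge_inf.
elim: j => [|j IHj]; first exact: ord_ge_triv.
have [p pj aE] := ord_ge_rep IHj.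
have : ord_ge j.+1 (f a - a).
  rewrite {2}aE {1}aE lrmorphism_mmap; apply: ord_ge_perturb => //.
  exact: ord_ge_var.
rewrite fa -[X in _ - X]scale1r -scalerBl => /(ord_geZ (q - 1)^-1).
by rewrite scalerA mulVf ?scale1r // subr_eq0.
Qed.

End Endomorphism.

End Theory.
End Coordinates.

(** * Weights of a torus action *)

Section Weights.
Variables (k : fieldType) (q : k).
Hypothesis q_neq0 : q != 0.
Hypothesis q_free : forall z : int, q ^ z = 1 -> z = 0.
Variables (A : comAlgType k) (r : nat).

Definition dot (c w : 'rV[int]_r) : int := (c *m w^T) 0 0.

Lemma dotDl c d w : dot (c + d) w = dot c w + dot d w.
Proof. by rewrite /dot mulmxDl mxE. Qed.
Lemma dotDr c w v : dot c (w + v) = dot c w + dot c v.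
Proof. by rewrite /dot linearD /= mulmxDr mxE. Qed.
Lemma dot0l w : dot 0 w = 0.
Proof. by rewrite /dot mul0mx mxE. Qed.
Lemma dot0r c : dot c 0 = 0.
Proof. by rewrite /dot trmx0 mulmx0 mxE. Qed.
Lemma dotBr c w v : dot c (w - v) = dot c w - dot c v.
Proof. by rewrite /dot linearB /= mulmxBr !mxE. Qed.
Lemma dotZl z c w : dot (z *: c) w = z * dot c w.
Proof. by rewrite /dot -scalemxAl mxE. Qed.
Lemma dot_delta i w : dot (delta_mx 0 i) w = w 0 i.
Proof. by rewrite /dot -rowE !mxE. Qed.

Lemma q_exp_inj z z' : q ^ z = q ^ z' -> z = z'.
Proof.
move=> zz'; apply/eqP; rewrite -subr_eq0; apply/eqP/q_free.
by rewrite expfzDr // zz' -expfzDr // subrr.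
Qed.

Section Dedekind.
Variables (J : A -> Prop) (N : int).
Hypothesis J_lin : forall c a b, J a -> J b -> J (c *: a + b).
Hypothesis N_neq0 : N != 0.

(** Dedekind's independence of characters, relative to a subspace J: comparing
    the hypothesis at c and at c + s eliminates one of the characters. The factor
    N restricts the characters to a subgroup of finite index. *)
Lemma dedekind (W : seq 'rV[int]_r) (g : 'rV[int]_r -> A) : uniq W ->
  (forall c, J (\sum_(w <- W) q ^ (N * dot c w) *: g w)) ->
  forall w, w \in W -> J (g w).
Proof.
elim: W g => [//|w0 W IHW] g /= /andP[w0W uW] Jg.
have J0 : J 0 by have := J_lin (-1) (Jg 0) (Jg 0); rewrite scaleN1r addNr.
have JZ c a : J a -> J (c *: a) by move=> Ja; rewrite -[_ *: _]addr0; exact: J_lin.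
have JW w : w \in W -> J (g w).
  move=> wW; have [i wi] : exists i, w 0 i != w0 0 i.
    apply/existsP; rewrite -negb_forall; apply: contra w0W => /forallP ww0.
    suff <- : w = w0 by [].
    by apply/rowP => i; exact/eqP.
  pose s : 'rV[int]_r := delta_mx 0 i.
  have qs : q ^ (N * dot s w) - q ^ (N * dot s w0) != 0.
    rewrite subr_eq0; apply: contra wi => /eqP/q_exp_inj.
    by rewrite !dot_delta => /(mulfI N_neq0)->.
  pose g' v := (q ^ (N * dot s v) - q ^ (N * dot s w0)) *: g v.
  have /(JZ (q ^ (N * dot s w) - q ^ (N * dot s w0))^-1) : J (g' w).
    apply: IHW => // c.
    have := J_lin (- q ^ (N * dot s w0)) (Jg c) (Jg (c + s)).
    rewrite !big_cons scalerDr scaler_sumr addrACA scalerA mulNr -expfzDr //.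
    rewrite -mulrDr [dot s _ + _]addrC -dotDl scaleNr addNr add0r.
    rewrite -big_split /=; congr J; apply: eq_bigr => v _.
    rewrite /g' !scalerA -scalerDl; congr (_ *: _).
    by rewrite dotDl mulrDr expfzDr // mulrBr mulNr addrC [X in _ - X]mulrC.
  by rewrite /g' scalerA mulVf ?scale1r.
move=> w; rewrite in_cons => /predU1P[->|]; last exact: JW.
have := Jg 0; rewrite big_cons dot0l mulr0 expr0z scale1r => Js.
rewrite -[g w0](addrK (\sum_(j <- W) q ^ (N * dot 0 j) *: g j)) addrC -scaleN1r.
apply: J_lin => //; rewrite big_seq; apply: big_ind => // [a b Ja Jb|v vW].
  by rewrite -[a]scale1r; exact: J_lin.
exact/JZ/JW.
Qed.
End Dedekind.

(** The element tau c is the action of the point (q ^ c_0, q ^ c_1, ...) of the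
    torus. As q has infinite order these points are Zariski dense, so that they
    carry the same weights as the whole torus. *)
Record torus_action (tau : 'rV[int]_r -> {lrmorphism A -> A}) : Prop :=
  TorusAction {
  ta_id : forall a, tau 0 a = a;
  taD : forall c d a, tau (c + d) a = tau c (tau d a);
  ta_faithful : forall c, (forall a, tau c a = a) -> c = 0;
  ta_rational : forall a, exists (W : seq 'rV[int]_r) g, uniq W /\
    forall c, tau c a = \sum_(w <- W) q ^ (dot c w) *: g w }.

Variable tau : 'rV[int]_r -> {lrmorphism A -> A}.
Hypothesis tauP : torus_action tau.

Definition has_weight w a := forall c, tau c a = q ^ (dot c w) *: a.

Lemma weight_lin w c a b : has_weight w a -> has_weight w b -> has_weight w (c *: a + b).
Proof. by move=> wa wb d; rewrite linearP /= wa wb scalerDr !scalerA mulrC. Qed.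
Lemma weight0 w : has_weight w 0.
Proof. by move=> c; rewrite linear0 scaler0. Qed.
Lemma weightZ w c a : has_weight w a -> has_weight w (c *: a).
Proof. by move=> wa; rewrite -[_ *: _]addr0; apply: weight_lin => //; exact: weight0. Qed.
Lemma weightM v w a b : has_weight v a -> has_weight w b -> has_weight (v + w) (a * b).
Proof.
move=> va wb c; rewrite rmorphM /= va wb dotDr expfzDr // -scalerAl -scalerAr.
by rewrite scalerA.
Qed.
Lemma weight1 : has_weight 0 1.
Proof. by move=> c; rewrite rmorph1 dot0r expr0z scale1r. Qed.

Lemma weightX w a n : has_weight w a -> has_weight (w *+ n) (a ^+ n).
Proof.
move=> wa; elim: n => [|n IHn]; first exact: weight1.
by rewrite exprS mulrS; exact: weightM.
Qed.

Lemma weight_prod I (s : seq I) (w : I -> 'rV[int]_r) (a : I -> A) (n : I -> nat) :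
  (forall i, has_weight (w i) (a i)) ->
  has_weight (\sum_(i <- s) w i *+ n i) (\prod_(i <- s) a i ^+ n i).
Proof.
move=> wa; elim: s => [|i s IHs]; first by rewrite !big_nil; exact: weight1.
by rewrite !big_cons; apply: weightM => //; exact: weightX.
Qed.

Lemma weight_decomposition a : exists Wg : seq 'rV[int]_r * ('rV[int]_r -> A),
  [/\ uniq Wg.1, forall w, w \in Wg.1 -> has_weight w (Wg.2 w)
    & a = \sum_(w <- Wg.1) Wg.2 w].
Proof.
have [W [g [uW tE]]] := ta_rational tauP a.
exists (W, g); split=> //= [w wW d|]; last first.
  rewrite -[LHS](ta_id tauP) tE; apply: eq_bigr => w _.
  by rewrite dot0l expr0z scale1r.
pose J (b : A) := b = 0.
have Jlin c x y : J x -> J y -> J (c *: x + y).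
  by rewrite /J => -> ->; rewrite scaler0 add0r.
have H c : J (\sum_(w <- W) q ^ (1 * dot c w) *:
              (tau d (g w) - q ^ (dot d w) *: g w)).
  under eq_bigr => v _ do rewrite mul1r scalerBr.
  rewrite sumrB /J; apply/eqP; rewrite subr_eq0; apply/eqP.
  transitivity (tau d (tau c a)).
    by rewrite tE raddf_sum; apply: eq_bigr => v _; rewrite /= linearZ.
  rewrite -(taD tauP) tE; apply: eq_bigr => v _.
  by rewrite scalerA addrC dotDl expfzDr.
by have /eqP := dedekind Jlin (oner_neq0 _) uW H wW; rewrite subr_eq0 => /eqP.
Qed.

Definition weights_of a : seq 'rV[int]_r := (sval (cid (weight_decomposition a))).1.
(** The projection on the space of weight w, obtained by choosing a decomposition
    of each element; it does not depend on the choice. *)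
Definition component w a : A :=
  if w \in weights_of a then (sval (cid (weight_decomposition a))).2 w else 0.

Lemma weights_uniq a : uniq (weights_of a).
Proof. by rewrite /weights_of; case: cid => ? []. Qed.

Lemma component_weight w a : has_weight w (component w a).
Proof.
rewrite /component /weights_of; case: cid => -[W g] /= [_ gh _].
by case: ifP => [/gh//|_]; exact: weight0.
Qed.

Lemma component_out w a : w \notin weights_of a -> component w a = 0.
Proof. by rewrite /component => /negbTE->. Qed.

Lemma component_sum a : a = \sum_(w <- weights_of a) component w a.
Proof.
have -> : \sum_(w <- weights_of a) component w a =
    \sum_(w <- weights_of a) (sval (cid (weight_decomposition a))).2 w.
  by apply: eq_big_seq => w wW; rewrite /component wW.
by rewrite /weights_of; case: cid => -[W g] /= [].
Qed.

Lemma weight_sum0 (W : seq 'rV[int]_r) (g : 'rV[int]_r -> A) : uniq W ->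
  (forall w, w \in W -> has_weight w (g w)) -> \sum_(w <- W) g w = 0 ->
  forall w, w \in W -> g w = 0.
Proof.
move=> uW gh g0; apply: (@dedekind (fun a => a = 0) 1) => //.
  by move=> c a b -> ->; rewrite scaler0 addr0.
move=> c /=; transitivity (tau c (\sum_(w <- W) g w)); last by rewrite g0 linear0.
by rewrite raddf_sum; apply: eq_big_seq => w /gh/= ->; rewrite mul1r.
Qed.

Lemma component_eq w (W : seq 'rV[int]_r) (g : 'rV[int]_r -> A) a : uniq W ->
  (forall w, w \in W -> has_weight w (g w)) -> a = \sum_(w <- W) g w ->
  component w a = if w \in W then g w else 0.
Proof.
move=> uW gh aE; pose g' v := if v \in W then g v else 0.
pose V := undup (weights_of a ++ W).
have sub_sum (U : seq 'rV[int]_r) (h : 'rV[int]_r -> A) : uniq U -> {subset U <= V} ->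
    (forall v, v \notin U -> h v = 0) -> \sum_(v <- V) h v = \sum_(v <- U) h v.
  move=> uU UV h0; rewrite (bigID (mem U)) /= [X in _ + X]big1 ?addr0 => [|v /h0//].
  rewrite -big_filter; apply: perm_big; apply: uniq_perm => //.
    by rewrite filter_uniq ?undup_uniq.
  by move=> v; rewrite mem_filter andb_idr // => /UV.
have dec v : v \in V -> component v a - g' v = 0.
  apply: (@weight_sum0 V (fun v => component v a - g' v)) => [|u _|]; first exact: undup_uniq.
    rewrite -scaleN1r addrC; apply: weight_lin; last exact: component_weight.
    by rewrite /g'; case: ifP => [/gh//|_]; exact: weight0.
  rewrite sumrB (sub_sum (weights_of a)); first last.
  - by move=> u /component_out.
  - by move=> u va; rewrite mem_undup mem_cat va.
  - exact: weights_uniq.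
  rewrite (sub_sum W) //; first last.
  - by move=> u /negbTE vW; rewrite /g' vW.
  - by move=> u va; rewrite mem_undup mem_cat va orbT.
  rewrite -component_sum {1}aE; apply/eqP; rewrite subr_eq0; apply/eqP.
  by apply: eq_big_seq => u uw; rewrite /g' uw.
have [wV|] := boolP (w \in V); first by apply/eqP; rewrite -subr_eq0; apply/eqP/dec.
rewrite mem_undup mem_cat negb_or => /andP[/component_out-> /negbTE->] //.
Qed.

Lemma component_linear w : linear (component w).
Proof.
move=> c a b; pose V := undup (weights_of a ++ weights_of b).
have sub_sum a' : {subset weights_of a' <= V} -> a' = \sum_(v <- V) component v a'.
  move=> aV; rewrite [LHS]component_sum [RHS](bigID (mem (weights_of a'))) /=.
  rewrite [X in _ + X]big1 ?addr0 => [|v /component_out//].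
  rewrite -[RHS]big_filter; apply: perm_big; apply: uniq_perm.
  - exact: weights_uniq.
  - by rewrite filter_uniq ?undup_uniq.
  by move=> v; rewrite mem_filter andb_idr // => /aV.
rewrite (@component_eq w V (fun v => c *: component v a + component v b)); first last.
- rewrite big_split -scaler_sumr /= -!sub_sum // => v;
  by rewrite mem_undup mem_cat => ->; rewrite ?orbT.
- by move=> v _; apply: weight_lin; exact: component_weight.
- exact: undup_uniq.
case: ifP => // /negbT; rewrite mem_undup mem_cat negb_or => /andP[wa wb].
by rewrite !component_out // scaler0 addr0.
Qed.
HB.instance Definition _ w := GRing.isLinear.Build k A A _ (component w) (component_linear w).

Lemma component_id w a : has_weight w a -> component w a = a.
Proof.
move=> wa; rewrite (@component_eq w [:: w] (fun=> a)) ?mem_head // ?big_seq1 //.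
by move=> v; rewrite inE => /eqP->.
Qed.

Lemma component_neq v w a : has_weight v a -> v != w -> component w a = 0.
Proof.
move=> va vw; rewrite (@component_eq w [:: v] (fun=> a)) ?big_seq1 //.
  by rewrite inE eq_sym (negbTE vw).
by move=> u; rewrite inE => /eqP->.
Qed.

Lemma componentM v w a b : has_weight v b -> component w (a * b) = component (w - v) a * b.
Proof.
move=> vb; rewrite [in LHS](component_sum a) mulr_suml raddf_sum /=.
have prE u : component w (component u a * b) = if u == w - v then component u a * b else 0.
  have uvb : has_weight (u + v) (component u a * b).
    by apply: weightM => //; exact: component_weight.
  rewrite -subr_eq opprK; case: ifPn => [/eqP uvw|]; last exact: component_neq.
  by rewrite -uvw component_id.
under eq_bigr do rewrite prE.
have [wW|wW] := boolP (w - v \in weights_of a); last first.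
  rewrite component_out // mul0r big1_seq // => u /= uW.
  by case: eqP uW wW => // -> ->.
rewrite (bigD1_seq (w - v)) ?weights_uniq //= eqxx big1 ?addr0 // => u /negbTE->//.
Qed.

Lemma component_tau w c a : component w (tau c a) = q ^ dot c w *: component w a.
Proof.
rewrite (@component_eq w (weights_of a) (fun v => q ^ dot c v *: component v a)).
- by case: ifPn => // /component_out->; rewrite scaler0.
- exact: weights_uniq.
- by move=> v _; apply: weightZ; exact: component_weight.
rewrite {1}[a]component_sum raddf_sum; apply: eq_bigr => v _; exact: component_weight.
Qed.

(** Independence of characters modulo J. It is enough that a subgroup of finite
    index preserves J. *)
Lemma component_stable (J : A -> Prop) (N : int) w a :
  (forall c a b, J a -> J b -> J (c *: a + b)) -> N != 0 ->
  (forall c a, J a -> J (tau (N *: c) a)) -> J a -> J (component w a).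
Proof.
move=> Jlin N0 Jtau Ja; have [wW|/component_out->] := boolP (w \in weights_of a); last first.
  by have := Jlin (-1) _ _ Ja Ja; rewrite scaleN1r addNr.
apply: (@dedekind J N Jlin N0 _ (fun w => component w a) (weights_uniq a) _ w wW) => c.
suff <- : tau (N *: c) a = \sum_(w0 <- weights_of a) q ^ (N * dot c w0) *: component w0 a.
  exact: Jtau.
rewrite {1}[a]component_sum raddf_sum; apply: eq_bigr => v _ /=.
by rewrite component_weight dotZl.
Qed.

End Weights.

(** * Linear algebra and algebraic dependence *)

Section LinearAlgebra.

(** The dimension bounds the size of independent families, so one of them has maximal
    size. *)
Lemma max_free (K : fieldType) d (X : Type) (Q : X -> Prop) (v : X -> 'rV[K]_d) :
  exists r (g : 'I_r -> X), [/\ forall i, Q (g i), row_free (\matrix_i v (g i))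
    & forall x, Q x -> (v x <= \matrix_i v (g i))%MS].
Proof.
pose P r := `[< exists g : 'I_r -> X,
  (forall i, Q (g i)) /\ row_free (\matrix_i v (g i)) >].
have P0 : exists r, P r.
  exists 0%N; apply/asboolP; exists (fun i : 'I_0 => match i with Ordinal _ H =>
    False_rect X (notF H) end).
  by split=> [[]//|]; rewrite -row_leq_rank.
have Pd r : P r -> (r <= d)%N.
  by case/asboolP => g [_ gf]; rewrite -(eqP gf) rank_leq_col.
have [r /asboolP[g [Qg gf]] rmax] := ex_maxnP P0 Pd.
exists r, g; split=> // x Qx; apply: contraT => xg.
pose g' (i : 'I_r.+1) := if unlift ord0 i is Some j then g j else x.
suff /rmax : P r.+1 by rewrite ltnn.
apply/asboolP; exists g'; split=> [i|]; first by rewrite /g'; case: unlift.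
set M := \matrix_i v (g i) in gf xg *; set M' := \matrix_i v (g' i).
rewrite -row_leq_rank.
have MM : (M + v x <= M')%MS.
  rewrite addsmx_sub; apply/andP; split.
    apply/row_subP => i; rewrite rowK.
    have -> : v (g i) = row (lift ord0 i) M' by rewrite rowK /g' liftK.
    exact: row_sub.
  have -> : v x = row ord0 M' by rewrite rowK /g' unlift_none.
  exact: row_sub.
apply: leq_trans (mxrankS MM); rewrite -{1}(eqP gf).
apply: rank_ltmx; rewrite ltmxE addsmxSl /=.
by apply: contra xg; apply: submx_trans; exact: addsmxSr.
Qed.

Lemma row_free_zero_cols (K : fieldType) r m (M : 'M[K]_(r, m)) (F : {set 'I_m}) :
  row_free M -> (forall i j, j \in F -> M i j = 0) -> (r + #|F| <= m)%N.
Proof.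
move=> Mf M0; pose N : 'M[K]_(r, #|~: F|) := \matrix_(i, j) M i (enum_val j).
have Nf : row_free N.
  apply: inj_row_free => u uN; apply: (row_free_inj Mf); rewrite mul0mx.
  apply/rowP => j; rewrite !mxE; have [jF|jF] := boolP (j \in F).
    by rewrite big1 // => i _; rewrite M0 ?mulr0.
  have jF' : j \in ~: F by rewrite inE.
  have := congr1 (fun v : 'rV_#|~: F| => v 0 (enum_rank_in jF' j)) uN.
  rewrite !mxE => uN0; rewrite -{}[RHS]uN0.
  by apply: eq_bigr => i _; rewrite !mxE enum_rankK_in.
have := rank_leq_col N; rewrite (eqP Nf) => rF.
by rewrite -[leqRHS](card_ord m) -(cardsC F) addnC leq_add2l.
Qed.

(** A cocharacter that kills given weights: solve over the rationals and clear the
    denominators. *)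
Lemma int_orthogonal d r (w : 'I_r -> 'rV[int]_d) :
  (\rank (\matrix_i map_mx (intr : int -> rat) (w i)) < d)%N ->
  exists2 c : 'rV[int]_d, c != 0 & forall i, dot c (w i) = 0.
Proof.
set M := \matrix_i _ => Md.
have : kermx M^T != 0.
  by rewrite kermx_eq0 -row_leq_rank mxrank_tr -ltnNge.
case/rowV0Pn => u; rewrite sub_kermx => /eqP uM u0.
pose N : int := \prod_j denq (u 0 j).
have N0 : N != 0 by apply/prodf_neq0 => j _; exact: denq_neq0.
have /fin_all_exists[c cE] j : exists z : int, N%:~R * u 0 j = z%:~R.
  exists (\prod_(i | i != j) denq (u 0 i) * numq (u 0 j)).
  rewrite intrM numqE /N (bigD1 j) //= intrM mulrAC mulrC mulrA.
  by rewrite -!mulrA [u 0 j * _]mulrC.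
exists (\row_j c j).
  apply: contra u0 => /eqP/rowP c0; apply/eqP/rowP => j.
  have := cE j; have := c0 j; rewrite !mxE => -> /eqP.
  by rewrite mulf_eq0 intr_eq0 (negbTE N0) => /eqP.
move=> i; apply/eqP; rewrite -(intr_eq0 rat); apply/eqP.
have := congr1 (fun v : 'rV_r => N%:~R * v 0 i) uM; rewrite !mxE mulr0 => <-.
rewrite /dot !mxE mulr_sumr rmorph_sum; apply: eq_bigr => j _.
by rewrite !mxE /= mulrA cE intrM.
Qed.

End LinearAlgebra.

Section Dependence.
Variables (K : fieldType) (m f : nat) (S : {set 'I_m}).
Variable g : 'I_f -> {mpoly K[m]}.
Hypothesis gS : forall i u, ~~ (mnm_supp u \subset S) -> (g i)@_u = 0.

Lemma mmap1_support u v : ~~ (mnm_supp v \subset S) -> (mmap1 g u)@_v = 0.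
Proof.
pose Q (p : {mpoly K[m]}) := forall v, ~~ (mnm_supp v \subset S) -> p@_v = 0.
have Q1 : Q 1.
  move=> w; rewrite mcoeff1; case: eqP => // ->; case/subsetP => i.
  by rewrite inE mnm0E eqxx.
have QM p p' : Q p -> Q p' -> Q (p * p').
  move=> Qp Qp' w wS; rewrite mcoeffM big1 // => -[a b] /= /eqP wE.
  have [aS|aS] := boolP (mnm_supp a \subset S); last by rewrite Qp // mul0r.
  have [bS|bS] := boolP (mnm_supp b \subset S); last by rewrite Qp' // mulr0.
  case/negP: wS; apply/subsetP => i; rewrite inE wE mnmDE addn_eq0 negb_and.
  by case/orP => H; [apply: (subsetP aS)|apply: (subsetP bS)]; rewrite inE.
suff : Q (mmap1 g u) by exact.
apply: big_ind => // i _; elim: (u i) => [//|l IHl].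
by rewrite exprS; apply: QM => // w; exact: gS.
Qed.

Lemma mmap1_degree E u : (forall i, msize (g i) <= E)%N ->
  (msize (mmap1 g u) <= (mdeg u * E).+1)%N.
Proof.
move=> gE; have sM (p p' : {mpoly K[m]}) a b :
    (msize p <= a.+1)%N -> (msize p' <= b.+1)%N -> (msize (p * p') <= (a + b).+1)%N.
  have [->|p0] := eqVneq p 0; first by rewrite mul0r msize0.
  have [->|p'0] := eqVneq p' 0; first by rewrite mulr0 msize0.
  rewrite msizeM // => pa pb; rewrite -subn1 leq_subLR add1n -addSn -addnS.
  exact: leq_add.
rewrite mdegE /mmap1; elim: (index_enum _) => [|i s IHs].
  by rewrite !big_nil msize1.
rewrite !big_cons mulnDl; apply: (sM) => //.
elim: (u i) => [|l IHl]; first by rewrite expr0 msize1.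
by rewrite exprS mulSn; apply: sM => //; exact: leq_trans (gE i) _.
Qed.

(** By counting: the monomials in g with exponents below N are N ^ f many, and
    they live in a space of dimension of order N ^ #|S|, which is smaller when N
    is large. *)
Lemma algebraic_dependence : (#|S| < f)%N ->
  exists2 p : {mpoly K[f]}, p != 0 & pev g p = 0.
Proof.
move=> Sf; pose E := \max_i msize (g i).
have gE i : (msize (g i) <= E)%N by exact: leq_bigmax.
(* B bounds the degrees of the monomials in g with exponents below N. *)
pose N := ((f * E).+1 ^ #|S|).+1; pose B := (f * N * E)%N.
pose X := {ffun 'I_f -> 'I_N}.
pose Y := [set t : {ffun 'I_m -> 'I_B.+1} | t \in pffun_on ord0 (mem S) predT].
pose ex (e : X) : 'X_{1..f} := [multinom e i : nat | i < f].
pose ey (t : {ffun 'I_m -> 'I_B.+1}) : 'X_{1..m} := [multinom t i : nat | i < m].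
pose M : 'M[K]_(#|X|, #|Y|) :=
  \matrix_(i, j) (mmap1 g (ex (enum_val i)))@_(ey (enum_val j)).
have : kermx M != 0.
  rewrite kermx_eq0 -row_leq_rank -ltnNge; apply: leq_ltn_trans (rank_leq_col _) _.
  have -> : #|Y| = (B.+1 ^ #|S|)%N.
    rewrite cardsE (card_pffun_on ord0 (mem S) predT) //.
    by rewrite (eq_card (B := {: 'I_B.+1})) ?card_ord.
  rewrite card_ffun !card_ord.
  apply: (@leq_ltn_trans ((N * (f * E).+1) ^ #|S|)%N).
    have [->|S0] := posnP #|S|; first by rewrite !expn0.
    rewrite leq_exp2r // mulnS /B mulnA [(N * f)%N]mulnC addnC -addn1 leq_add2l //.
  rewrite expnMn; apply: (@leq_trans (N ^ #|S|.+1)%N).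
    by rewrite expnSr ltn_pmul2l // expn_gt0.
  by rewrite leq_pexp2l.
case/rowV0Pn => c; rewrite sub_kermx => /eqP cM c0.
pose p := \sum_(i < #|X|) c 0 i *: 'X_[ex (enum_val i)] : {mpoly K[f]}.
have ex_inj : injective ex.
  move=> e e' /mnmP ee'; apply/ffunP => i; apply/val_inj.
  by have := ee' i; rewrite !mnmE.
exists p.
  apply: contra c0 => /eqP p0; apply/eqP/rowP => i; rewrite mxE.
  have := congr1 (mcoeff (ex (enum_val i))) p0.
  rewrite mcoeff0 /p raddf_sum /= (bigD1 i) //= mcoeffZ mcoeffX eqxx mulr1.
  rewrite big1 ?addr0 // => j ji; rewrite mcoeffZ mcoeffX.
  case: eqP => [/ex_inj/enum_val_inj ij|_]; last by rewrite mulr0.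
  by rewrite ij eqxx in ji.
have -> : pev g p = \sum_(i < #|X|) c 0 i *: mmap1 g (ex (enum_val i)).
  by rewrite /p raddf_sum /=; apply: eq_bigr => i _; rewrite mmapZ mmapX mulr_algl.
apply/mpolyP => v; rewrite mcoeff0 raddf_sum /=.
have [vS|vS] := boolP (mnm_supp v \subset S); last first.
  by rewrite big1 // => i _; rewrite mcoeffZ mmap1_support // mulr0.
have [vB|vB] := leqP (mdeg v) B; last first.
  rewrite big1 // => i _; rewrite mcoeffZ.
  suff /eqP-> : (mmap1 g (ex (enum_val i)))@_v == 0 by rewrite mulr0.
  rewrite mcoeff_eq0; apply: contraL vB => /msize_mdeg_lt vlt.
  rewrite -leqNgt -ltnS; apply: leq_trans vlt _.
  apply: leq_trans (mmap1_degree _ gE) _; rewrite ltnS leq_mul2r.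
  apply/orP; right; rewrite mdegE -[X in (X * N)%N](card_ord f) -sum_nat_const.
  by apply: leq_sum => j _; rewrite mnmE ltnW.
pose t : {ffun 'I_m -> 'I_B.+1} := [ffun i => inord (v i)].
have tv : ey t = v.
  apply/mnmP => i; rewrite mnmE ffunE inordK // ltnS; apply: leq_trans vB.
  by rewrite mdegE (bigD1 i) //= leq_addr.
have tY : t \in Y.
  rewrite inE; apply/pffun_onP; split=> [|i //].
  apply/subsetP => i; rewrite inE => ti; apply: (subsetP vS).
  rewrite inE -tv mnmE; apply: contra ti => /eqP ti.
  by apply/eqP/val_inj.
have := congr1 (fun u : 'rV_#|Y| => u 0 (enum_rank_in tY t)) cM.
rewrite !mxE => cM0; rewrite -[RHS]cM0; apply: eq_bigr => i _.
by rewrite mcoeffZ mxE enum_rankK_in // tv.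
Qed.

End Dependence.

(** * Large tori act with full rank on every component *)

Section Facets.
Variables (k : fieldType) (A : comAlgType k) (m : nat) (C : simplicial_complex m).
Variables (x : 'I_m -> A) (pi : {set 'I_m} -> {lrmorphism A -> {mpoly k[m]}}).
Hypothesis xP : sr_coordinates C x pi.

Definition facet (F : {set 'I_m}) := maxset (fun s => s \in C) F.

Lemma facet_face F : facet F -> F \in C.
Proof. exact: maxsetp. Qed.

Lemma face_in_facet s : s \in C -> exists2 F, facet F & s \subset F.
Proof.
move=> sC; have [F FC sF] := @maxset_exists _ (fun s => s \in C) s sC.
by exists F.
Qed.

Lemma facet_inj a : (forall F, facet F -> pi F a = 0) -> a = 0.
Proof.
move=> a0; apply: (src_inj xP) => s sC; apply/mpolyP => u; rewrite mcoeff0.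
have [F Ff sF] := face_in_facet sC.
have [us|us] := boolP (mnm_supp u \subset s); last exact: (src_coeff0 xP).
rewrite (src_coeff_sub xP _ sC (facet_face Ff)) //; last exact: subset_trans sF.
by rewrite a0 // mcoeff0.
Qed.

Lemma mpolyXi_neq0 i : 'X_i != 0 :> {mpoly k[m]}.
Proof.
apply/eqP => /(congr1 (mcoeff U_(i))); rewrite mcoeffX eqxx mcoeff0.
by move/eqP; rewrite oner_eq0.
Qed.

Lemma facet_var0 F i : facet F -> (pi F (x i) == 0) = (i \notin F).
Proof.
move=> /facet_face FC; rewrite (src_face xP) // /face_var.
by case: ifP => _; rewrite ?eqxx // (negbTE (mpolyXi_neq0 i)).
Qed.

Lemma facet_kernel_eq F G : facet F -> facet G ->
  (forall a, pi G a = 0 -> pi F a = 0) -> G = F.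
Proof.
move=> Ff Gf GF; apply: (maxsetsup Ff (facet_face Gf)).
apply/subsetP => i; apply: contraLR; rewrite -(facet_var0 i Gf) => /eqP/GF/eqP.
by rewrite facet_var0.
Qed.

(** The kernel of pi F is prime and the product of the kernels of all facets is
    zero, so the preimage of the former under h contains one of the latter. *)
Lemma facet_pullback (h : {lrmorphism A -> A}) F : facet F ->
  exists2 G, facet G & forall a, pi G a = 0 -> pi F (h a) = 0.
Proof.
move=> Ff; apply: contrapT => nG.
have /choice[b bP] G : exists b, facet G -> pi G b = 0 /\ pi F (h b) != 0.
  have [Gf|Gf] := boolP (facet G); last by exists 0.
  apply: contrapT => nb; apply: nG; exists G => // a Ga.
  apply/eqP; apply: contrapT => /negP Fa; apply: nb; exists a => _; split=> //.
have prod0 : \prod_(G | facet G) b G = 0.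
  apply: facet_inj => G Gf; rewrite (bigD1 G) //= rmorphM /=.
  by rewrite (bP G Gf).1 mul0r.
have /eqP := congr1 (fun a => pi F (h a)) prod0.
rewrite /= !raddf0 !rmorph_prod /= prodf_seq_eq0 => /hasP[G _ /andP[Gf]].
by rewrite (negbTE (bP G Gf).2).
Qed.

(** An automorphism permutes the kernels of the facets, which are finitely many.
    This plays the part of the connectedness of the torus: up to finite index it
    preserves every irreducible component. *)
Lemma facet_iter_stable (h g : {lrmorphism A -> A}) F a : cancel g h -> cancel h g ->
  facet F -> pi F a = 0 -> pi F (iter #|{set 'I_m}|`! h a) = 0.
Proof.
move=> gK hK.
have ex (h' : {lrmorphism A -> A}) : exists s : {set 'I_m} -> {set 'I_m},
    forall F, (facet F -> facet (s F) /\
      forall a, pi (s F) a = 0 -> pi F (h' a) = 0) /\ (~~ facet F -> s F = F).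
  have /choice[s sP] : forall F, exists G, (facet F -> facet G /\
      forall a, pi G a = 0 -> pi F (h' a) = 0) /\ (~~ facet F -> G = F).
    move=> H; have [Hf|Hf] := boolP (facet H); last by exists H.
    by have [G' ? ?] := facet_pullback h' Hf; exists G'.
  by exists s.
have [s sP] := ex h; have [s' s'P] := ex g.
have s_inj : injective s.
  apply: (can_inj (g := s')) => G; have [sf snf] := sP G.
  have [Gf|Gf] := boolP (facet G); last by rewrite snf // (s'P G).2.
  have [sGf sG] := sf Gf; have [s'Gf s'G] := (s'P (s G)).1 sGf.
  by apply: facet_kernel_eq => // b /s'G/sG; rewrite gK; exact.
have it j G b : facet G ->
    facet (iter j s G) /\ (pi (iter j s G) b = 0 -> pi G (iter j h b) = 0).
  move=> Gf; elim: j b => [|j IHj] b; first by split.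
  have [jf jP] := IHj (h b); have [sjf sj] := (sP (iter j s G)).1 jf.
  by split=> //= /sj/jP; rewrite -iterSr.
move=> Ff Fa; apply: (it _ _ _ Ff).2.
suff -> : iter #|{set 'I_m}|`! s F = F by [].
have /dvdnP[l ->] : (fingraph.order s F %| #|{set 'I_m}|`!)%N.
  by apply: dvdn_fact; rewrite fingraph.order_gt0 /fingraph.order max_card.
elim: l => [//|l IHl]; by rewrite mulSn iterD IHl iter_order.
Qed.

End Facets.

Section TorusOnFacets.
Variables (k : closedFieldType) (q : k).
Hypothesis q_neq0 : q != 0.
Hypothesis q_free : forall z : int, q ^ z = 1 -> z = 0.
Variables (A : comAlgType k) (m : nat) (C : simplicial_complex m).
Variables (x : 'I_m -> A) (pi : {set 'I_m} -> {lrmorphism A -> {mpoly k[m]}}).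
Hypothesis xP : sr_coordinates C x pi.
Variables (r : nat) (tau : 'rV[int]_r -> {lrmorphism A -> A}).
Hypothesis tauP : torus_action q tau.

Local Notation has_weight := (has_weight q tau).
Local Notation component := (component q_neq0 q_free tauP).
Local Notation ord_ge := (ord_ge C pi).
Local Notation lin := (lin pi).

Definition stable (J : A -> Prop) := exists2 N : int, N != 0 &
  forall c a, J a -> J (tau (N *: c) a).

Lemma facet_tau_stable F : facet C F -> stable (fun a => pi F a = 0).
Proof.
move=> Ff; exists #|{set 'I_m}|`!%:Z => [|c a Fa].
  by rewrite eqz_nat -lt0n fact_gt0.
suff -> : tau (#|{set 'I_m}|`!%:Z *: c) a = iter #|{set 'I_m}|`! (tau c) a.
  have K d b : tau (- d) (tau d b) = b.
    by rewrite -(taD tauP) addNr (ta_id tauP).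
  apply: (facet_iter_stable xP (g := tau (- c))) => // b.
  by have := K (- c) b; rewrite opprK.
elim: #|{set 'I_m}|`! => [|l IHl]; first by rewrite scale0r (ta_id tauP).
by rewrite intS scalerDl scale1r (taD tauP) IHl.
Qed.

Lemma component_facet F w a : facet C F -> pi F a = 0 -> pi F (component w a) = 0.
Proof.
move=> Ff Fa; have [N N0 tN] := facet_tau_stable Ff.
apply: (@component_stable _ _ q_neq0 q_free _ _ _ tauP (fun a => pi F a = 0) N) => //.
by move=> c b b' Fb Fb'; rewrite linearP /= Fb Fb' scaler0 addr0.
Qed.

Lemma tau_id_of_weights c :
  (forall w a, has_weight w a -> dot c w = 0 \/ a = 0) -> c = 0.
Proof.
move=> cw; apply: (ta_faithful tauP) => a.
rewrite {1}(component_sum q_neq0 q_free tauP a) raddf_sum.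
rewrite [RHS](component_sum q_neq0 q_free tauP a); apply: eq_bigr => w _ /=.
have wh := component_weight q_neq0 q_free tauP w a.
case: (cw _ _ wh) => [c0|->]; last by rewrite linear0.
by rewrite wh c0 expr0z scale1r.
Qed.

Lemma facet_ord1 F a : facet C F -> pi F a = 0 -> ord_ge 1 a.
Proof.
move=> /facet_face FC Fa s u sC; rewrite ltnS leqn0 mdeg_eq0 => /eqP->.
have sup0 : mnm_supp 0%MM = set0 :> {set 'I_m}.
  by apply/setP => i; rewrite !inE mnm0E eqxx.
by rewrite (src_coeff_sub xP a sC FC) ?sup0 ?sub0set // Fa mcoeff0.
Qed.

Lemma facet_lin F a j : facet C F -> pi F a = 0 -> j \in F -> lin a 0 j = 0.
Proof.
move=> /facet_face FC Fa jF; rewrite mxE.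
by rewrite (src_coeff_sub xP a (faces1 C j) FC) ?mnm_supp1 ?sub1set ?set11 // Fa mcoeff0.
Qed.

(** A torus element that is unipotent at the origin is trivial, being also
    diagonalizable. *)
Lemma tau_unipotent c :
  (forall w a, has_weight w a -> ord_ge 2 (tau c a - a)) -> c = 0.
Proof.
move=> c2; apply: tau_id_of_weights => w a wa.
have [c0|c0] := eqVneq (dot c w) 0; [by left|right].
apply: (unipotent_eigen xP (f := tau c) (q := q ^ dot c w)) => [i||].
- have xE := component_sum q_neq0 q_free tauP (x i).
  rewrite [in X in X - _]xE {3}xE raddf_sum -sumrB; apply: ord_ge_sum => v _ /=.
  exact/c2/component_weight.
- by apply: contra c0 => /eqP/q_free->.
- exact: wa.
Qed.

(** On each component, a torus of rank at least m has as many independent weights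
    as the dimension of the component allows. Otherwise choose a maximal family h of
    weight vectors not vanishing on the component, and weight vectors y vanishing on
    it whose linear parts span those of all such vectors. There are fewer than m
    of them in total, so some nonzero cocharacter c kills their weights. It acts
    trivially on the component and on the linear parts, hence unipotently at the
    origin. *)
Lemma facet_weights F : (m <= r)%N -> facet C F -> exists f (h : 'I_f -> A * 'rV[int]_r),
  [/\ (#|F| <= f)%N, forall i, has_weight (h i).2 (h i).1,
      forall i, pi F (h i).1 != 0
    & row_free (\matrix_i map_mx (intr : int -> rat) (h i).2)].
Proof.
move=> mr Ff.
have [f [h [hQ hf hmax]]] := @max_free rat r (A * 'rV[int]_r)
  (fun aw => has_weight aw.2 aw.1 /\ pi F aw.1 != 0)
  (fun aw => map_mx (intr : int -> rat) aw.2).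
exists f, h; split=> // [|i|i]; [|exact: (hQ i).1|exact: (hQ i).2].
rewrite leqNgt; apply/negP => fF.
have [e [y [yQ yf ymax]]] := @max_free k m (A * 'rV[int]_r)
  (fun aw => has_weight aw.2 aw.1 /\ pi F aw.1 = 0) (fun aw => lin aw.1).
have eF : (e + #|F| <= m)%N.
  apply: row_free_zero_cols yf _ => i j jF; rewrite mxE.
  exact: (facet_lin Ff (yQ i).2).
pose w (i : 'I_(f + e)) := match split i with inl j => (h j).2 | inr j => (y j).2 end.
have [|c c0 cw] := @int_orthogonal r (f + e) w.
  apply: leq_ltn_trans (rank_leq_row _) _; apply: leq_trans mr.
  by apply: leq_trans eF; rewrite addnC ltn_add2l.
have ch j : dot c (h j).2 = 0.
  by rewrite -[RHS](cw (lshift e j)) /w (unsplitK (inl j)).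
have cy j : dot c (y j).2 = 0.
  by rewrite -[RHS](cw (rshift f j)) /w (unsplitK (inr j)).
have cF v a : has_weight v a -> pi F a != 0 -> dot c v = 0.
  move=> va Fa; have /submxP[D vD] := hmax (a, v) (conj va Fa).
  apply/eqP; rewrite -(intr_eq0 rat); apply/eqP.
  have -> : (dot c v)%:~R = (map_mx intr c *m (map_mx intr v)^T) 0 0 :> rat.
    rewrite /dot !mxE rmorph_sum; apply: eq_bigr => i _.
    by rewrite !mxE /= intrM.
  rewrite vD trmx_mul mulmxA [_ *m (\matrix_i _)^T](_ : _ = 0) ?mul0mx ?mxE //.
  apply/rowP => j; rewrite [RHS]mxE -[RHS](mulr0z 1) -(ch j) /dot !mxE rmorph_sum.
  by apply: eq_bigr => i _; rewrite !mxE /= intrM.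
have tF v a : has_weight v a -> pi F (tau c a - a) = 0.
  move=> va; rewrite va; have [Fa|Fa] := eqVneq (pi F a) 0.
    by rewrite linearB linearZ /= Fa scaler0 subrr.
  by rewrite (cF v a) // expr0z scale1r subrr linear0.
have tx1 i : ord_ge 1 (tau c (x i)).
  rewrite -[tau c _](subrK (x i)); apply: ord_geD (ord_ge_var xP i).
  apply: (facet_ord1 Ff); have xE := component_sum q_neq0 q_free tauP (x i).
  rewrite [in X in X - _]xE {3}xE raddf_sum -sumrB raddf_sum big1 // => v _ /=.
  exact/tF/component_weight.
suff c0' : c = 0 by rewrite c0' eqxx in c0.
apply: tau_unipotent => v a va; have [Fa|Fa] := eqVneq (pi F a) 0; last first.
  by rewrite va (cF v a) // expr0z scale1r subrr; exact: ord_ge0.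
have /submxP[D aD] := ymax (a, v) (conj va Fa).
pose d := a - \sum_j D 0 j *: (y j).1.
have Fd : pi F d = 0.
  rewrite linearB linear_sum /= Fa big1 ?subrr // => j _.
  by rewrite linearZ /= (yQ j).2 scaler0.
have d2 : ord_ge 2 d.
  apply: (ord_ge2P xP); first exact: facet_ord1 Fd.
  rewrite linearB /= aD linear_sum /=.
  apply/eqP; rewrite subr_eq0; apply/eqP/rowP => i; rewrite !mxE summxE.
  by apply: eq_bigr => j _; rewrite linearZ !mxE.
have -> : tau c a - a = tau c d - d.
  rewrite /d raddfB opprB /= raddf_sum.
  under [X in _ - X + _]eq_bigr => j _.
    rewrite /= linearZ /= (yQ j).1 cy expr0z scale1r; over.
  by rewrite addrA subrK.
by apply: ord_geB => //; exact: (ord_ge_endo xP tx1).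
Qed.

End TorusOnFacets.

(** * A fixed point of a large torus *)

Section Translation.
Variables (k : fieldType) (A : comAlgType k) (m : nat) (C : simplicial_complex m).
Variables (x : 'I_m -> A) (pi : {set 'I_m} -> {lrmorphism A -> {mpoly k[m]}}).
Hypothesis xP : sr_coordinates C x pi.

Lemma src_translation_nonface (p : 'I_m -> k) u :
  (forall i F, p i != 0 -> facet C F -> i \in F) -> mnm_supp u \notin C ->
  mmap1 (fun i => x i - (p i)%:A) u = 0.
Proof.
(* Only the variables that are not translated decide whether u is a face. *)
move=> pF uC; pose v := [multinom if p i == 0%R then u i else 0%N | i < m].
have vC : mnm_supp v \notin C.
  apply: contra uC => /face_in_facet[F Ff vF].
  apply: (faces_sub (facet_face Ff)); apply/subsetP => i; rewrite inE => ui.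
  have [pi0|/pF] := eqVneq (p i) 0; last exact.
  by apply: (subsetP vF); rewrite inE mnmE pi0 eqxx.
have -> : u = (v + (u - v))%MM.
  apply/mnmP => i; rewrite mnmDE mnmBE mnmE.
  by case: ifP => _; rewrite ?subnn ?addn0 // subn0.
have vE : mmap1 (fun i => x i - (p i)%:A) v = mmap1 x v.
  apply: eq_bigr => i _; rewrite mnmE; case: eqP => [->|_]; last by rewrite !expr0.
  by rewrite scale0r subr0.
by rewrite mmap1D vE (src_nonface xP) ?mul0r.
Qed.

(** The variety is invariant under the translations along the intersection of its
    components. *)
Lemma src_translation (p : 'I_m -> k) :
  (forall i F, p i != 0 -> facet C F -> i \in F) ->
  exists pi', sr_coordinates C (fun i => x i - (p i)%:A) pi'.
Proof.
move=> pF.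
have [u uC|f fx] := src_morphism xP (B := A) (b := fun i => x i - (p i)%:A).
  exact: src_translation_nonface.
have [u uC|g gx] := src_morphism xP (B := A) (b := fun i => x i - (- p i)%:A).
  by apply: src_translation_nonface => // i F; rewrite oppr_eq0; exact: pF.
have fK : cancel f g.
  apply: (src_ext xP (f := g \o f) (g := idfun)) => i /=.
  rewrite fx linearB linearZ /= gx rmorph1 /=.
  by rewrite scaleNr opprK addrK.
have gK : cancel g f.
  apply: (src_ext xP (f := f \o g) (g := idfun)) => i /=.
  rewrite gx linearB linearZ /= fx rmorph1 /=.
  by rewrite scaleNr opprK subrK.
exists (fun s => pi s \o g); split=> [a|s i sC|a a0].
- have [u uE] := src_gen xP (g a); exists u.
  rewrite -[a]gK uE lrmorphism_mmap; congr mmap; apply: funext => i; exact: fx.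
- by rewrite /= -fx fK; exact: (src_face xP).
- rewrite -[a]gK [g a](_ : _ = 0) ?raddf0 //; apply: (src_inj xP) => s sC.
  exact: a0.
Qed.

(** The origin is the only point at which all the coordinates vanish. *)
Lemma point_ord1 (f : {lrmorphism A -> k^o}) a :
  (forall i, f (x i) = 0) -> f a = 0 -> ord_ge C pi 1 a.
Proof.
move=> fx fa; have [c a1] := ord_ge1_gen xP a.
suff c0 : c = 0 by move: a1; rewrite c0 scale0r subr0.
have [p pd pE] := ord_ge_rep xP a1.
have := congr1 f pE; rewrite linearB /= fa linearZ /= rmorph1 lrmorphism_mmap.
rewrite /mmap big_seq big1 => [/eqP|u /pd]; last first.
  rewrite lt0n mdeg_eq0 => u0; apply/eqP; rewrite mulf_eq0 (_ : mmap1 _ u == 0) ?orbT //.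
  rewrite (mmap1_eq0 (R := k)); apply/existsP.
  have [i ui] : exists i, u i != 0%N.
    apply/existsP; rewrite -negb_forall; apply: contra u0 => /forallP ui0.
    by apply/eqP/mnmP => i; rewrite mnm0E; apply/eqP.
  by exists i; rewrite ui /= fx.
by rewrite sub0r oppr_eq0 => /eqP; rewrite /GRing.scale /= mulr1.
Qed.

End Translation.

Section FixedPoint.
Variables (k : closedFieldType) (q : k).
Hypothesis q_neq0 : q != 0.
Hypothesis q_free : forall z : int, q ^ z = 1 -> z = 0.
Variables (A : comAlgType k) (m : nat) (C : simplicial_complex m).
Variables (x : 'I_m -> A) (pi : {set 'I_m} -> {lrmorphism A -> {mpoly k[m]}}).
Hypothesis xP : sr_coordinates C x pi.
Variables (r : nat) (tau : 'rV[int]_r -> {lrmorphism A -> A}).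
Hypothesis tauP : torus_action q tau.
Hypothesis mr : (m <= r)%N.

Local Notation has_weight := (has_weight q tau).
Local Notation component := (component q_neq0 q_free tauP).

Lemma row_free_weights_inj f (w : 'I_f -> 'rV[int]_r) (u v : 'I_f -> nat) :
  row_free (\matrix_i map_mx (intr : int -> rat) (w i)) ->
  \sum_i w i *+ u i = \sum_i w i *+ v i -> u =1 v.
Proof.
move=> wf uv; pose c (s : 'I_f -> nat) : 'rV[rat]_f := \row_i (s i)%:R.
have cE s : c s *m (\matrix_i map_mx (intr : int -> rat) (w i)) =
    map_mx intr (\sum_i w i *+ s i).
  apply/rowP => j; rewrite !mxE summxE rmorph_sum; apply: eq_bigr => i _.
  by rewrite !mxE mulmxnE /= rmorphMn /= mulr_natl.
have := row_free_inj wf (etrans (cE u) (etrans (congr1 _ uv) (esym (cE v)))).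
move=> /rowP cuv i; have := cuv i; rewrite !mxE => /eqP.
by rewrite Num.Theory.eqr_nat => /eqP.
Qed.

(** Together with the weight vectors of facet_weights, a nonconstant invariant
    would give more than #|F| algebraically independent functions on the
    component: a dependence between them splits into its components, each of which
    is a polynomial relation satisfied by the invariant alone. *)
Lemma invariant_const F a : facet C F -> has_weight 0 a -> exists z, pi F a = z%:MP.
Proof.
move=> Ff a0; have [f [h [Ff' hw hF hf]]] := facet_weights q_neq0 q_free xP tauP mr Ff.
pose g (i : 'I_f.+1) := if unlift ord0 i is Some j then (h j).1 else a.
pose w (i : 'I_f.+1) := if unlift ord0 i is Some j then (h j).2 else 0.
have gw i : has_weight (w i) (g i) by rewrite /w /g; case: unlift.
have [||p p0 pg] := @algebraic_dependence k m f.+1 F (fun i => pi F (g i)) => //.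
  by move=> i u uF; apply: (src_coeff0 xP) => //; exact: facet_face Ff.
have [u0 pu0] : exists u0, u0 \in msupp p.
  case E: (msupp p) => [|u s]; last by exists u; rewrite mem_head.
  by move/eqP: E; rewrite msupp_eq0 (negbTE p0).
pose wt (u : 'X_{1..f.+1}) := \sum_i w i *+ u i.
have uw u : has_weight (wt u) (mmap1 g u). by exact: (weight_prod q_neq0).
have wtE u : wt u = wt u0 -> forall j, u (lift ord0 j) = u0 (lift ord0 j).
  rewrite /wt !big_ord_recl /w unlift_none !mul0rn !add0r => e.
  by apply: (row_free_weights_inj hf); move: e; under eq_bigr do rewrite liftK;
    under [RHS]eq_bigr do rewrite liftK.
have pgF : pi F (pev g p) = 0.
  by rewrite lrmorphism_mmap; exact: pg.
have := component_facet q_neq0 q_free xP tauP (wt u0) Ff pgF.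
pose H : A := \prod_j (h j).1 ^+ u0 (lift ord0 j).
(* One component of the relation is H times the value at a of the polynomial Q. *)
pose Q : {poly k} := \sum_(u <- msupp p | wt u == wt u0) p@_u *: 'X^(u ord0).
have -> : component (wt u0) (pev g p) =
    (\sum_(u <- msupp p | wt u == wt u0) p@_u *: a ^+ u ord0) * H.
  rewrite /mmap raddf_sum [in RHS]big_mkcond mulr_suml; apply: eq_bigr => u _ /=.
  rewrite mulr_algl linearZ /=; case: ifPn => [/eqP uu|uu]; last first.
    by rewrite (component_neq _ _ _ (uw u)) // mul0r scaler0.
  rewrite component_id -?uu // -scalerAl; congr (_ *: _).
  rewrite /mmap1 big_ord_recl /g unlift_none; congr (_ * _).
  by apply: eq_bigr => j _; rewrite liftK wtE.
rewrite rmorphM /= => /eqP; rewrite mulf_eq0 orbC => /orP[].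
  rewrite rmorph_prod prodf_seq_eq0 => /hasP[j _ /=]; rewrite rmorphXn.
  by rewrite expf_eq0 (negbTE (hF j)) andbF.
have Q0 : Q != 0.
  apply/eqP => /(congr1 (fun Q : {poly k} => Q`_(u0 ord0))).
  rewrite coef0 coef_sum big_mkcond (bigD1_seq u0) ?msupp_uniq //= eqxx.
  rewrite coefZ coefXn eqxx mulr1 big1 ?addr0 => [/eqP|u uu0].
    by rewrite mcoeff_eq0 pu0.
  case: eqP => // uu; rewrite coefZ coefXn; case: eqP => [e|_]; last by rewrite mulr0.
  case/eqP: uu0; apply/mnmP => i; case: (unliftP ord0 i) => [j|] ->; last by [].
  exact: wtE.
have [s QE] := closed_field_poly_normal Q.
have -> : pi F (\sum_(u <- msupp p | wt u == wt u0) p@_u *: a ^+ u ord0) =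
    (map_poly (@mpolyC m k) Q).[pi F a].
  rewrite raddf_sum /Q raddf_sum horner_sum; apply: eq_bigr => u _ /=.
  rewrite linearZ /= rmorphXn map_polyZ map_polyXn hornerZ hornerXn.
  by rewrite mul_mpolyC.
rewrite QE map_polyZ hornerZ mulf_eq0 mpolyC_eq0 lead_coef_eq0 (negbTE Q0) /=.
rewrite rmorph_prod horner_prod prodf_seq_eq0 => /hasP[z _ /=].
rewrite rmorphB /= map_polyX map_polyC hornerXsubC subr_eq0 => /eqP zE.
by exists z.
Qed.

Section Evaluation.
Variable F : {set 'I_m}.
Hypothesis Ff : facet C F.

(** The value of the invariant part, which is constant on the component of F. As
    the next lemmas show, this is evaluation at a fixed point. *)
Definition fixed_eval a : k := (pi F (component 0 a))@_0.

Lemma fixed_evalE a : pi F (component 0 a) = (fixed_eval a)%:MP.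
Proof.
have [z zE] := invariant_const Ff (component_weight q_neq0 q_free tauP 0 a).
by rewrite /fixed_eval zE mcoeffC eqxx mulr1.
Qed.

Lemma mpoly_unit_const (p p' : {mpoly k[m]}) z : z != 0 -> p * p' = z%:MP ->
  exists c, p' = c%:MP.
Proof.
move=> z0 pp'; have pp'0 : p * p' != 0 by rewrite pp' mpolyC_eq0.
have := pp'0; rewrite mulf_eq0 negb_or => /andP[p0 p'0].
have := msizeM p0 p'0; rewrite pp' msizeC z0 /= => sE.
have : (msize p' <= 1)%N.
  have := sE; rewrite -[msize p]prednK ?lt0n ?msize_poly_eq0 // addSn /= => sE'.
  by rewrite sE' leq_addl.
by move/msize1_polyC => ->; exists p'@_0.
Qed.

(** The product is an invariant, hence a constant; were it nonzero, b would be
    invertible on an affine space, that is, constant, and of weight 0. *)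
Lemma fixed_eval_opposite v a b : v != 0 -> has_weight (- v) a -> has_weight v b ->
  pi F (a * b) = 0.
Proof.
move=> v0 va vb; have ab0 : has_weight 0 (a * b).
  by rewrite -(addNr v); exact: weightM.
have [z zE] := invariant_const Ff ab0; rewrite zE; apply/eqP.
rewrite mpolyC_eq0; apply: contraT => z0; case/eqP: (z0).
have := zE; rewrite rmorphM /= => /(mpoly_unit_const z0)[c cE].
have : pi F (b - c%:A) = 0.
  by rewrite linearB linearZ /= rmorph1 cE alg_mpolyC subrr.
move/(component_facet q_neq0 q_free xP tauP v Ff).
rewrite linearB linearZ /= (component_id _ _ _ vb).
have one0 : has_weight 0 1 by exact: weight1.
rewrite (component_neq _ _ _ one0) 1?eq_sym // scaler0 subr0 => b0.
move: zE; rewrite rmorphM /= b0 mulr0 => /esym/eqP.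
by rewrite mpolyC_eq0 => /eqP.
Qed.

Lemma fixed_evalM a b : fixed_eval (a * b) = fixed_eval a * fixed_eval b.
Proof.
apply/eqP; rewrite -(mpolyC_eq m); apply/eqP; rewrite mpolyCM -!fixed_evalE.
have bE := component_sum q_neq0 q_free tauP b.
rewrite [in LHS]bE mulr_sumr !raddf_sum /=.
have prE v : pi F (component 0 (a * component v b)) =
    if v == 0 then pi F (component 0 a) * pi F (component 0 b) else 0.
  rewrite (componentM _ _ _ _ _ (component_weight q_neq0 q_free tauP v b)) sub0r.
  case: eqVneq => [->|v0]; first by rewrite oppr0 rmorphM.
  by apply: (fixed_eval_opposite v0); exact: component_weight.
under eq_bigr do rewrite prE.
have [b0|b0] := boolP (0 \in weights_of q_neq0 q_free tauP b).
  rewrite (bigD1_seq 0) ?weights_uniq //= eqxx big1 ?addr0 // => v /negbTE->//.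
rewrite (component_out b0) linear0 mulr0 big1_seq // => v /= vb.
by case: eqP vb b0 => // -> ->.
Qed.

(** The fixed point lies on every component, since the ideal of a component is
    homogeneous and its invariants are constants that vanish at the origin. *)
Lemma fixed_point : exists f : {lrmorphism A -> k^o},
  (forall c a, f (tau c a) = f a) /\
  (forall i G, f (x i) != 0 -> facet C G -> i \in G).
Proof.
have evl : linear (fixed_eval : A -> k^o).
  by move=> c a b; rewrite /fixed_eval linearP /= linearP /= mcoeffD mcoeffZ.
have evm : monoid_morphism (fixed_eval : A -> k^o).
  split=> [|a b]; last exact: fixed_evalM.
  rewrite /fixed_eval component_id; last exact: weight1.
  by rewrite rmorph1 mcoeff1 eqxx.
have [f fE] := lrmorphism_of_fun evl evm; exists f; split=> [c a|i G].
  by rewrite !fE /fixed_eval component_tau dot0r expr0z scale1r.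
rewrite fE => + Gf; apply: contraR => iG.
have xG : pi G (x i) = 0 by apply/eqP; rewrite (facet_var0 xP).
have /(facet_ord1 xP Gf) := component_facet q_neq0 q_free xP tauP 0 Gf xG.
by move=> x0; apply/eqP/x0; rewrite ?mdeg0 //; exact: facet_face Ff.
Qed.

End Evaluation.

(** A torus of rank at least m fixes a point, which can be moved to the origin by a
    translation as it lies on all the components. *)
Lemma fixed_coordinates : exists (z : 'I_m -> A) pi', sr_coordinates C z pi' /\
  forall c i, ord_ge C pi' 1 (tau c (z i)).
Proof.
have [F Ff _] := face_in_facet (faces0 C).
have [f [ft fx]] := fixed_point Ff.
have [pi' zP] := src_translation xP fx.
exists (fun i => x i - (f (x i))%:A), pi'; split=> // c i.
have fz j : f (x j - (f (x j))%:A) = 0.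
  rewrite linearB linearZ /= rmorph1.
  by rewrite [X in _ - X](mulr1 (f (x j))) subrr.
by apply: (point_ord1 zP fz); rewrite ft.
Qed.

End FixedPoint.

(** * Homogeneous coordinates *)

(** Some term of the Leibniz expansion is nonzero. Such a permutation serves to match
    two bases. *)
Lemma det_neq0_perm (R : idomainType) n (M : 'M[R]_n) : \det M != 0 ->
  exists s : 'S_n, forall i, M i (s i) != 0.
Proof.
move=> M0; apply: contrapT => nM; case/eqP: M0; rewrite /determinant big1 // => s _.
have [i /eqP iM] : exists i, M i (s i) == 0.
  apply: contrapT => ni; apply: nM; exists s => i; apply/negP => iM.
  by apply: ni; exists i.
by rewrite (bigD1 i) //= iM mul0r mulr0.
Qed.

Lemma pev_trans (k : fieldType) (A : comAlgType k) f m (y : 'I_m -> A) (l : 'I_f -> A)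
    (s : {mpoly k[f]}) :
  (forall i, exists p, l i = pev y p) -> exists p, pev l s = pev y p.
Proof.
move=> /choice[P lP]; exists (pev P s).
rewrite [X in _ = mmap _ _ X]/mmap raddf_sum [LHS]/mmap; apply: eq_bigr => u _ /=.
rewrite !mulr_algl mmapZ mulr_algl; congr (_ *: _).
rewrite rmorph_mmap1; congr mmap1; exact: funext.
Qed.

Section Diagonal.
Variables (k : closedFieldType) (q : k).
Hypothesis q_neq0 : q != 0.
Hypothesis q_free : forall z : int, q ^ z = 1 -> z = 0.
Variables (A : comAlgType k) (m : nat) (C : simplicial_complex m).
Variables (x : 'I_m -> A) (pi : {set 'I_m} -> {lrmorphism A -> {mpoly k[m]}}).
Hypothesis xP : sr_coordinates C x pi.
Variables (r : nat) (tau : 'rV[int]_r -> {lrmorphism A -> A}).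
Hypothesis tauP : torus_action q tau.
Hypothesis tau1 : forall c i, ord_ge C pi 1 (tau c (x i)).

Local Notation has_weight := (has_weight q tau).
Local Notation component := (component q_neq0 q_free tauP).
Local Notation ord_ge := (ord_ge C pi).
Local Notation lin := (lin pi).

Lemma component_ord j w a : ord_ge j a -> ord_ge j (component w a).
Proof.
move=> ja; apply: (@component_stable _ _ q_neq0 q_free _ _ _ tauP (ord_ge j) 1) => //.
  by move=> c b b'; exact: ord_ge_lin.
by move=> c b jb; rewrite scale1r; exact: (ord_ge_endo xP).
Qed.

(** Since the torus preserves the maximal ideal of the origin, its cotangent space
    is spanned by classes of weight vectors. *)
Lemma diagonal_basis : exists (y : 'I_m -> A) (chi : 'I_m -> 'rV[int]_r),
  [/\ forall i, has_weight (chi i) (y i), forall i, ord_ge 1 (y i)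
    & row_free (\matrix_i lin (y i))].
Proof.
have [f [g [gQ gf gmax]]] := @max_free k m (A * 'rV[int]_r)
  (fun aw => has_weight aw.2 aw.1 /\ ord_ge 1 aw.1) (fun aw => lin aw.1).
have fm : f = m.
  apply/eqP; rewrite eqn_leq -{1}(eqP gf) rank_leq_col /=.
  rewrite -[X in (X <= _)%N](mxrank1 k m) -{1}(eqP gf); apply: mxrankS.
  apply/row_subP => i; rewrite row1 -(lin_var xP) [x i](component_sum q_neq0 q_free tauP).
  rewrite linear_sum; apply: summx_sub => w _.
  apply: (gmax (component w (x i), w)); split; first exact: component_weight.
  by apply: component_ord; exact: (ord_ge_var xP).
subst f; exists (fun i => (g i).1), (fun i => (g i).2).
by split=> // i; [exact: (gQ i).1 | exact: (gQ i).2].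
Qed.

Section Basis.
Variables (y : 'I_m -> A) (chi : 'I_m -> 'rV[int]_r).
Hypothesis ychi : forall i, has_weight (chi i) (y i).
Hypothesis y1 : forall i, ord_ge 1 (y i).
Hypothesis yfree : row_free (\matrix_i lin (y i)).

Lemma basis_lin a : ord_ge 1 a -> exists c : 'I_m -> k, ord_ge 2 (a - \sum_i c i *: y i).
Proof.
move=> a1; have : (lin a <= \matrix_i lin (y i))%MS.
  exact: submx_full yfree.
case/submxP => D aD; exists (D 0); apply: (ord_ge2P xP).
  by apply: ord_geB => //; apply: ord_ge_sum => i _; exact: ord_geZ.
rewrite linearB /= aD linear_sum /=.
apply/eqP; rewrite subr_eq0; apply/eqP/rowP => j; rewrite !mxE summxE.
by apply: eq_bigr => i _; rewrite linearZ !mxE.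
Qed.

(** A cocharacter that kills the weights of the cotangent space acts
    unipotently. *)
Lemma chi_rank : (r <= \rank (\matrix_i map_mx (intr : int -> rat) (chi i)))%N.
Proof.
rewrite leqNgt; apply/negP => /int_orthogonal[c c0 cchi].
suff c0' : c = 0 by rewrite c0' eqxx in c0.
apply: (tau_unipotent q_neq0 q_free xP tauP) => w a _.
have [z a1] := ord_ge1_gen xP a; have [e d2] := basis_lin a1.
pose b := z%:A + \sum_i e i *: y i.
have tb : tau c b = b.
  rewrite raddfD /= linearZ /= rmorph1 raddf_sum; congr (_ + _).
  by apply: eq_bigr => i _; rewrite /= linearZ /= ychi cchi expr0z scale1r.
have -> : tau c a - a = tau c (a - b) - (a - b).
  by rewrite raddfB /= tb opprB addrA subrK.
rewrite opprD addrA.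
by apply: ord_geB => //; exact: (ord_ge_endo xP).
Qed.

(** The y i generate the algebra up to any order, because their linear parts form
    a basis. *)
Lemma basis_generates j a : exists p, ord_ge j (a - pev y p).
Proof.
elim: j => [|j [p /(ord_ge_rep xP)[s sj sE]]]; first by exists 0; exact: ord_ge_triv.
have /choice[c cP] i := basis_lin (ord_ge_var xP i).
pose l i := \sum_t c i t *: y t.
have l1 i : ord_ge 1 (l i) by apply: ord_ge_sum => t _; exact: ord_geZ.
have [|p' p'E] := @pev_trans _ A m m y l s.
  move=> i; exists (\sum_t c i t *: 'X_t); rewrite raddf_sum.
  by apply: eq_bigr => t _; rewrite /= mmapZ mmapX mmap1U mulr_algl.
exists (p + p'); rewrite mmapD opprD addrA sE -p'E.
by apply: ord_ge_perturb => //; exact: (ord_ge_var xP).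
Qed.

Hypothesis chifree : row_free (\matrix_i map_mx (intr : int -> rat) (chi i)).

Definition mnm_weight (u : 'X_{1..m}) := \sum_i chi i *+ u i.

Lemma mnm_weight_inj : injective mnm_weight.
Proof. by move=> u v uv; apply/mnmP; exact: (row_free_weights_inj chifree uv). Qed.

Lemma weight_monomial u : has_weight (mnm_weight u) (mmap1 y u).
Proof. exact: (weight_prod q_neq0). Qed.

(** Up to any order j, an element of weight w is a multiple of the only monomial of
    that weight; the coefficient is determined as soon as this monomial is not of
    order j. *)
Lemma weight_space w a : has_weight w a -> a != 0 ->
  exists u c, mnm_weight u = w /\ a = c *: mmap1 y u.
Proof.
move=> wa a0.
have pry p : component w (pev y p) =
    \sum_(u <- msupp p | mnm_weight u == w) p@_u *: mmap1 y u.
  rewrite /mmap raddf_sum [RHS]big_mkcond; apply: eq_bigr => u _ /=.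
  rewrite mulr_algl linearZ /=; case: eqP => [<-|/eqP uw].
    by rewrite component_id //; exact: weight_monomial.
  by rewrite (component_neq _ _ _ (weight_monomial u)) // scaler0.
have [[u uw]|nu] := pselect (exists u, mnm_weight u = w); last first.
  case/eqP: a0; apply: (ord_ge_inf xP) => j.
  have [p /(component_ord w)] := basis_generates j a.
  rewrite raddfB /= component_id // pry big1 ?subr0 // => u /eqP uw.
  by case: nu; exists u.
have /choice[c cP] j : exists c, ord_ge j (a - c *: mmap1 y u).
  have [p /(component_ord w)] := basis_generates j a.
  rewrite raddfB /= component_id // pry; exists p@_u.
  suff <- : \sum_(v <- msupp p | mnm_weight v == w) p@_v *: mmap1 y v =
    p@_u *: mmap1 y u by [].
  have [up|up] := boolP (u \in msupp p).
    rewrite big_mkcond (bigD1_seq u) ?msupp_uniq //= uw eqxx big1 ?addr0 // => v.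
    by move=> /eqP vu; case: eqP => // vw; case: vu; apply: mnm_weight_inj; rewrite vw.
  rewrite big_seq_cond big1 => [|v /andP[vp /eqP vw]].
    by move: up; rewrite -mcoeff_eq0 => /eqP->; rewrite scale0r.
  by rewrite (mnm_weight_inj (etrans uw (esym vw))) vp in up.
have [j0 j0P] : exists j0, ~ ord_ge j0 (mmap1 y u).
  apply: contrapT => nj; case/eqP: a0; apply: (ord_ge_inf xP) => j.
  rewrite -[a](subrK (c j *: mmap1 y u)); apply: ord_geD => //.
  by apply: ord_geZ; apply: contrapT => nju; apply: nj; exists j.
exists u, (c j0); split=> //; apply/eqP; rewrite -subr_eq0; apply/eqP.
apply: (ord_ge_inf xP) => j; pose J := maxn j j0.
suff <- : c J = c j0 by apply: ord_geW (cP J); exact: leq_maxl.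
apply/eqP; rewrite -subr_eq0; apply: contra_notT j0P => cc.
have := ord_geB (cP j0) (ord_geW (leq_maxr j j0) (cP J)).
rewrite opprB addrC addrA subrK -scalerBl => /(ord_geZ (c J - c j0)^-1).
by rewrite scalerA mulVf ?scale1r.
Qed.

(** Let P be the set of the i such that y i vanishes on the component of F. The
    linear parts of the functions vanishing there are spanned by the y i with i in
    P, and also by the coordinates j outside F. Hence a nonzero term of the
    determinant of the change of basis maps P into the complement of F, and one of
    the inverse matrix shows that they have the same size. The same permutation
    does this for all facets at once. *)
Lemma facet_permutation : exists s : 'S_m,
  forall F i, facet C F -> (pi F (y i) == 0) = (s i \notin F).
Proof.
pose L := \matrix_i lin (y i).
have Lu : L \in unitmx by rewrite -row_free_unit.
have [s sL] : exists s : 'S_m, forall i, L i (s i) != 0.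
  by apply: det_neq0_perm; rewrite -unitfE -unitmxE.
have [t tL] : exists t : 'S_m, forall i, invmx L i (t i) != 0.
  by apply: det_neq0_perm; rewrite -unitfE -unitmxE unitmx_inv.
exists s => F i Ff; pose P := [set i | pi F (y i) == 0].
have sP : s @: P \subset ~: F.
  apply/subsetP => _ /imsetP[j jP ->]; move: jP; rewrite !inE => /eqP Fj.
  by apply/negP => sF; case/eqP: (sL j); rewrite mxE (facet_lin xP Ff Fj).
have tP : (t @: (~: F)) \subset P.
  apply/subsetP => _ /imsetP[j jF ->]; rewrite inE in jF.
  apply: contraR (tL j) => tjP; apply/eqP.
  have [c cP cE] : exists2 c : 'rV[k]_m, (forall l, l \notin P -> c 0 l = 0)
      & delta_mx 0 j = c *m L.
    rewrite -(lin_var xP) [x j](component_sum q_neq0 q_free tauP) linear_sum.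
    have Fx : pi F (x j) = 0 by apply/eqP; rewrite (facet_var0 xP).
    apply: (big_ind (fun v => exists2 c : 'rV[k]_m,
        (forall l, l \notin P -> c 0 l = 0) & v = c *m L)) => [|a b|w _].
    - by exists 0 => [l _|]; rewrite ?mxE ?mul0mx.
    - move=> [c cP ->] [c' c'P ->]; exists (c + c') => [l lP|]; last by rewrite mulmxDl.
      by rewrite mxE cP ?c'P ?addr0.
    have [->|a0] := eqVneq (component w (x j)) 0.
      by exists 0 => [l _|]; rewrite ?mxE ?mul0mx ?linear0.
    have [u [c [uw aE]]] := weight_space (component_weight q_neq0 q_free tauP w (x j)) a0.
    have c0 : c != 0 by apply: contra a0 => /eqP c0; rewrite aE c0 scale0r.
    have Fu : pi F (mmap1 y u) = 0.
      have := component_facet q_neq0 q_free xP tauP w Ff Fx; rewrite aE linearZ /=.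
      by move/eqP; rewrite scaler_eq0 (negbTE c0) => /eqP.
    have [u2|] := leqP 2 (mdeg u).
      exists 0 => [l _|]; rewrite ?mxE // mul0mx aE.
      apply: (@ord_ge2_lin _ _ _ C); apply: ord_geZ; apply: ord_geW u2 _.
      exact: ord_ge_mmap1.
    rewrite ltnS leq_eqVlt ltnS leqn0 mdeg_eq0 => /orP[/mdeg1P[l /eqP ul]|/eqP u0].
      exists (c *: delta_mx 0 l) => [l' l'P|].
        rewrite !mxE eqxx /=; case: eqP l'P => [->|_ _]; rewrite ?mulr0 //.
        by rewrite inE -(mmap1U y l) -ul Fu eqxx.
      by rewrite -scalemxAl -rowE rowK aE ul mmap1U linearZ.
    by move/eqP: Fu; rewrite u0 mmap11 rmorph1 oner_eq0.
  have : row j (invmx L) = c by rewrite rowE cE mulmxK.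
  by move/rowP/(_ (t j)); rewrite mxE cP.
have card_eq : #|P| = #|~: F|.
  apply/eqP; rewrite eqn_leq -{1}(card_imset P (@perm_inj _ s)).
  rewrite -{2}(card_imset (~: F) (@perm_inj _ t)).
  by rewrite !subset_leq_card.
have sPF : s @: P = ~: F.
  by apply/eqP; rewrite eqEcard sP (card_imset P (@perm_inj _ s)) card_eq leqnn.
have := congr1 (fun S : {set 'I_m} => s i \in S) sPF.
by rewrite mem_imset ?inE //; exact: perm_inj.
Qed.

End Basis.

Lemma toric_coordinates_at_origin : (m <= r)%N ->
  exists (y : 'I_m -> A) (chi : 'I_m -> 'rV[int]_r),
  [/\ (r <= m)%N, forall i, has_weight (chi i) (y i),
      row_free (\matrix_i map_mx (intr : int -> rat) (chi i)),
      forall u, (mmap1 y u != 0) = (mnm_supp u \in C)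
    & forall w a, has_weight w a -> a != 0 ->
        exists u c, mnm_weight chi u = w /\ a = c *: mmap1 y u].
Proof.
move=> mr; have [y [chi [ychi y1 yfree]]] := diagonal_basis.
have rk := chi_rank ychi y1 yfree.
have chifree : row_free (\matrix_i map_mx (intr : int -> rat) (chi i)).
  by rewrite -row_leq_rank; exact: leq_trans rk.
have [s sP] := facet_permutation ychi y1 yfree chifree.
pose t := (s^-1)%g; pose tm (u : 'X_{1..m}) := [multinom u (s i) | i < m].
have tmE u : mmap1 (y \o t) u = mmap1 y (tm u).
  rewrite /mmap1 (reindex_inj (@perm_inj _ s)); apply: eq_bigr => i _ /=.
  by rewrite permK mnmE.
have tmK (u : 'X_{1..m}) : tm [multinom u (t i) | i < m] = u.
  by apply/mnmP => i; rewrite !mnmE permK.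
exists (y \o t), (chi \o t); split=> [|i||u|w a wa a0].
- exact: leq_trans rk (rank_leq_row _).
- exact: ychi.
- have -> : \matrix_i map_mx (intr : int -> rat) ((chi \o t) i) =
      row_perm t (\matrix_i map_mx intr (chi i)).
    by apply/matrixP => i j; rewrite !mxE.
  by rewrite -row_leq_rank row_permE eqmxMfull ?row_leq_rank // row_full_unit unitmx_perm.
- have yF F : facet C F -> (pi F (mmap1 (y \o t) u) != 0) = (mnm_supp u \subset F).
    move=> Ff; rewrite rmorph_mmap1 mmap1_eq0 negb_exists.
    apply/forallP/subsetP => [uF i|uF i].
      rewrite inE => ui; have := uF i.
      by rewrite ui /= (sP _ _ Ff) negbK permKV.
    rewrite /= negb_and negbK (sP _ _ Ff) negbK permKV.
    by have [//|ui] := eqVneq (u i) 0%N; rewrite uF ?inE.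
  apply/idP/idP => [u0|uC].
    apply: contraR u0 => uC; apply/eqP/(facet_inj xP) => F Ff.
    apply/eqP; apply: contraR uC; rewrite yF //.
    exact/faces_sub/facet_face.
  have [F Ff uF] := face_in_facet uC.
  by apply: contraTneq uF => u0; rewrite -yF // u0 linear0 eqxx.
have [u [c [uw ->]]] := weight_space ychi y1 yfree chifree wa a0.
exists [multinom u (t i) | i < m], c; split; last by rewrite tmE tmK.
rewrite -uw /mnm_weight (reindex_inj (@perm_inj _ s)); apply: eq_bigr => i _ /=.
by rewrite permK mnmE permK.
Qed.

End Diagonal.

Section Toric.
Variables (k : closedFieldType) (q : k).
Hypothesis q_neq0 : q != 0.
Hypothesis q_free : forall z : int, q ^ z = 1 -> z = 0.
Variables (A : comAlgType k) (m : nat) (C : simplicial_complex m).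
Variables (x : 'I_m -> A) (pi : {set 'I_m} -> {lrmorphism A -> {mpoly k[m]}}).
Hypothesis xP : sr_coordinates C x pi.
Variables (r : nat) (tau : 'rV[int]_r -> {lrmorphism A -> A}).
Hypothesis tauP : torus_action q tau.

(** Any faithful action of a torus of rank at least m on k[C] is the standard one,
    in suitable coordinates. *)
Lemma toric_coordinates : (m <= r)%N ->
  exists (y : 'I_m -> A) (chi : 'I_m -> 'rV[int]_r),
  [/\ (r <= m)%N, forall i, has_weight q tau (chi i) (y i),
      row_free (\matrix_i map_mx (intr : int -> rat) (chi i)),
      forall u, (mmap1 y u != 0) = (mnm_supp u \in C)
    & forall w a, has_weight q tau w a -> a != 0 ->
        exists u c, mnm_weight chi u = w /\ a = c *: mmap1 y u].
Proof.
move=> mr; have [z [pi' [zP z1]]] := fixed_coordinates q_neq0 q_free xP tauP mr.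
exact: (toric_coordinates_at_origin q_neq0 q_free zP tauP z1 mr).
Qed.
End Toric.

(** * Weights of homogeneous locally nilpotent derivations *)

(** The weights of the derivations y^b d/dy_j that preserve the ideal of
    nonfaces. *)
Definition is_root m r (C : simplicial_complex m) (chi : 'I_m -> 'rV[int]_r)
    (e : 'rV[int]_r) :=
  exists (b : 'X_{1..m}) (j : 'I_m), [/\ b j = 0%N, e = mnm_weight chi b - chi j,
    mnm_supp b \in C
    & forall s : {set 'I_m}, s \in C -> mnm_supp b \subset s -> j |: s \in C].

(** A nonzero locally nilpotent derivation of weight e, as obtained from a
    one-parameter unipotent subgroup normalized by the torus. *)
Record root_derivation (k : fieldType) (A : comAlgType k) r (q : k)
    (tau : 'rV[int]_r -> {lrmorphism A -> A}) (e : 'rV[int]_r) (D : {linear A -> A}) :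
    Prop := RootDerivation {
  rd_leibniz : forall a b, D (a * b) = D a * b + a * D b;
  rd_weight : forall w a, has_weight q tau w a -> has_weight q tau (w + e) (D a);
  rd_nilpotent : forall a, exists l, iter l D a = 0;
  rd_neq0 : exists a, D a != 0 }.

Section Derivations.
Variables (k : closedFieldType) (q : k).
Hypothesis char0 : [pchar k] =i pred0.
Hypothesis q_neq0 : q != 0.
Hypothesis q_free : forall z : int, q ^ z = 1 -> z = 0.
Variables (A : comAlgType k) (m : nat) (C : simplicial_complex m).
Variables (r : nat) (tau : 'rV[int]_r -> {lrmorphism A -> A}).
Hypothesis tauP : torus_action q tau.
Variables (y : 'I_m -> A) (chi : 'I_m -> 'rV[int]_r).
Hypothesis ychi : forall i, has_weight q tau (chi i) (y i).
Hypothesis chifree : row_free (\matrix_i map_mx (intr : int -> rat) (chi i)).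
Hypothesis yC : forall u, (mmap1 y u != 0) = (mnm_supp u \in C).
Hypothesis yspan : forall w a, has_weight q tau w a -> a != 0 ->
  exists u c, mnm_weight chi u = w /\ a = c *: mmap1 y u.
Variables (e : 'rV[int]_r) (D : {linear A -> A}).
Hypothesis DP : root_derivation q tau e D.

Lemma der1 : D 1 = 0.
Proof.
have := rd_leibniz DP 1 1; rewrite !mulr1 mul1r => /eqP.
by rewrite -subr_eq0 opprD addrA subrr sub0r oppr_eq0 => /eqP.
Qed.

Lemma der_mmap1 (z : 'I_m -> A) (E : A) (c : 'I_m -> k) (u : 'X_{1..m}) :
  (forall i, u i != 0%N -> D (z i) = c i *: (E * z i)) ->
  D (mmap1 z u) = (\sum_i (u i)%:R * c i) *: (E * mmap1 z u).
Proof.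
move=> Dz; rewrite /mmap1; elim: (index_enum _) => [|i s IHs].
  by rewrite !big_nil der1 scale0r.
have Dzn : D (z i ^+ u i) = ((u i)%:R * c i) *: (E * z i ^+ u i).
  have [->|ui] := eqVneq (u i) 0%N; first by rewrite expr0 der1 mul0r scale0r.
  elim: (u i) => [|l IHl]; first by rewrite expr0 der1 mul0r scale0r.
  rewrite exprS (rd_leibniz DP) IHl (Dz _ ui) -scalerAl -scalerAr [z i * (E * _)]mulrCA.
  by rewrite -mulrA -scalerDl -natr1 mulrDl mul1r addrC.
rewrite !big_cons (rd_leibniz DP) IHs Dzn -scalerAl -scalerAr.
by rewrite [_ * (E * \prod_(j <- s) _)]mulrCA -mulrA -scalerDl.
Qed.

Lemma der_basis_neq0 : exists j, D (y j) != 0.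
Proof.
apply: contrapT => nD; have [a /eqP[]] := rd_neq0 DP.
have Dy j : D (y j) = 0.
  by apply/eqP; apply: contrapT => /negP Dj; apply: nD; exists j.
rewrite (component_sum q_neq0 q_free tauP a) raddf_sum big1 // => w _ /=.
have wa := component_weight q_neq0 q_free tauP w a.
have [->|a0] := eqVneq (component q_neq0 q_free tauP w a) 0; first by rewrite raddf0.
have [u [c [_ ->]]] := yspan wa a0.
rewrite linearZ /= (@der_mmap1 _ 0 (fun=> 0)) ?mul0r ?scaler0 // => i _.
by rewrite mul0r scaler0.
Qed.

Lemma mnm_weightD u v : mnm_weight chi (u + v) = mnm_weight chi u + mnm_weight chi v.
Proof. by rewrite -big_split; apply: eq_bigr => i _; rewrite mnmDE mulrnDr. Qed.

Lemma mnm_weight1 j : mnm_weight chi U_(j) = chi j.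
Proof.
rewrite /mnm_weight (bigD1 j) //= mnm1E eqxx mulr1n big1 ?addr0 // => i.
by rewrite mnm1E eq_sym => /negbTE->.
Qed.

Let wt_inj := mnm_weight_inj chifree.

(** On the monomial of exponents u, the power l of such a derivation multiplies by
    y^(l b) and by the product of the lam u + t lam b for t < l. If y^b is not
    nilpotent, taking u = b forces lam b = 0, and then taking for u a single
    variable y i forces c i = 0. *)
Lemma log_derivation_not_nilpotent (b : 'X_{1..m}) (c : 'I_m -> k) :
  (forall i, D (y i) = c i *: (mmap1 y b * y i)) -> forall i, D (y i) = 0.
Proof.
move=> Dy; pose lam (u : 'X_{1..m}) := \sum_i (u i)%:R * c i.
have Du u : D (mmap1 y u) = lam u *: mmap1 y (b + u).
  by rewrite mmap1D; apply: der_mmap1 => i _.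
have lamD u v : lam (u + v)%MM = lam u + lam v.
  rewrite /lam -big_split; apply: eq_bigr => i _.
  by rewrite mnmDE natrD mulrDl.
have Dl l u : exists2 z : k, (z = 0 -> exists t, lam u + t%:R * lam b = 0) &
    iter l D (mmap1 y u) = z *: mmap1 y (b *+ l + u).
  elim: l => [|l [z z0 zE]].
    exists 1; last by rewrite mulm0n add0m scale1r.
    by move/eqP; rewrite oner_eq0.
  exists (z * lam (b *+ l + u)%MM).
    move/eqP; rewrite mulf_eq0 => /orP[/eqP/z0//|/eqP bl0]; exists l.
    rewrite -{}[RHS]bl0 lamD addrC; congr (_ + _); elim: l {z z0 zE} => [|l IHl].
      by rewrite mul0r mulm0n /lam big1 // => i _; rewrite mnm0E mul0r.
    by rewrite mulmSr lamD -IHl -natr1 mulrDl mul1r.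
  by rewrite iterS zE linearZ /= Du scalerA addmA -mulmS.
have lam0 u : (forall l, mmap1 y (b *+ l + u)%MM != 0) ->
    exists t, lam u + t%:R * lam b = 0.
  move=> u0; have [l lu] := rd_nilpotent DP (mmap1 y u).
  have [z z0 zE] := Dl l u; apply: z0; apply/eqP; move: lu => /eqP.
  by rewrite zE scaler_eq0 (negbTE (u0 l)) orbF.
have supp u l : mnm_supp (b + u) \in C -> mnm_supp (b *+ l + u) \in C.
  move=> buC; apply: faces_sub buC _; apply/subsetP => i; rewrite !inE.
  rewrite !mnmDE mulmnE !addn_eq0 !negb_and muln_eq0 negb_or.
  by move=> /orP[/andP[-> _]//|->]; rewrite orbT.
move=> i; apply/eqP; apply: contraT => Di.
have bi : mnm_supp (b + U_(i)) \in C.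
  by rewrite -yC mmap1D mmap1U; apply: contra Di => /eqP byi; rewrite Dy byi scaler0.
have bb : mnm_supp (b + b) \in C.
  apply: faces_sub bi _; apply/subsetP => j; rewrite !inE !mnmDE !addn_eq0.
  by rewrite andbb => /negbTE->.
have lamb : lam b = 0.
  have [|t] := lam0 b; first by move=> l; rewrite yC supp.
  rewrite -[X in X + _]mul1r -mulrDl => /eqP; rewrite mulf_eq0 => /orP[|/eqP//].
  rewrite addrC natr1 => t0; have /pcharf0P/(_ t.+1) := char0.
  by rewrite t0.
have [|t] := lam0 U_(i)%MM; first by move=> l; rewrite yC supp.
rewrite lamb mulr0 addr0 /lam (bigD1 i) //= mnm1E eqxx mul1r big1 ?addr0 => [ci|j].
  by case/eqP: Di; rewrite Dy ci scale0r.
by rewrite mnm1E eq_sym => /negbTE->; rewrite mul0r.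
Qed.

(** D maps each y i to a multiple of a monomial. Either each of these monomials is
    divisible by its y i, which contradicts nilpotence, or some D (y j) is a multiple
    of a monomial y^b without y j. Comparing weights, D then kills the other
    variables, and applying D to the relation y_j y^s = 0, for a face s containing the
    support of b, shows that j can be added to s. *)
Lemma derivation_root : is_root C chi e.
Proof.
have ex j : exists bc : 'X_{1..m} * k,
    D (y j) = bc.2 *: mmap1 y bc.1 /\
    (D (y j) != 0 -> mnm_weight chi bc.1 = chi j + e).
  have [->|Dj] := eqVneq (D (y j)) 0; first by exists (0%MM, 0); rewrite scale0r.
  have [b [c [bE DE]]] := yspan (rd_weight DP (ychi j)) Dj.
  by exists (b, c).
have {ex}[bc bcP] := choice ex.
have [[j [Dj bj]]|nj] := pselect (exists j, D (y j) != 0 /\ (bc j).1 j = 0%N); last first.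
  have [j0 Dj0] := der_basis_neq0.
  pose b := ((bc j0).1 - U_(j0))%MM.
  have bE j : D (y j) != 0 -> (bc j).1 = (b + U_(j))%MM.
    move=> Dj; apply: wt_inj; rewrite mnm_weightD mnm_weight1 (bcP j).2 // addrC.
    congr (_ + _); apply: (addIr (chi j0)); rewrite -[in RHS]mnm_weight1 -mnm_weightD.
    rewrite submK ?(bcP j0).2 1?addrC //.
    apply/mnm_lepP => i; rewrite mnm1E; case: eqP => // <-; rewrite lt0n.
    by apply/eqP => b0; apply: nj; exists j0.
  (* By injectivity of the weight, all the monomials of the D (y j) are y^b y_j. *)
  case/eqP: Dj0; apply: (@log_derivation_not_nilpotent b
    (fun j => if D (y j) == 0 then 0 else (bc j).2)) => j.
  case: eqP => [->|/eqP Dj]; first by rewrite scale0r.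
  by rewrite {1}(bcP j).1 (bE _ Dj) mmap1D mmap1U.
set b := (bc j).1 in bj; have [DE wE] := bcP j; have {}wE := wE Dj.
have b0 : mmap1 y b != 0.
  by apply: contra Dj => /eqP b0; rewrite DE -/b b0 scaler0.
have c0 : (bc j).2 != 0 by apply: contra Dj => /eqP c0; rewrite DE c0 scale0r.
have Di i : i != j -> D (y i) = 0.
  move=> ij; apply/eqP; apply: contraT => Di; have wEi := (bcP i).2 Di.
  have : ((bc i).1 + U_(j))%MM = (b + U_(i))%MM.
    by apply: wt_inj; rewrite !mnm_weightD !mnm_weight1 wE wEi addrAC;
      rewrite [in RHS]addrAC [chi i + _]addrC.
  move/mnmP/(_ j); rewrite !mnmDE !mnm1E eqxx bj (negbTE ij) => /eqP.
  by rewrite addn_eq0 andbF.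
exists b, j; split=> //; first by rewrite wE addrC addKr.
  by rewrite -yC.
move=> s sC bs; have [js|js] := boolP (j \in s).
  by rewrite (setUidPr _) // sub1set.
apply: contraT => jsC; pose u := [multinom (i \in s) : nat | i < m].
have us : mnm_supp u = s by apply/setP => i; rewrite inE mnmE eqb0 negbK.
have yju : y j * mmap1 y u = 0.
  rewrite -(mmap1U y j) -mmap1D; apply/eqP; rewrite -[_ == _]negbK yC.
  apply: contra jsC => /faces_sub; apply; apply/subsetP => i.
  by rewrite !inE mnmDE mnm1E mnmE addn_eq0 negb_and !eqb0 !negbK eq_sym.
have Du : D (mmap1 y u) = 0.
  rewrite (@der_mmap1 y 0 (fun=> 0)) ?mul0r ?scaler0 // => i.
  rewrite mnmE eqb0 negbK => iS; rewrite Di ?mul0r ?scaler0 //.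
  by apply: contraNneq js => <-.
have := rd_leibniz DP (y j) (mmap1 y u); rewrite yju Du linear0 mulr0 addr0 DE.
rewrite -scalerAl -mmap1D => /esym/eqP; rewrite scaler_eq0 (negbTE c0) /=.
rewrite -[_ == _]negbK yC => /negP[]; apply: faces_sub sC _.
apply/subsetP => i; rewrite inE mnmDE addn_eq0 negb_and => /orP[bi|].
  by apply: (subsetP bs); rewrite inE.
by rewrite mnmE eqb0 negbK.
Qed.

End Derivations.

(** * Recovering the complex from the weights *)

Definition unit_row m (i : 'I_m) : 'rV[int]_m := delta_mx 0 i.

Section Roots.
Variables (m : nat) (C0 C : simplicial_complex m) (v : 'I_m).
Variable chi : 'I_m -> 'rV[int]_m.
Hypothesis chifree : row_free (\matrix_i map_mx (intr : int -> rat) (chi i)).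
Hypothesis roots : forall d : 'X_{1..m}, d v = 0%N -> mnm_supp d \in C0 ->
  is_root C chi (mnm_weight (@unit_row m) d - unit_row v).

Let W : 'M[int]_m := \matrix_i chi i.
Let co (u : 'X_{1..m}) : 'rV[int]_m := \row_i (u i)%:Z.

Let W_inj (z z' : 'rV[int]_m) : z *m W = z' *m W -> z = z'.
Proof.
move=> zz'.
have WE : map_mx (intr : int -> rat) W = \matrix_i map_mx intr (chi i).
  by apply/matrixP => i j; rewrite !mxE.
have : map_mx (intr : int -> rat) z = map_mx intr z'.
  by apply: (row_free_inj chifree); rewrite -WE -!map_mxM zz'.
by move/rowP => e; apply/rowP => i; have := e i; rewrite !mxE => /intr_inj.
Qed.

Let coD u w : co (u + w)%MM = co u + co w.
Proof. by apply/rowP => i; rewrite !mxE mnmDE PoszD. Qed.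

Let mnm_weightE u : mnm_weight chi u = co u *m W.
Proof.
rewrite mulmx_sum_row /mnm_weight; apply: eq_bigr => i _.
by rewrite !mxE rowK -scaler_nat natz.
Qed.

Let mnm_weight_unit u : mnm_weight (@unit_row m) u = co u.
Proof.
rewrite [RHS]row_sum_delta /mnm_weight; apply: eq_bigr => i _.
by rewrite !mxE -scaler_nat natz.
Qed.

Let chiE j : chi j = unit_row j *m W.
Proof. by rewrite -rowE rowK. Qed.

(** The weights d - e_v of the source are read in the basis chi of the target. For
    d = 0 one gets b - e_j, and letting the multiples of d grow shows that passing
    from d = 0 to d adds a vector dl d with nonnegative coordinates, zero at j. So the
    matrix of the dl of the basis vectors, completed by e_j - b, is invertible and has
    only zeros in column j outside row v; a nonzero term of its determinant is a
    permutation that maps v to j and each face to a part of the support of its dl. *)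
Lemma roots_permutation : exists (s : 'S_m) (B : {set 'I_m}),
  (forall S : {set 'I_m}, S \in C0 -> v \notin S -> (s @: S) :|: B \in C) /\
  (forall S : {set 'I_m}, S \in C -> B \subset S -> s v |: S \in C).
Proof.
have /choice[bj bjP] (d : 'X_{1..m}) : exists bj : 'X_{1..m} * 'I_m,
    d v = 0%N -> mnm_supp d \in C0 ->
    [/\ bj.1 bj.2 = 0%N, co d - unit_row v = (co bj.1 - unit_row bj.2) *m W,
      mnm_supp bj.1 \in C & forall s : {set 'I_m}, s \in C ->
        mnm_supp bj.1 \subset s -> bj.2 |: s \in C].
  have [[dv dC]|nd] := pselect (d v = 0%N /\ mnm_supp d \in C0); last first.
    by exists (0%MM, v) => dv dC; case: nd.
  have [b [j [bj dE bC jC]]] := roots dv dC; exists (b, j) => _ _; split=> //=.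
  by rewrite mulmxBl -mnm_weightE -chiE -dE mnm_weight_unit.
have supp0 : mnm_supp 0%MM = set0 :> {set 'I_m}.
  by apply/setP => i; rewrite !inE mnm0E.
have [b0 E0 bC jC] : _ := bjP 0%MM (mnm0E v) (etrans (congr1 _ supp0) (faces0 C0)).
set b := (bj 0%MM).1 in b0 E0 bC jC; set j := (bj 0%MM).2 in b0 E0 jC.
pose dl d := co (bj d).1 - unit_row (bj d).2 - (co b - unit_row j).
have dlW (d : 'X_{1..m}) : d v = 0%N -> mnm_supp d \in C0 -> dl d *m W = co d.
  move=> dv dC; have [_ dE _ _] := bjP d dv dC; rewrite mulmxBl -dE -E0.
  have -> : co 0%MM = 0 by apply/rowP => i; rewrite !mxE mnm0E.
  by rewrite sub0r opprK subrK.
have suppM (d : 'X_{1..m}) l : mnm_supp d \in C0 -> mnm_supp (d *+ l) \in C0.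
  move/faces_sub; apply; apply/subsetP => i; rewrite !inE mulmnE.
  by apply: contraNneq => ->.
have dlM (d : 'X_{1..m}) l : d v = 0%N -> mnm_supp d \in C0 -> dl (d *+ l)%MM = l%:Z *: dl d.
  move=> dv dC; apply: W_inj; rewrite -scalemxAl !dlW ?suppM ?mulmnE ?dv //.
  by apply/rowP => i; rewrite !mxE mulmnE PoszM mulrC.
have dl_ge0 (d : 'X_{1..m}) i : d v = 0%N -> mnm_supp d \in C0 -> 0 <= dl d 0 i.
  move=> dv dC; rewrite leNgt; apply/negP => dl0.
  (* With the multiple b i + 2 of d, coordinate i would be less than -1. *)
  have bound : (b i).+2%:Z * dl d 0 i <= - (b i).+2%:Z by nia.
  have := congr1 (fun z : 'rV_m => z 0 i) (dlM d (b i).+2 dv dC).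
  rewrite [RHS]mxE => e; move: bound; rewrite -e /dl !mxE eqxx /=.
  by case: (i == j); case: (i == (bj (d *+ _)%MM).2); lia.
(* Adding dl d >= 0 to b - e_j must leave a coordinate -1, which can only be j. *)
have dl_j (d : 'X_{1..m}) : d v = 0%N -> mnm_supp d \in C0 -> (bj d).2 = j /\ forall i,
    ((bj d).1 i)%:Z = (b i)%:Z + dl d 0 i.
  move=> dv dC; have [bd _ _ _] := bjP d dv dC.
  have jj : (bj d).2 = j.
    apply/eqP; apply: contraT => jd.
    have := dl_ge0 d (bj d).2 dv dC; rewrite /dl !mxE !eqxx (negbTE jd) bd /=; lia.
  split=> // i; rewrite /dl !mxE jj; lia.
(* The coordinates of the standard basis in the basis chi. *)
pose M : 'M[int]_m := \matrix_i (if i == v then unit_row j - co b else dl U_(i)%MM).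
have U1 i : i != v -> U_(i)%MM v = 0%N by rewrite mnm1E => /negbTE->.
have U2 i : mnm_supp U_(i)%MM \in C0 by rewrite mnm_supp1 faces1.
have MW : M *m W = 1%:M.
  apply/row_matrixP => i; rewrite row_mul rowK row1.
  case: eqP => [->|/eqP iv].
    have := E0; have -> : co 0%MM = 0 by apply/rowP => l; rewrite !mxE mnm0E.
    by rewrite sub0r -[X in X *m W]opprB mulNmx => /oppr_inj <-.
  rewrite dlW ?U1 ?U2 //; apply/rowP => l; rewrite !mxE mnm1E eqxx /=.
  by rewrite eq_sym; case: (l == i).
have [s sM] : exists s : 'S_m, forall i, M i (s i) != 0.
  apply: det_neq0_perm; apply/eqP => M0; have := congr1 determinant MW.
  by rewrite det_mulmx M0 mul0r det1 => /eqP; rewrite eq_sym oner_eq0.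
have Mij i l : i != v -> M i l = dl U_(i)%MM 0 l by move=> iv; rewrite mxE (negbTE iv).
have sv : s v = j.
  rewrite -(permKV s j); congr (s _); apply/esym/eqP; apply: contraT => iv.
  have := sM ((s^-1)%g j); rewrite permKV Mij // => /eqP[].
  have [bd _ _ _] := bjP _ (U1 _ iv) (U2 ((s^-1)%g j)).
  have [jj /(_ j)] := dl_j _ (U1 _ iv) (U2 ((s^-1)%g j)).
  rewrite jj in bd; rewrite bd b0; lia.
exists s, (mnm_supp b); split=> [S SC vS|S SC bS]; last by rewrite sv; exact: jC.
pose ind (T : {set 'I_m}) := [multinom (i \in T) : nat | i < m].
have suppI (T : {set 'I_m}) : mnm_supp (ind T) = T by apply/setP => i; rewrite inE mnmE eqb0 negbK.
have indv (T : {set 'I_m}) : v \notin T -> ind T v = 0%N.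
  by move=> vT; rewrite mnmE (negbTE vT).
have [_ _ SbC _] : _ := bjP (ind S) (indv _ vS) (etrans (congr1 _ (suppI S)) SC).
apply: faces_sub SbC _; have [|_ bS] := dl_j _ (indv _ vS); first by rewrite suppI.
have dlS i := dl_ge0 _ i (indv _ vS) (etrans (congr1 _ (suppI S)) SC).
rewrite subUset; apply/andP; split; last first.
  apply/subsetP => i; rewrite !inE => bi; have := bS i; have := dlS i.
  by move: bi; rewrite -!lt0n; lia.
apply/subsetP => _ /imsetP[i iS ->]; rewrite inE -lt0n.
have iv : i != v by apply: contraNneq vS => <-.
have SiC : S :\ i \in C0 by apply: faces_sub SC _; exact: subsetDl.
have vSi : v \notin S :\ i by rewrite !inE (negbTE vS) andbF.
have dlE : dl (ind S) = dl (ind (S :\ i)) + dl U_(i)%MM.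
  apply: W_inj; rewrite [RHS]mulmxDl (dlW _ (indv _ vS)) ?suppI // (dlW _ (indv _ vSi)) ?suppI //.
  rewrite (dlW _ (U1 _ iv)) // -coD; congr co.
  apply/mnmP => l; rewrite mnmDE !mnmE !inE eq_sym.
  by case: eqP => [<-|_]; rewrite ?iS ?addn0.
have := bS (s i); rewrite dlE mxE.
have := dl_ge0 _ (s i) (indv _ vSi) (etrans (congr1 _ (suppI _)) SiC).
have := dl_ge0 _ (s i) (U1 _ iv) (U2 i); have := sM i; rewrite Mij //.
by move: (dl (ind _) 0 _) (dl U_(i)%MM 0 _) => z z'; lia.
Qed.

End Roots.

Definition apex m (C : simplicial_complex m) v := forall s, s \in C -> v |: s \in C.

Section Apexes.
Variables (m : nat) (C C' : simplicial_complex m) (v : 'I_m).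
Hypothesis vC : apex C v.
Variables (s : 'S_m) (B : {set 'I_m}).
Hypothesis sB : forall S : {set 'I_m}, S \in C -> v \notin S -> (s @: S) :|: B \in C'.
Hypothesis sv : forall S : {set 'I_m}, S \in C' -> B \subset S -> s v |: S \in C'.

Let half := [set S : {set 'I_m} | (S \in C) && (v \notin S)].
Let star := [set S : {set 'I_m} | (S :|: B \in C') && (s v \notin S)].
Let image := (fun S : {set 'I_m} => s @: S) @: half.
Let suspend (j : 'I_m) (Q : {set {set 'I_m}}) := Q :|: ((fun S => j |: S) @: Q).

Let card_suspend j (Q : {set {set 'I_m}}) :
  (forall S, S \in Q -> j \notin S) -> #|suspend j Q| = (#|Q| + #|Q|)%N.
Proof.
move=> jQ; rewrite cardsU (_ : Q :&: _ = set0) ?cards0 ?subn0.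
  rewrite card_in_imset // => S T SQ TQ /= ST.
  by rewrite -(setU1K (jQ _ SQ)) ST setU1K // jQ.
apply/setP => S; rewrite !inE; apply/negP => /andP[SQ /imsetP[T _ ST]].
by move: (jQ _ SQ); rewrite ST setU11.
Qed.

Let image_star : image \subset star.
Proof.
apply/subsetP => _ /imsetP[S + ->]; rewrite !inE => /andP[SC vS].
by rewrite sB // mem_imset //; exact: perm_inj.
Qed.

Let star_sub : suspend (s v) star \subset faces C'.
Proof.
apply/subsetP => S /setUP[|/imsetP[T + ->]]; rewrite inE => /andP[SC _].
  by apply: faces_sub SC _; exact: subsetUl.
apply: (faces_sub (sv SC _)); first exact: subsetUr.
by rewrite setUA subsetUl.
Qed.

Let half_suspend : #|faces C| = (#|half| + #|half|)%N.
Proof.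
rewrite -(card_suspend (j := v)) => [|S]; last by rewrite inE => /andP[].
apply: eq_card => S; apply/idP/idP => [SC|/setUP[|/imsetP[T + ->]]]; last first.
- by rewrite inE => /andP[/vC].
- by rewrite inE => /andP[].
apply/setUP; have [vS|vS] := boolP (v \in S); last by left; rewrite inE SC.
right; apply/imsetP; exists (S :\ v); last by rewrite setD1K.
by rewrite !inE eqxx andbT; apply: faces_sub SC _; exact: subsetDl.
Qed.

Let card_image : #|image| = #|half|.
Proof. by rewrite card_imset //; apply: imset_inj; exact: perm_inj. Qed.

(** The faces of C avoiding v embed into the faces of C' avoiding s v that can be
    joined to B; the latter can be doubled inside C' by adding s v. *)
Lemma card_star_le : (#|faces C| <= #|faces C'|)%N.
Proof.
apply: leq_trans (subset_leq_card star_sub).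
rewrite half_suspend card_suspend => [|S]; last by rewrite inE => /andP[].
by rewrite -card_image; apply: leq_add; exact: subset_leq_card.
Qed.

(** Equality in card_star_le makes both inclusions equalities. *)
Lemma star_isomorphism : (#|faces C'| <= #|faces C|)%N ->
  apex C' (s v) /\ forall S : {set 'I_m}, (S \in C) = (s @: S \in C').
Proof.
move=> CC'.
have cstar : #|suspend (s v) star| = (#|star| + #|star|)%N.
  by apply: card_suspend => S; rewrite inE => /andP[].
have le1 := subset_leq_card image_star; have le2 := subset_leq_card star_sub.
rewrite cstar in le2; rewrite card_image in le1; rewrite half_suspend in CC'.
have im_eq : image = star.
  by apply/eqP; rewrite eqEcard image_star card_image; lia.
have st_eq : suspend (s v) star = faces C'.
  by apply/eqP; rewrite eqEcard star_sub cstar; lia.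
have ap : apex C' (s v).
  move=> S; rewrite -st_eq => /setUP[SQ|/imsetP[T TQ ->]].
    by apply/setUP; right; apply/imsetP; exists S.
  by rewrite setUA setUid; apply/setUP; right; apply/imsetP; exists T.
have half_eq (S : {set 'I_m}) : v \notin S -> (S \in C) = (s @: S \in C').
  move=> vS; have svS : s v \notin s @: S by rewrite mem_imset //; exact: perm_inj.
  apply/idP/idP => [SC|].
    have : s @: S \in star by rewrite -im_eq; apply/imsetP; exists S; rewrite ?inE ?SC.
    by rewrite inE => /andP[SB _]; apply: faces_sub SB _; exact: subsetUl.
  move=> sSC; have : s @: S \in suspend (s v) star by rewrite st_eq.
  case/setUP=> [|/imsetP[T _ ST]]; last first.
    by move: svS; rewrite ST setU11.
  rewrite -im_eq => /imsetP[T + ST].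
  by rewrite (imset_inj (@perm_inj _ s) ST) inE => /andP[].
split=> // S; have [vS|/half_eq//] := boolP (v \in S).
have vS' : v \notin S :\ v by rewrite !inE eqxx.
have sS : s @: S = s v |: s @: (S :\ v) by rewrite -imsetU1 setD1K.
transitivity (S :\ v \in C).
  apply/idP/idP => [/faces_sub|/vC]; first by apply; exact: subsetDl.
  by rewrite setD1K.
rewrite half_eq // sS; apply/idP/idP => [/ap//|/faces_sub]; apply; exact: subsetUr.
Qed.

End Apexes.

Section Cone.
Variables (n : nat) (D : simplicial_complex n).

Definition cone_faces := [set s : {set 'I_n.+1} | lift ord_max @^-1: s \in faces D].

Lemma cone_sub (s t : {set 'I_n.+1}) : s \in cone_faces -> t \subset s -> t \in cone_faces.
Proof. by rewrite !inE => sD ts; apply: faces_sub sD _; exact: preimsetS. Qed.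

Lemma cone1 i : [set i] \in cone_faces.
Proof.
rewrite inE; case: (unliftP ord_max i) => [j|] ->.
  apply: (faces_sub (faces1 D j)); apply/subsetP => l; rewrite !inE.
  by move/eqP/lift_inj->.
apply: (faces_sub (faces0 D)); apply/subsetP => l; rewrite !inE.
by rewrite eq_sym (negbTE (neq_lift _ _)).
Qed.

Lemma cone0 : set0 \in cone_faces.
Proof. by rewrite inE preimset0 faces0. Qed.

Definition cone := SimplicialComplex cone_sub cone1 cone0.

Lemma cone_apex : apex cone ord_max.
Proof.
move=> s; rewrite !inE.
suff -> : lift ord_max @^-1: (ord_max |: s) = lift ord_max @^-1: s by [].
by apply/setP => i; rewrite !inE eq_sym (negbTE (neq_lift _ _)).
Qed.

Lemma cone_lift (s : {set 'I_n}) : (lift ord_max @: s \in cone) = (s \in D).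
Proof.
rewrite inE; suff -> : lift ord_max @^-1: (lift ord_max @: s) = s by [].
by apply/setP => i; rewrite inE mem_imset //; exact: lift_inj.
Qed.

End Cone.

Lemma apex_tperm m (C : simplicial_complex m) i j (S : {set 'I_m}) :
  apex C i -> apex C j -> (tperm i j @: S \in C) = (S \in C).
Proof.
move=> iC jC; have imp T : T \in C -> tperm i j @: T \in C.
  move=> /iC/jC/faces_sub; apply; apply/subsetP => _ /imsetP[l lT ->].
  by rewrite !inE; case: tpermP; rewrite ?eqxx ?orbT // => _ _; rewrite lT !orbT.
apply/idP/idP => [/imp|]; last exact: imp.
rewrite -imset_comp (eq_imset (g := id)) ?imset_id // => l.
by rewrite /= tpermK.
Qed.

(** The map s may move the apex, but two apexes can be exchanged by an automorphism
    of the complex. *)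
Lemma cone_cancel n (D D' : simplicial_complex n) (s : 'S_n.+1) :
  apex (cone D') (s ord_max) ->
  (forall S : {set 'I_n.+1}, (S \in cone D) = (s @: S \in cone D')) ->
  complex_isomorphic D D'.
Proof.
move=> ap sE; pose t := (s * tperm (s ord_max) ord_max)%g.
have tE (S : {set 'I_n.+1}) : (S \in cone D) = (t @: S \in cone D').
  rewrite sE -(apex_tperm _ ap (@cone_apex _ D')) -imset_comp.
  suff -> : t @: S = (tperm (s ord_max) ord_max \o s) @: S by [].
  by apply: eq_imset => i; rewrite permM.
have tm : t ord_max = ord_max by rewrite permM tpermL.
have /fin_all_exists[f fE] i : exists j, t (lift ord_max i) = lift ord_max j.
  case: (unliftP ord_max (t (lift ord_max i))) => [j ->|]; first by exists j.
  by rewrite -[in RHS]tm => /perm_inj/eqP; rewrite eq_sym (negbTE (neq_lift _ _)).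
have f_inj : injective f.
  by move=> i j ij; apply/(@lift_inj _ ord_max)/(@perm_inj _ t); rewrite !fE ij.
exists f; split; first exact: injF_bij.
move=> S; rewrite -(cone_lift D) -(cone_lift D') tE -!imset_comp.
suff -> : (t \o lift ord_max) @: S = (lift ord_max \o f) @: S by [].
by apply: eq_imset => i; rewrite /= fE.
Qed.

(** * The coordinate ring of a cylinder *)

Section StanleyReisnerRing.
Variables (k : fieldType) (n : nat) (D : simplicial_complex n).

Lemma sr_pi_eq0 (p : {mpoly k[n]}) : sr_pi D p = 0 -> sr_ideal D p.
Proof.
rewrite -[0](raddf0 (@sr_pi k n D)) => /eqP.
by rewrite -Quotient.idealrBE subr0.
Qed.

Lemma sr_pi_pev p : sr_pi D p = pev (@sr_gen k n D) p.
Proof.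
elim/mpolyind: p => [|c m p _ _ IHp]; first by rewrite raddf0 mmap0.
rewrite raddfD /= mmapD IHp; congr (_ + _).
rewrite mmapZ mmapX -mul_mpolyC rmorphM /= -sr_pi_alg; congr (_ * _).
by rewrite mpolyXE_id rmorph_prod; apply: eq_bigr => i _; exact: rmorphXn.
Qed.

Lemma sr_gen_nonface (s : {set 'I_n}) :
  s \notin D -> \prod_(i in s) sr_gen k D i = 0.
Proof.
move=> sD; rewrite -(rmorph_prod (@sr_pi k n D)) -[RHS](raddf0 (@sr_pi k n D)).
apply/eqP; rewrite -Quotient.idealrBE subr0; apply/asboolP.
exists (fun t => (t == s)%:R); rewrite (bigD1 s) //= eqxx mul1r [X in _ + X]big1 ?addr0 // => t.
by case/andP => _ /negbTE->; rewrite mul0r.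
Qed.

Lemma sr_morphism (B : comAlgType k) (b : 'I_n -> B) :
  (forall s : {set 'I_n}, s \notin D -> \prod_(i in s) b i = 0) ->
  exists f : {lrmorphism sr_ring k D -> B}, forall i, f (sr_gen k D i) = b i.
Proof.
move=> b0; have [|f fx] := @fg_morphism k (sr_alg k D) B b; last by exists f.
move=> p /=; rewrite -sr_pi_pev => /sr_pi_eq0/asboolP[c ->].
rewrite raddf_sum big1 // => s sD; rewrite /= rmorphM rmorph_prod /=.
suff -> : \prod_(i in s) pev b 'X_i = 0 by rewrite mulr0.
by rewrite -(b0 s sD); apply: eq_bigr => i _; rewrite mmapX mmap1U.
Qed.

End StanleyReisnerRing.

Lemma poly_ext_morphism (k : fieldType) (B E : comAlgType k) (f : {lrmorphism B -> E})
    (z : E) :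
  exists F : {lrmorphism poly_ext B -> E}, (forall b, F b%:P = f b) /\ F 'X = z.
Proof.
pose F (p : poly_ext B) : E := (map_poly f p).[z].
have FM : monoid_morphism F.
  by split=> [|p p']; rewrite /F ?rmorph1 ?hornerC // rmorphM hornerM.
have Fl : linear F.
  move=> c p p'; rewrite /F rmorphD hornerD; congr (_ + _).
  have -> : c *: p = c%:A%:P * p :> poly_ext B by [].
  by rewrite rmorphM hornerM /= map_polyC hornerC /= linearZ rmorph1 mulr_algl.
have [F' F'E] := lrmorphism_of_fun Fl FM; exists F'.
by split=> [b|]; rewrite F'E /F ?map_polyC ?hornerC // map_polyX hornerX.
Qed.

Lemma poly_ext_const (k : fieldType) (B : comAlgType k) :
  exists c : {lrmorphism B -> poly_ext B}, forall b, c b = b%:P.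
Proof.
have cM : monoid_morphism (polyC : B -> poly_ext B) by split=> // a b; exact: polyCM.
have cl : linear (polyC : B -> poly_ext B).
  move=> z a b; rewrite polyCD; congr (_ + _).
  by rewrite -[z *: a](mulr_algl z a) polyCM.
by have [c cE] := lrmorphism_of_fun cl cM; exists c => b; rewrite cE.
Qed.

Lemma prod_mmap1_nonface (B : comNzRingType) n (x : 'I_n -> B)
    (u : 'X_{1..n}) :
  \prod_(i in mnm_supp u) x i = 0 -> mmap1 x u = 0.
Proof.
move=> x0; rewrite /mmap1 (bigID (mem (mnm_supp u))) /=.
suff -> : \prod_(i in mnm_supp u) x i ^+ u i =
    (\prod_(i in mnm_supp u) x i) * \prod_(i in mnm_supp u) x i ^+ (u i).-1.
  by rewrite x0 !mul0r.
rewrite -big_split; apply: eq_bigr => i; rewrite inE /= => ui.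
by rewrite -exprS prednK // lt0n.
Qed.

Section Cylinder.
Variables (k : closedFieldType) (n : nat) (D : simplicial_complex n).
Let A := poly_alg (sr_alg k D).
Let x : 'I_n.+1 -> A := @fg_gen k A.

Lemma cylinder_gen_max : x ord_max = 'X.
Proof. by rewrite /x /= /poly_gen unlift_none. Qed.

Lemma cylinder_gen_lift i : x (lift ord_max i) = (sr_gen k D i)%:P.
Proof. by rewrite /x /= /poly_gen liftK. Qed.

Lemma cylinder_nonface u : mnm_supp u \notin cone D -> mmap1 x u = 0.
Proof.
rewrite inE => uD; pose v := [multinom u (lift ord_max i) | i < n].
have vD : mnm_supp v \notin D.
  suff -> : mnm_supp v = lift ord_max @^-1: mnm_supp u by [].
  by apply/setP => i; rewrite !inE mnmE.
have v0 : mmap1 (sr_gen k D) v = 0.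
  exact/prod_mmap1_nonface/sr_gen_nonface.
have [c cE] := poly_ext_const (sr_ring k D).
have vE : \prod_(i < n) x (lift ord_max i) ^+ u (lift ord_max i) =
    c (mmap1 (sr_gen k D) v).
  rewrite rmorph_mmap1; apply: eq_bigr => i _ /=.
  by rewrite cylinder_gen_lift cE mnmE.
by rewrite /mmap1 (bigD1_ord ord_max) //= vE v0 linear0 mulr0.
Qed.

(** The coordinate ring of the cylinder over D is the Stanley-Reisner ring of the
    cone over D, the variable of the line being the apex. *)
Lemma cylinder_coordinates : exists pi, @sr_coordinates k A n.+1 (cone D) x pi.
Proof.
have /choice[pi piP] (s : {set 'I_n.+1}) : exists f : {lrmorphism A -> {mpoly k[n.+1]}},
    s \in cone D -> forall i, f (x i) = face_var k s i.
  have [sC|sC] := boolP (s \in cone D); last first.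
    have [t tD|f _] := @sr_morphism k n D {mpoly k[n.+1]} (fun=> 0).
      have [i it] : exists i, i \in t.
        by apply/set0Pn; apply: contraNneq tD => ->; exact: faces0.
      by rewrite (bigD1 i) //= mul0r.
    by have [F _] := poly_ext_morphism f 0; exists F.
  have [t tD|f fx] := @sr_morphism k n D {mpoly k[n.+1]}
      (fun i => face_var k s (lift ord_max i)).
    have [i it iS] : exists2 i, i \in t & lift ord_max i \notin s.
      apply/subsetPn; move: tD; rewrite -cone_lift => tC.
      have /subsetPn[_ /imsetP[i it ->] iS] : ~~ (lift ord_max @: t \subset s).
        by apply: contra tC; exact: faces_sub.
      by apply/subsetPn; exists i.
    by rewrite (bigD1 i) //= /face_var (negbTE iS) mul0r.
  have [F [Ff Fz]] := poly_ext_morphism f (face_var k s ord_max).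
  exists F => _ i; case: (unliftP ord_max i) => [j|] ->.
    by rewrite cylinder_gen_lift Ff fx.
  by rewrite cylinder_gen_max Fz.
exists pi; split=> [|s i sC|a a0]; [exact: fg_genP | exact: piP|].
have [p pE] := fg_genP a; rewrite pE /mmap big1_seq // => u _ /=.
have [uC|/cylinder_nonface->] := boolP (mnm_supp u \in cone D); last by rewrite mulr0.
have := congr1 (mcoeff u) (a0 _ uC); rewrite pE lrmorphism_mmap mcoeff0.
have -> : pi (mnm_supp u) \o fg_gen (f:=A) = face_var k (mnm_supp u).
  by apply: funext => i; exact: piP.
by rewrite mcoeff_face subxx => ->; rewrite /= scale0r mul0r.
Qed.

End Cylinder.

(** * Derivations of additive group actions *)

Section AdditiveAction.
Variables (k : closedFieldType) (q : k).
Hypothesis q_neq0 : q != 0.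
Hypothesis char0 : [pchar k] =i pred0.
Variables (A : fg_algebra k) (r : nat) (tau : 'rV[int]_r -> {lrmorphism A -> A}).
Variable theta : k -> {lrmorphism A -> A}.
Hypothesis theta_id : forall a, theta 0 a = a.
Hypothesis thetaD : forall z w a, theta (z + w) a = theta z (theta w a).
Hypothesis theta_poly : forall a, exists p : {poly A}, forall z, theta z a = p.[z%:A].
Hypothesis theta_nontrivial : exists z a, theta z a != a.
Variable e : 'rV[int]_r.
Hypothesis theta_weight : forall c z a,
  tau c (theta z a) = theta (q ^ dot c e * z) (tau c a).

Lemma natr_inj : injective (fun n : nat => n%:R : k).
Proof.
have n0 n : n%:R = 0 :> k -> n = 0%N.
  by move=> /eqP; have /pcharf0P-> := char0 => /eqP.
move=> i j /= ij; wlog le_ij : i j ij / (i <= j)%N.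
  by move=> H; case/orP: (leq_total i j) => [/(H _ _ ij)|/(H _ _ (esym ij))].
apply/eqP; rewrite eqn_leq le_ij /= -subn_eq0; apply/eqP/n0.
by rewrite natrB // ij subrr.
Qed.

Lemma poly_eq0_scalars (p : {poly A}) : (forall z : k, p.[z%:A] = 0) -> p = 0.
Proof.
move=> p0; apply/polyP => i; rewrite coef0; apply: functional0 => l.
pose lp : {poly k} := \poly_(j < size p) l p`_j.
have lp0 : lp = 0.
  apply/eqP; apply: contraT => lpn0.
  pose s := [seq i%:R : k | i <- iota 0 (size lp)].
  have := max_poly_roots (rs := s) lpn0; rewrite size_map size_iota ltnn.
  apply; last by rewrite map_inj_uniq ?iota_uniq //; exact: natr_inj.
  apply/allP => z _; rewrite rootE horner_poly.
  apply/eqP; transitivity (l p.[z%:A]); last by rewrite p0 linear0.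
  rewrite horner_coef raddf_sum; apply: eq_bigr => j _ /=.
  by rewrite -[_%:A ^+ _](rmorphXn (in_alg A)) /= mulr_algr linearZ mulrC.
have := congr1 (fun r : {poly k} => r`_i) lp0; rewrite coef0 coef_poly.
by case: ltnP => // ip _; rewrite nth_default ?linear0.
Qed.

Lemma poly_ext_scalars (p p' : {poly A}) : (forall z : k, p.[z%:A] = p'.[z%:A]) -> p = p'.
Proof.
move=> pp'; apply/eqP; rewrite -subr_eq0; apply/eqP/poly_eq0_scalars => z.
by rewrite hornerD hornerN pp' subrr.
Qed.

Definition orbit_poly a : {poly A} := sval (cid (theta_poly a)).

Lemma orbit_polyE a z : theta z a = (orbit_poly a).[z%:A].
Proof. by rewrite /orbit_poly; case: cid. Qed.

Lemma orbit_poly_linear c a b :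
  orbit_poly (c *: a + b) = c%:A *: orbit_poly a + orbit_poly b.
Proof.
apply: poly_ext_scalars => z.
by rewrite -orbit_polyE hornerD hornerZ -!orbit_polyE linearP mulr_algl.
Qed.

Lemma orbit_polyM a b : orbit_poly (a * b) = orbit_poly a * orbit_poly b.
Proof.
by apply: poly_ext_scalars => z; rewrite hornerM -!orbit_polyE rmorphM.
Qed.

Lemma orbit_poly0 a : (orbit_poly a)`_0 = a.
Proof. by rewrite -horner_coef0 -[RHS]theta_id orbit_polyE scale0r. Qed.

Lemma coef1_deriv (p : {poly A}) : p`_1 = p^`().[0].
Proof. by rewrite horner_coef0 coef_deriv mulr1n. Qed.

(** The derivative of the action at 0. *)
Definition generator a := (orbit_poly a)`_1.

Lemma generator_linear : linear generator.
Proof.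
by move=> c a b; rewrite /generator orbit_poly_linear coefD coefZ mulr_algl.
Qed.
HB.instance Definition _ := GRing.isLinear.Build k A A _ generator generator_linear.

Lemma generatorM a b : generator (a * b) = generator a * b + a * generator b.
Proof.
rewrite /generator orbit_polyM coefM !big_ord_recl big_ord0 addr0 /= !orbit_poly0.
by rewrite addrC.
Qed.

Definition coef_apply (f : {linear A -> A}) (p : {poly A}) : {poly A} :=
  \poly_(i < size p) f p`_i.

Lemma coef_coef_apply (f : {linear A -> A}) p i : (coef_apply f p)`_i = f p`_i.
Proof. by rewrite coef_poly; case: ltnP => // ip; rewrite nth_default ?linear0. Qed.

Lemma horner_coef_apply (f : {linear A -> A}) p (z : k) : f p.[z%:A] = (coef_apply f p).[z%:A].
Proof.
rewrite horner_poly horner_coef raddf_sum; apply: eq_bigr => i _ /=.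
by rewrite -[_%:A ^+ _](rmorphXn (in_alg A)) /= !mulr_algr linearZ.
Qed.

(** Differentiate the additivity of the action. *)
Lemma generator_coef a j :
  generator (orbit_poly a)`_j = (orbit_poly a)`_j.+1 *+ j.+1.
Proof.
suff E : coef_apply generator (orbit_poly a) = (orbit_poly a)^`() :> {poly A}.
  by rewrite -coef_deriv -E coef_coef_apply.
apply: poly_ext_scalars => w; rewrite -horner_coef_apply -orbit_polyE /= /generator.
have -> : orbit_poly (theta w a) = orbit_poly a \Po ('X + w%:A%:P).
  apply: poly_ext_scalars => z; rewrite -orbit_polyE -thetaD orbit_polyE.
  by rewrite horner_comp hornerD hornerX hornerC scalerDl.
rewrite coef1_deriv deriv_comp hornerM horner_comp !(hornerD, hornerX, hornerC, derivD).
by rewrite derivX derivC !hornerC addr0 mulr1 add0r.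
Qed.

(** Hence the action is the exponential of its generator, which is locally
    nilpotent as orbits are polynomial. *)
Lemma iter_generator l a : iter l generator a = (orbit_poly a)`_l *+ l`!.
Proof.
elim: l => [|l IHl]; first by rewrite orbit_poly0 mulr1n.
by rewrite iterS IHl raddfMn /= generator_coef -mulrnA -factS.
Qed.

Lemma generator_neq0 : exists a, generator a != 0.
Proof.
apply: contrapT => ng; have g0 b : generator b = 0.
  by apply/eqP; apply: contrapT => /negP gb; apply: ng; exists b.
have [z [a /eqP[]]] := theta_nontrivial.
rewrite orbit_polyE; suff -> : orbit_poly a = a%:P by rewrite hornerC.
apply/polyP => -[|l]; rewrite coefC ?orbit_poly0 //=.
have := generator_coef a l; rewrite g0 -scaler_nat => /esym/eqP.
rewrite scaler_eq0 => /orP[|/eqP//].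
by have /pcharf0P-> := char0.
Qed.

Lemma additive_action_derivation : exists D, root_derivation q tau e D.
Proof.
exists (generator : {linear A -> A}); split=> [a b|w a wa c|a|].
- exact: generatorM.
- have := theta_weight c; move=> tE.
  have E : coef_apply (tau c) (orbit_poly a) =
      orbit_poly (tau c a) \Po ((q ^ dot c e)%:A *: 'X).
    apply: poly_ext_scalars => z; rewrite -horner_coef_apply -orbit_polyE /= tE.
    by rewrite orbit_polyE horner_comp hornerZ hornerX mulr_algl scalerA.
  have := congr1 (fun p : {poly A} => p`_1) E; rewrite coef_coef_apply => /= ->.
  rewrite coef1_deriv deriv_comp hornerM horner_comp derivZ derivX !hornerZ hornerX.
  rewrite hornerC mulr1 mulr0 -coef1_deriv -/(generator (tau c a)) wa linearZ /=.
  by rewrite mulr_algr scalerA dotDr expfzDr // mulrC.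
- exists (size (orbit_poly a)).
  by rewrite iter_generator nth_default // mul0rn.
- exact: generator_neq0.
Qed.
End AdditiveAction.

(** * Algebraicity and automorphisms *)

Section Transport.
Variables (k : closedFieldType) (A A' : fg_algebra k).
Variable f : aut A -> aut A'.
Hypothesis f_ind : ind_morphism (aut_ind_variety A) (aut_ind_variety A') f.

(** A morphism of ind-varieties turns a family of automorphisms with polynomial
    coordinates into another one. *)
Lemma transport_poly_map (V : Type) (S : (V -> k) -> Prop) (gam : V -> aut A) d :
  (forall v, aut_piece d (gam v)) ->
  (forall (l : {scalar A}) i, alg_gen S (fun v => l (gam v (fg_gen i))) /\
                              alg_gen S (fun v => l (aut_inv (gam v) (fg_gen i)))) ->
  forall a : A', poly_map S (fun v => f (gam v) a).
Proof.
move=> gd gS a; have [e [fE fM]] := f_ind d.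
have gen i : poly_map S (fun v => f (gam v) (fg_gen i)).
  split=> [|l]; first by exists e => v; exact: (fE _ (gd v) i).1.
  have : regular (piece_var (aut_ind_variety A') e)
      (fun g : {g | aut_piece e g} => l (sval g (fg_gen i))).
    by apply: AlgGen; exists l, i; left.
  move/fM => /(@alg_gen_comp k _ _ _ S (fun v => exist _ (gam v) (gd v))) H.
  apply: H => _ [l' [i' [->|->]]]; [exact: (gS l' i').1|exact: (gS l' i').2].
have [p ->] := fg_genP a.
under eq_fun do rewrite lrmorphism_mmap.
exact: poly_map_mmap.
Qed.

End Transport.

Section Expansions.
Variables (k : closedFieldType) (q : k).
Hypothesis q_neq0 : q != 0.
Variables (A : fg_algebra k).

(** Coordinates, and their inverses, of the points q ^ c of the torus. *)
Definition char_gen r (u : 'rV[int]_r -> k) :=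
  exists i, u = (fun c => q ^ c 0 i) \/ u = (fun c => q ^ (- c 0 i)).

Lemma char_gen_laurent r u : alg_gen (@char_gen r) u ->
  exists s : seq ('rV[int]_r * k), forall c, u c = \sum_(p <- s) q ^ dot c p.1 * p.2.
Proof.
elim=> {u}[_ [i [->|->]]|a|u u' _ [s sE] _ [s' s'E]|u u' _ [s sE] _ [s' s'E]].
- exists [:: (delta_mx 0 i, 1)] => c; rewrite big_seq1 mulr1 /=; congr (_ ^ _).
  rewrite /dot mxE (bigD1 i) //= !mxE !eqxx mulr1 big1 ?addr0 // => j ji.
  by rewrite !mxE (negbTE ji) andbF mulr0.
- exists [:: (- delta_mx 0 i, 1)] => c; rewrite big_seq1 mulr1 /=; congr (_ ^ _).
  rewrite /dot mxE (bigD1 i) //= !mxE !eqxx mulrN1 big1 ?addr0 // => j ji.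
  by rewrite !mxE (negbTE ji) andbF oppr0 mulr0.
- by exists [:: (0, a)] => c; rewrite big_seq1 dot0r mul1r.
- by exists (s ++ s') => c; rewrite big_cat sE s'E.
exists [seq (p.1 + p'.1, p.2 * p'.2) | p <- s, p' <- s'] => c.
rewrite big_allpairs_dep /= sE s'E mulr_suml; apply: eq_bigr => p _.
rewrite mulr_sumr; apply: eq_bigr => p' _ /=.
by rewrite dotDr expfzDr // mulrACA.
Qed.

Lemma poly_map_laurent r (F : 'rV[int]_r -> A) : poly_map (@char_gen r) F ->
  exists (W : seq 'rV[int]_r) g, uniq W /\
    forall c, F c = \sum_(w <- W) q ^ (dot c w) *: g w.
Proof.
move=> [[d Fd] Fl]; have [N [l [e [_ el]]]] := deg_le_frame A d.
have /choice[s sE] j := char_gen_laurent (Fl (l j)).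
pose t := flatten [seq [seq (p.1, p.2 *: e j) | p <- s j] | j <- index_enum 'I_N].
have tE c : F c = \sum_(p <- t) q ^ dot c p.1 *: p.2.
  rewrite [LHS](el _ (Fd c)) /t big_flatten big_map; apply: eq_bigr => j _.
  rewrite big_map sE scaler_suml; apply: eq_bigr => p _.
  by rewrite /= scalerA.
exists (undup [seq p.1 | p <- t]), (fun w => \sum_(p <- t | p.1 == w) p.2).
split=> [|c]; first exact: undup_uniq.
under eq_bigr do rewrite scaler_sumr big_mkcond.
rewrite exchange_big tE big_seq [RHS]big_seq; apply: eq_bigr => p pt /=.
rewrite (bigD1_seq p.1) ?undup_uniq ?mem_undup ?map_f //= eqxx.
by rewrite big1 ?addr0 // => w; rewrite eq_sym => /negbTE->.
Qed.

Lemma poly_map_poly (F : k -> A) : poly_map (fun u => u = id) F ->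
  exists p : {poly A}, forall z, F z = p.[z%:A].
Proof.
move=> [[d Fd] Fl]; have [N [l [e [_ el]]]] := deg_le_frame A d.
have poly u : alg_gen (fun u => u = id) u -> exists s : {poly k}, forall z, u z = s.[z].
  elim=> {u}[_ ->|a|u u' _ [s sE] _ [s' s'E]|u u' _ [s sE] _ [s' s'E]].
  - by exists 'X => z; rewrite hornerX.
  - by exists a%:P => z; rewrite hornerC.
  - by exists (s + s') => z; rewrite hornerD sE s'E.
  - by exists (s * s') => z; rewrite hornerM sE s'E.
have /choice[s sE] j := poly _ (Fl (l j)).
exists (\sum_j map_poly (in_alg A) (s j) * (e j)%:P) => z.
rewrite [LHS](el _ (Fd z)) horner_sum; apply: eq_bigr => j _.
rewrite hornerM hornerC -[z%:A]/(in_alg A z) horner_map /= mulr_algl; congr (_ *: _).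
exact: sE.
Qed.

End Expansions.

Section ConeAutomorphisms.
Variables (k : closedFieldType) (A : fg_algebra k).
Local Notation m := (fg_num A).
Local Notation x := (@fg_gen k A).
Variables (C : simplicial_complex m) (v : 'I_m).
Variable pi : {set 'I_m} -> {lrmorphism A -> {mpoly k[m]}}.
Hypothesis xP : sr_coordinates C x pi.
Hypothesis vC : apex C v.

Lemma aut_of_inverse (f g : {lrmorphism A -> A}) :
  (forall i, g (f (x i)) = x i) -> (forall i, f (g (x i)) = x i) ->
  exists h : aut A, aut_fun h = f /\ aut_inv h = g.
Proof.
move=> gf fg.
have fK : cancel f g by apply: (@fg_ext k A A (g \o f) idfun).
have gK : cancel g f by apply: (@fg_ext k A A (f \o g) idfun).
by exists (Aut fK gK).
Qed.

Lemma mmap1_scale (t : 'I_m -> k) u :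
  mmap1 (fun i => t i *: x i) u = mmap1 t u *: mmap1 x u.
Proof.
rewrite /mmap1; elim: (index_enum _) => [|i s IHs].
  by rewrite !big_nil scale1r.
by rewrite !big_cons IHs exprZn -scalerAl -scalerAr scalerA.
Qed.

Lemma scaling_automorphism (t : 'I_m -> k) : (forall i, t i != 0) ->
  exists h : aut A, forall i, h (x i) = t i *: x i /\ aut_inv h (x i) = (t i)^-1 *: x i.
Proof.
move=> t0; have ex t' : exists f : {lrmorphism A -> A}, forall i, f (x i) = t' i *: x i.
  apply: (src_morphism xP) => u uC.
  by rewrite mmap1_scale (src_nonface xP uC) scaler0.
have [f fE] := ex t; have [g gE] := ex (fun i => (t i)^-1).
have [||h [hf hg]] := @aut_of_inverse f g.
- by move=> i; rewrite fE linearZ /= gE scalerA divff ?scale1r.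
- by move=> i; rewrite gE linearZ /= fE scalerA mulVf ?scale1r.
by exists h => i; rewrite hf hg fE gE.
Qed.

(** Adding a monomial to the variable of the apex preserves the ideal of nonfaces,
    as the apex lies in no minimal nonface. *)
Definition shear (d : 'X_{1..m}) (z : k) (i : 'I_m) : A :=
  if i == v then x i + z *: mmap1 x d else x i.

Lemma shear_nonface d z u : mnm_supp u \notin C -> mmap1 (shear d z) u = 0.
Proof.
move=> uC; pose w := [multinom if i == v then 0%N else u i | i < m].
have wC : mnm_supp w \notin C.
  apply: contra uC => /vC/faces_sub; apply; apply/subsetP => i.
  by rewrite in_setU1 !inE mnmE; case: (i == v).
have -> : u = (w + (u - w))%MM.
  apply/mnmP => i; rewrite mnmDE mnmBE mnmE.
  by case: ifP => _; rewrite ?subn0 // subnn addn0.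
rewrite mmap1D; suff -> : mmap1 (shear d z) w = mmap1 x w.
  by rewrite (src_nonface xP wC) mul0r.
by apply: eq_bigr => i _; rewrite mnmE /shear; case: eqP.
Qed.

Lemma shear_mmap1 (f : {lrmorphism A -> A}) d z (u : 'X_{1..m}) :
  (forall i, f (x i) = shear d z i) -> u v = 0%N -> f (mmap1 x u) = mmap1 x u.
Proof.
move=> fE u0; rewrite rmorph_mmap1; apply: eq_bigr => i _ /=.
by rewrite fE /shear; case: eqP => // ->; rewrite u0 !expr0.
Qed.

Lemma shear_automorphism (d : 'X_{1..m}) z : d v = 0%N -> exists h : aut A, forall i,
  h (x i) = shear d z i /\ aut_inv h (x i) = shear d (- z) i.
Proof.
move=> d0; have ex z' : exists f : {lrmorphism A -> A}, forall i, f (x i) = shear d z' i.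
  by apply: (src_morphism xP) => u; exact: shear_nonface.
have [f fE] := ex z; have [g gE] := ex (- z).
have inv (f' g' : {lrmorphism A -> A}) z' : (forall i, f' (x i) = shear d z' i) ->
    (forall i, g' (x i) = shear d (- z') i) -> forall i, g' (f' (x i)) = x i.
  move=> f'E g'E i; rewrite f'E /shear; case: eqP => [->|/eqP im].
    rewrite linearD linearZ /= (shear_mmap1 g'E d0) g'E /shear eqxx.
    by rewrite scaleNr subrK.
  by rewrite g'E /shear (negbTE im).
have [||h [hf hg]] := @aut_of_inverse f g.
- exact: inv fE gE.
- by apply: (inv _ _ (- z)); rewrite ?opprK.
by exists h => i; rewrite hf hg fE gE.
Qed.

Lemma src_mmap1_neq0 u : mnm_supp u \in C -> mmap1 x u != 0.
Proof.
move=> uC.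
suff : pi (mnm_supp u) (mmap1 x u) != 0 by apply: contra => /eqP->; rewrite linear0.
rewrite rmorph_mmap1 mmap1_eq0 negb_exists; apply/forallP => i /=.
rewrite (src_face xP) // /face_var inE; case: (u i != 0%N) => //=.
exact: mpolyXi_neq0.
Qed.

Lemma deg_le_mmap1 (u : 'X_{1..m}) c i e : (mdeg u <= e)%N -> (1 <= e)%N ->
  deg_le e (x i + c *: mmap1 x u).
Proof.
move=> ue e1; rewrite addrC; apply: deg_le_lin.
  by exists 'X_[u]; rewrite ?msizeX ?mmapX.
by exists 'X_i; rewrite ?msizeX ?mdeg1 // mmapX mmap1U.
Qed.

End ConeAutomorphisms.

(** * The transported torus and its derivations *)

Section Two.
Variable k : fieldType.
Hypothesis char0 : [pchar k] =i pred0.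

Lemma two_neq0 : 2%:R != 0 :> k.
Proof. by have /pcharf0P-> := char0. Qed.

Lemma two_free (z : int) : (2%:R : k) ^ z = 1 -> z = 0.
Proof.
have pos l : (2%:R : k) ^+ l = 1 -> l = 0%N.
  rewrite -natrX => e; have : (2 ^ l - 1)%:R = 0 :> k.
    by rewrite natrB ?expn_gt0 // e subrr.
  move/eqP; have /pcharf0P-> := char0.
  by case: l {e} => // l; rewrite subn_eq0 leqNgt (@leq_exp2l 2 1).
case: z => l; first by move/pos->.
have -> : (2%:R : k) ^ Negz l = (2%:R ^+ l.+1)^-1 by [].
by move/(congr1 GRing.inv); rewrite invrK invr1 => /pos.
Qed.
End Two.

Section TransportedTorus.
Variables (k : closedFieldType) (q : k).
Hypothesis char0 : [pchar k] =i pred0.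
Hypothesis q_neq0 : q != 0.
Hypothesis q_free : forall z : int, q ^ z = 1 -> z = 0.
Variables A A' : fg_algebra k.
Local Notation m := (fg_num A).
Local Notation x := (@fg_gen k A).
Variables (C : simplicial_complex m) (v : 'I_m).
Variable pi : {set 'I_m} -> {lrmorphism A -> {mpoly k[m]}}.
Hypothesis xP : sr_coordinates C x pi.
Hypothesis vC : apex C v.
Variable f : aut A -> aut A'.
Hypothesis f_mul : {morph f : g h / (g * h)%g}.
Hypothesis f_inj : injective f.
Hypothesis f_ind : ind_morphism (aut_ind_variety A) (aut_ind_variety A') f.

Lemma transport_one : f 1%g = 1%g.
Proof. by apply: (mulgI (f 1%g)); rewrite -f_mul !mulg1. Qed.

Lemma transport_faithful g : (forall a, f g a = a) -> g = 1%g.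
Proof.
move=> g1; apply: f_inj; rewrite transport_one.
by apply: aut_ext => i; rewrite g1.
Qed.

Section Torus.
Variable tor : 'rV[int]_m -> aut A.
Hypothesis torP : forall c i, tor c (x i) = q ^ c 0 i *: x i /\
  aut_inv (tor c) (x i) = (q ^ c 0 i)^-1 *: x i.

Lemma torD c d : tor (c + d) = (tor c * tor d)%g.
Proof.
apply: aut_ext => i; rewrite (torP _ i).1 /= (torP d i).1 linearZ /= (torP c i).1.
have -> : (c + d) 0 i = d 0 i + c 0 i by rewrite mxE addrC.
by rewrite scalerA expfzDr.
Qed.

Lemma tor0 : tor 0 = 1%g.
Proof. by apply: aut_ext => i; rewrite (torP _ i).1 mxE expr0z scale1r. Qed.

Lemma dot_unit (c : 'rV[int]_m) i : dot c (unit_row i) = c 0 i.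
Proof. by rewrite /dot trmx_delta -colE mxE. Qed.

Lemma tor_mmap1 c (u : 'X_{1..m}) :
  tor c (mmap1 x u) = q ^ dot c (mnm_weight (@unit_row m) u) *: mmap1 x u.
Proof.
rewrite rmorph_mmap1.
have -> : mmap1 (tor c \o x) u = mmap1 (fun i => q ^ c 0 i *: x i) u.
  by congr mmap1; apply: funext => i; exact: (torP c i).1.
rewrite mmap1_scale; congr (_ *: _).
rewrite /mmap1 /mnm_weight; elim: (index_enum _) => [|i s IHs].
  by rewrite !big_nil dot0r expr0z.
rewrite !big_cons dotDr expfzDr // IHs; congr (_ * _).
elim: (u i) => [|l IHl]; first by rewrite mulr0n dot0r expr0z expr0.
by rewrite mulrS dotDr expfzDr // exprS IHl dot_unit.
Qed.

Lemma tor_piece c : aut_piece 1 (tor c).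
Proof.
have h e i : deg_le 1 (e *: x i).
  rewrite -[_ *: _]addr0; apply: deg_le_lin; last exact: deg_le0.
  by exists 'X_i; rewrite ?msizeX ?mdeg1 // mmapX mmap1U.
by move=> i; rewrite (torP c i).1 (torP c i).2.
Qed.

Definition transported_tor c : {lrmorphism A' -> A'} := f (tor c).

Lemma transported_torus_action : torus_action q transported_tor.
Proof.
split=> [a|c d a|c c1|a].
- by rewrite /transported_tor tor0 transport_one.
- by rewrite /transported_tor torD f_mul.
- have tc := transport_faithful c1.
  apply/rowP => i; rewrite mxE; apply: q_free; have := (torP c i).1; rewrite tc /=.
  move/eqP; rewrite -subr_eq0 -{1}[x i]scale1r -scalerBl scaler_eq0 subr_eq0.
  have : mmap1 x U_(i) != 0 by apply: (src_mmap1_neq0 xP); rewrite mnm_supp1 faces1.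
  by rewrite mmap1U => /negbTE->; rewrite orbF eq_sym => /eqP.
apply: poly_map_laurent => //; apply: (transport_poly_map f_ind tor_piece) => l i.
split.
  have -> : (fun c => l (tor c (x i))) = (fun c => q ^ c 0 i * l (x i)).
    by apply: funext => c; rewrite (torP c i).1 linearZ.
  apply: AlgGenM; last exact: AlgGenC.
  by apply: AlgGen; exists i; left.
have -> : (fun c => l (aut_inv (tor c) (x i))) = (fun c => q ^ (- c 0 i) * l (x i)).
  by apply: funext => c; rewrite (torP c i).2 linearZ -invr_expz.
apply: AlgGenM; last exact: AlgGenC.
by apply: AlgGen; exists i; right.
Qed.

Section Shear.
Variables (d : 'X_{1..m}) (sh : k -> aut A).
Hypothesis d0 : d v = 0%N.
Hypothesis dC : mnm_supp d \in C.
Hypothesis shP : forall z i, sh z (x i) = shear v d z i /\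
  aut_inv (sh z) (x i) = shear v d (- z) i.

Lemma shear_mon z : sh z (mmap1 x d) = mmap1 x d.
Proof. by apply: (@shear_mmap1 _ _ v _ d z) => // i; exact: (shP z i).1. Qed.

Lemma shearD z w : sh (z + w) = (sh z * sh w)%g.
Proof.
apply: aut_ext => i; rewrite (shP _ i).1 /= (shP w i).1 /shear.
case: eqP => [iv|/eqP iv].
  rewrite linearD linearZ /= shear_mon (shP z i).1 /shear iv eqxx.
  by rewrite -addrA -scalerDl.
by rewrite (shP z i).1 /shear (negbTE iv).
Qed.

Lemma shear0 : sh 0 = 1%g.
Proof.
apply: aut_ext => i; rewrite (shP _ i).1 /shear.
by case: ifP => // _; rewrite scale0r addr0.
Qed.

Lemma shear_piece z : aut_piece (mdeg d).+1 (sh z).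
Proof.
have h w i : deg_le (mdeg d).+1 (shear v d w i).
  rewrite /shear; case: ifP => _; first exact: deg_le_mmap1.
  by rewrite -[x i]addr0 -(scale0r (mmap1 x d)); exact: deg_le_mmap1.
by move=> i; rewrite (shP z i).1 (shP z i).2.
Qed.

Local Notation e := (mnm_weight (@unit_row m) d - unit_row v).

(** The torus normalizes the shears along x^d, with weight d - e_v. *)
Lemma tor_shear c z : (tor c * sh z)%g = (sh (q ^ dot c e * z) * tor c)%g.
Proof.
apply: aut_ext => i; rewrite /= (shP z i).1 (torP c i).1 linearZ /= (shP _ i).1 /shear.
case: eqP => [->|/eqP iv]; last by rewrite (torP c i).1.
rewrite linearD linearZ /= tor_mmap1 (torP c v).1 scalerDr !scalerA; congr (_ + _ *: _).
by rewrite mulrA -expfzDr // dotBr dot_unit addrC subrK mulrC.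
Qed.

Lemma shear_derivation : exists dd, root_derivation q transported_tor e dd.
Proof.
apply: (@additive_action_derivation k q q_neq0 char0 A' m transported_tor
  (fun z => aut_fun (f (sh z)))) => [a|z w a|a||c z a].
- by rewrite shear0 transport_one.
- by rewrite shearD f_mul.
- apply: poly_map_poly; apply: (transport_poly_map f_ind shear_piece) => l i.
  have h (g : k -> k) : alg_gen (fun u => u = id) g ->
      alg_gen (fun u => u = id) (fun z => l (shear v d (g z) i)).
    move=> gS; rewrite /shear; case: eqP => _; last exact: AlgGenC.
    have -> : (fun z => l (x i + g z *: mmap1 x d)) =
        (fun z => l (x i) + g z * l (mmap1 x d)).
      by apply: funext => z; rewrite linearD linearZ.
    by apply: AlgGenD; [exact: AlgGenC | apply: AlgGenM => //; exact: AlgGenC].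
  split.
    have -> : (fun z => l (sh z (x i))) = (fun z => l (shear v d (id z) i)).
      by apply: funext => z; rewrite (shP z i).1.
    by apply: h; exact: AlgGen.
  have -> : (fun z => l (aut_inv (sh z) (x i))) = (fun z => l (shear v d (-1 * z) i)).
    by apply: funext => z; rewrite (shP z i).2 mulN1r.
  by apply: h; apply: AlgGenM; [exact: AlgGenC | exact: AlgGen].
- apply: contrapT => nt; have sh1 : sh 1 = 1%g.
    apply: transport_faithful => a; apply/eqP; apply: contrapT => /negP fa.
    by apply: nt; exists 1, a.
  have := (shP 1 v).1; rewrite sh1 /= /shear eqxx scale1r => /eqP.
  rewrite -subr_eq0 opprD addrA subrr sub0r oppr_eq0.
  by apply/negP; exact: (src_mmap1_neq0 xP).
- have := congr1 (fun g : aut A' => g a) (congr1 f (tor_shear c z)).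
  by rewrite !f_mul.
Qed.

End Shear.
End Torus.

Lemma transported_torus : exists tau : 'rV[int]_m -> {lrmorphism A' -> A'},
  torus_action q tau /\
  (forall d : 'X_{1..m}, d v = 0%N -> mnm_supp d \in C -> exists dd,
    root_derivation q tau (mnm_weight (@unit_row m) d - unit_row v) dd).
Proof.
have /choice[tor torP] (c : 'rV[int]_m) : exists h : aut A, forall i,
    h (x i) = q ^ c 0 i *: x i /\ aut_inv h (x i) = (q ^ c 0 i)^-1 *: x i.
  by apply: (scaling_automorphism xP) => i; exact: expfz_neq0.
exists (transported_tor tor); split; first exact: transported_torus_action.
move=> d d0 dC; have /choice[sh shP] z := shear_automorphism xP vC z d0.
exact: (shear_derivation torP d0 dC shP).
Qed.

End TransportedTorus.

(** * The theorem *)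

Section Comparison.
Variable k : closedFieldType.
Hypothesis char0 : [pchar k] =i pred0.

(** The diagonal torus of the source has rank n + 1. *)
Lemma rank_bound n n' (D : simplicial_complex n) (D' : simplicial_complex n')
    (f : aut (poly_alg (sr_alg k D)) -> aut (poly_alg (sr_alg k D'))) :
  {morph f : g h / (g * h)%g} -> injective f ->
  ind_morphism (aut_ind_variety _) (aut_ind_variety _) f ->
  (n' <= n)%N -> (n <= n')%N.
Proof.
move=> f_mul f_inj f_ind n'n; have [pi xP] := cylinder_coordinates k D.
have [pi' x'P] := cylinder_coordinates k D'.
have q0 := two_neq0 char0; have qf := two_free char0.
have [tau [tauP _]] :=
  transported_torus char0 q0 qf xP (@cone_apex _ D) f_mul f_inj f_ind.
by have [y [chi []]] := toric_coordinates q0 qf x'P tauP n'n.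
Qed.

(** Every x^d d/dx_v with d supported on a face of D is transported to a derivation
    whose weight is a root of the target. *)
Lemma cone_comparison n (D D' : simplicial_complex n)
    (f : aut (poly_alg (sr_alg k D)) -> aut (poly_alg (sr_alg k D'))) :
  {morph f : g h / (g * h)%g} -> injective f ->
  ind_morphism (aut_ind_variety _) (aut_ind_variety _) f ->
  exists (s : 'S_n.+1) (B : {set 'I_n.+1}),
  (forall S : {set 'I_n.+1}, S \in cone D -> ord_max \notin S ->
     (s @: S) :|: B \in cone D') /\
  (forall S : {set 'I_n.+1}, S \in cone D' -> B \subset S ->
     s ord_max |: S \in cone D').
Proof.
move=> f_mul f_inj f_ind; have [pi xP] := cylinder_coordinates k D.
have [pi' x'P] := cylinder_coordinates k D'.
have q0 := two_neq0 char0; have qf := two_free char0.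
have [tau [tauP tauD]] :=
  transported_torus char0 q0 qf xP (@cone_apex _ D) f_mul f_inj f_ind.
have [y [chi [_ ychi chifree yC yspan]]] := toric_coordinates q0 qf x'P tauP (leqnn _).
apply: (roots_permutation chifree) => d d0 dC.
have [dd ddP] := tauD d d0 dC.
exact: (derivation_root char0 q0 qf tauP ychi chifree yC yspan ddP).
Qed.

End Comparison.

Lemma complex_isomorphic_sr_variety (k : closedFieldType) n n'
    (D : simplicial_complex n) (D' : simplicial_complex n') :
  complex_isomorphic D D' -> var_isomorphic (sr_variety k D) (sr_variety k D').
Proof.
move=> [f [[g fK gK] fD]].
have [s sD|phi phiE] := @sr_morphism k n D (sr_ring k D') (fun i => sr_gen k D' (f i)).
  rewrite -[RHS](@sr_gen_nonface k n' D' (f @: s)) -?fD //.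
  by rewrite big_imset //= => i j _ _; exact: (can_inj fK).
have gD (s : {set 'I_n'}) : (s \in D') = (g @: s \in D).
  by rewrite fD -imset_comp (eq_imset (g := id)) ?imset_id.
have [s sD|psi psiE] := @sr_morphism k n' D' (sr_ring k D) (fun i => sr_gen k D (g i)).
  rewrite -[RHS](@sr_gen_nonface k n D (g @: s)) -?gD //.
  by rewrite big_imset //= => i j _ _; exact: (can_inj gK).
have phiK : cancel phi psi.
  by apply: (@fg_ext k (sr_alg k D) _ (psi \o phi) idfun) => i /=; rewrite phiE psiE fK.
have psiK : cancel psi phi.
  by apply: (@fg_ext k (sr_alg k D') _ (phi \o psi) idfun) => i /=; rewrite psiE phiE gK.
exists (fun p : spec_point (sr_alg k D) => (p \o psi : spec_point (sr_alg k D'))).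
exists (fun p : spec_point (sr_alg k D') => (p \o phi : spec_point (sr_alg k D))).
split.
- by move=> p; apply: lrmorphism_ext => a /=; rewrite phiK.
- by move=> p; apply: lrmorphism_ext => a /=; rewrite psiK.
- by move=> _ [a ->]; exists (psi a).
- by move=> _ [a ->]; exists (phi a).
Qed.

Theorem corollary4p12 (k : closedFieldType) (char0 : [pchar k] =i pred0)
    (n n' : nat) (n_gt0 : (0 < n)%N) (n'_gt0 : (0 < n')%N)
    (D : simplicial_complex n) (D' : simplicial_complex n') :
  ind_group_isomorphic (aut_cylinder k D) (aut_cylinder k D') ->
  complex_isomorphic D D' /\ var_isomorphic (sr_variety k D) (sr_variety k D').
Proof.
move=> [f [g [fK gK f_mul f_ind g_ind]]].
have g_mul : {morph g : a b / (a * b)%g}.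
  by move=> a b; rewrite -[a]gK -[b]gK -f_mul !fK.
have f_inj := can_inj fK; have g_inj := can_inj gK.
suff DD' : complex_isomorphic D D'.
  by split=> //; exact: complex_isomorphic_sr_variety.
have nn' : n = n'.
  apply/eqP; rewrite eqn_leq; case/orP: (leq_total n' n) => le; rewrite le ?andbT.
    exact: (rank_bound char0 f_mul f_inj f_ind le).
  exact: (rank_bound char0 g_mul g_inj g_ind le).
subst n'.
have [s [B [sB sv]]] := cone_comparison char0 f_mul f_inj f_ind.
have [t [B' [tB tv]]] := cone_comparison char0 g_mul g_inj g_ind.
have [ap sE] := star_isomorphism (@cone_apex _ D) sB sv
  (card_star_le (@cone_apex _ D') tB tv).
exact: cone_cancel ap sE.
Qed.
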